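(* Suppose $Q:\mathbb{D}^2\to\mathbb{C}$ is a holomorphic function with $Q(z,0)=Q(0,w)=0$ for all $z,w\in\mathbb{D}$, which solves the linear damped wave equation $$\partial_z\partial_wQ(z,w)=\frac{z^2\partial_zQ(z,w)-w^2\partial_wQ(z,w)}{zw(z-w)},\qquad(z,w)\in\mathbb{D}^2.$$ Then $Q$ has the form $Q=\mathscr{Q}[\mathrm{M}_\mu]$ for some $\mu$ in the closed unit ball of $L^\infty(\mathbb{D})$ if and only if $$\Big|\int_{\mathbb{D}}z^{-2}Q(z,z)\,\overline{f(z)}\,\mathrm{dA}(z)\Big|\le\|f\|_{A^1(\mathbb{D})},\qquad f\in A^1(\mathbb{D}).$$
   Context: $\mathbb{D}$ is the open unit disk, $\mathrm{dA}=\mathrm{d}x\,\mathrm{d}y/\pi$, $\langle f,g\rangle_{\mathbb{D}}=\int_{\mathbb{D}}f\bar g\,\mathrm{dA}$. $A^1(\mathbb{D})$ is the space of holomorphic $f$ on $\mathbb{D}$ with $\|f\|_{A^1(\mathbb{D})}=\int_{\mathbb{D}}|f|\,\mathrm{dA}<\infty$. $\mathrm{M}_\mu$ is multiplication by $\mu$ on $L^2(\mathbb{D})$. For a bounded operator $\mathrm{T}$ on $L^2(\mathbb{D})$, $\mathscr{Q}[\mathrm{T}](z,w)=zw\langle\mathrm{T}(\bar s_w),s_z\rangle_{\mathbb{D}}$ on $\mathbb{D}^2$, where $s_z(\zeta)=(1-\bar z\zeta)^{-1}$ and $\bar s_w$ is the complex conjugate of $s_w$. The wave equation is understood via removable singularities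 where $zw(z-w)=0$ (equivalently, after multiplication by $zw(z-w)$). The function $g(z)=z^{-2}Q(z,z)$ is holomorphic on $\mathbb{D}$, and the integral $\int_{\mathbb{D}}g\bar f\,\mathrm{dA}$ is understood as the limit $\lim_{r\to1^-}\int_{\mathbb{D}}g(z)\overline{f(rz)}\,\mathrm{dA}(z)$; the condition includes that these integrals and the limit exist. *)

(* Defs.v *)
From HB Require Import structures.
From mathcomp Require Import all_boot all_order all_algebra.
From mathcomp.real_closed Require Import complex.
From mathcomp Require Import all_classical all_reals all_analysis.

Set Implicit Arguments.
Unset Strict Implicit.
Unset Printing Implicit Defensive.

Import Order.TTheory GRing.Theory Num.Theory.
Import numFieldNormedType.Exports.

Local Open Scope classical_set_scope.
Local Open Scope ring_scope.
Local Open Scope complex_scope.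

(* The library equips every numeric field [K] with the topology and norm of
   [K^o], but canonical structure inference does not see through the concrete
   type [R[i]]; these instances are the same structures, by conversion. *)
HB.instance Definition _ (R : realType) := GRing.ComAlgebra.copy R[i] R[i]^o.
HB.instance Definition _ (R : realType) := Vector.copy R[i] R[i]^o.
HB.instance Definition _ (R : realType) := NormedModule.copy R[i] R[i]^o.

Notation cnorm := ComplexField.Normc.normc.

Section Disk.
Context {R : realType}.
Local Notation C := R[i].

Definition disk : set C := [set z | cnorm z < 1].

Definition of_plane (p : measurableTypeR R * measurableTypeR R) : C :=
  p.1 +i* p.2.

Definition plane_disk : set (measurableTypeR R * measurableTypeR R) :=
  of_plane @^-1` disk.

Definition invpi_ge0 : 0 <= (pi : R)^-1.
Proof. by rewrite invr_ge0 pi_ge0. Qed.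

(* dA = dx dy / pi *)
Definition dA :
    {measure set (measurableTypeR R * measurableTypeR R) -> \bar R} :=
  mscale (NngNum invpi_ge0) (@lebesgue_measure R \x @lebesgue_measure R)%E.

Definition disk_measurable (f : C -> C) : Prop :=
  measurable_fun plane_disk (@complex.Re R \o f \o of_plane) /\
  measurable_fun plane_disk (@complex.Im R \o f \o of_plane).

Definition disk_integrable (f : C -> C) : Prop :=
  dA.-integrable plane_disk (EFin \o @complex.Re R \o f \o of_plane) /\
  dA.-integrable plane_disk (EFin \o @complex.Im R \o f \o of_plane).

Definition disk_integral (f : C -> C) : C :=
  (\int[dA]_(p in plane_disk) complex.Re (f (of_plane p))) +i*
  (\int[dA]_(p in plane_disk) complex.Im (f (of_plane p))).

Definition inner_disk (f g : C -> C) : C :=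
  disk_integral (fun z => f z * (g z)^*).

(* A function on C stands for its restriction to the disk; neither predicate
   depends on the values outside. *)
Definition holomorphic_disk (f : C -> C) : Prop :=
  forall z, disk z -> derivable f z 1.

Definition holomorphic_bidisk (Q : C -> C -> C) : Prop :=
  forall z w, disk z -> disk w ->
    differentiable (fun p : C * C => Q p.1 p.2) (z, w).

Definition A1norm (f : C -> C) : \bar R :=
  (\int[dA]_(p in plane_disk) (cnorm (f (of_plane p)))%:E)%E.

Definition A1 : set (C -> C) :=
  [set f | holomorphic_disk f /\ (A1norm f < +oo)%E].

Definition Linfty_norm (mu : C -> C) : \bar R :=
  Lnorm dA +oo ((fun p => (cnorm (mu (of_plane p)))%:E) \_ plane_disk).

Definition Linfty_closed_unit_ball : set (C -> C) :=
  [set mu | disk_measurable mu /\ (Linfty_norm mu <= 1)%E].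

Definition szego (z zeta : C) : C := (1 - z^* * zeta)^-1.

(* Operators on L^2 of the disk are given by their action on representatives. *)
Definition mul_op (mu : C -> C) : (C -> C) -> (C -> C) :=
  fun f zeta => mu zeta * f zeta.

Definition scrQ (T : (C -> C) -> (C -> C)) (z w : C) : C :=
  z * w * inner_disk (T (fun zeta => (szego w zeta)^*)) (szego z).

Definition d_z (Q : C -> C -> C) (z w : C) : C := derive1 (Q^~ w) z.
Definition d_w (Q : C -> C -> C) (z w : C) : C := derive1 (Q z) w.

(* The equation d_z d_w Q = (z^2 d_z Q - w^2 d_w Q) / (z w (z - w)), with the
   removable singularities cleared by multiplying by z w (z - w). *)
Definition damped_wave (Q : C -> C -> C) : Prop :=
  forall z w, disk z -> disk w ->
    z * w * (z - w) * d_z (d_w Q) z w =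
    z ^+ 2 * d_z Q z w - w ^+ 2 * d_w Q z w.

(* z^-2 Q(z,z); at the removable singularity z = 0 this takes the value 0,
   which does not affect integrals. *)
Definition diag (Q : C -> C -> C) (z : C) : C := z ^- 2 * Q z z.

(* [L] is the integral over the disk of g times the conjugate of f, in the
   sense of the limit of the dilates of f as r tends to 1 from below. *)
Definition is_dilated_pairing (g f : C -> C) (L : C) : Prop :=
  (forall r : R, 0 < r < 1 ->
     disk_integrable (fun z => g z * (f (r%:C * z))^*)) /\
  inner_disk g (fun z => f (r%:C * z)) @[r --> (1 : R)^'-] --> L.

End Disk.

(* Main.v *)
From HB Require Import structures.
Require Import Defs.
From mathcomp Require Import all_boot all_order all_algebra.
From mathcomp.real_closed Require Import complex.
From mathcomp Require Import all_classical all_reals all_analysis.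
From mathcomp Require Import measurable_realfun ess_sup_inf.
From mathcomp Require Import ring lra.

Import Order.TTheory GRing.Theory Num.Theory.
Import numFieldNormedType.Exports.

Local Open Scope classical_set_scope.
Local Open Scope ring_scope.
Local Open Scope complex_scope.

(* Put m_n for the integral of mu(u) conj(u)^n.  Partial fractions in the Szego
   kernels give
     (z - w) scrQ[M_mu](z, w) = z w sum_n m_n (z^(n+1) - w^(n+1)).
   For a solution Q and fixed w, the function N = (z - w) w d_w Q - z Q satisfies
   z d_z N = N, so N is linear in z.  This is a first-order equation in w for
   z0 (z - w) Q(z, w) - z (z0 - w) Q(z0, w), and the same argument yields
     z0 (z - w) Q(z, w) = z B(w) - w B(z)  with  B(w) = (z0 - w) Q(z0, w).
   Hence Q has the above expansion, m_n being read off the Taylor series of B, and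
   z^-2 Q(z, z) = sum_n (n + 1) m_n z^n.  So Q = scrQ[M_mu] exactly when mu has the
   moments m_n.  If such a mu exists, z^-2 Q(z, z) is integrable (Bessel and Fatou)
   with the same moments as mu, so both pair equally with dilates of f, and the
   pairing tends to the integral of mu conj(f).  Conversely the inequality for
   polynomials f bounds sum_n m_n conj(f_n) by the L^1 norm of f; Hahn-Banach and
   Radon-Nikodym extend this functional to the integral against a mu with
   |mu| <= 1. *)

(** Since the integral of |z|^(2 n) is 1 / (n + 1), the sum of (n + 1) m_n z^n is the Bergman
    projection of mu. That projection does not preserve boundedness: z^-2 Q(z, z) is square
    integrable, but its product with the conjugate of an f in A^1 need not be integrable, and its
    Taylor series cannot be integrated termwise by domination on the whole disk. Dilation is the
    remedy throughout: the Taylor series of f(r z) converges uniformly on the disk, and f(r z) tends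
    to f in L^1 as r tends to 1. In B the constant coefficient vanishes by the boundary condition
    and the linear one cancels in z B(w) - w B(z), so that m_n sits in the coefficient of order n +
    2. In the converse the Hahn-Banach theorem is applied over the reals, to the real part of the
    functional on pairs of real functions. The bound |mu| <= 1 comes from testing the extension on
    the phase of its density where that density exceeds 1 in modulus, which shows this set to be
    null. *)

Section ComplexNorm.
Context {R : realType}.
Local Notation C := R[i].
Implicit Types (x y z : C).

Lemma cnormE z : cnorm z = Num.sqrt (complex.Re z ^+ 2 + complex.Im z ^+ 2).
Proof. by case: z. Qed.

Lemma cnorm_ge0 z : 0 <= cnorm z.
Proof. by rewrite cnormE sqrtr_ge0. Qed.

Lemma cnorm0 : cnorm (0 : C) = 0.
Proof. exact: ComplexField.Normc.normc0. Qed.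

Lemma cnorm1 : cnorm (1 : C) = 1.
Proof. exact: ComplexField.Normc.normc1. Qed.

Lemma cnorm_eq0 z : (cnorm z == 0) = (z == 0).
Proof.
by apply/eqP/eqP => [/ComplexField.Normc.eq0_normc|->] //; rewrite cnorm0.
Qed.

Lemma cnorm_gt0 z : (0 < cnorm z) = (z != 0).
Proof. by rewrite lt_neqAle eq_sym cnorm_ge0 andbT cnorm_eq0. Qed.

Lemma cnormM x y : cnorm (x * y) = cnorm x * cnorm y.
Proof. exact: ComplexField.Normc.normcM. Qed.

Lemma cnormV x : cnorm x^-1 = (cnorm x)^-1.
Proof. exact: ComplexField.Normc.normcV. Qed.

Lemma cnormN x : cnorm (- x) = cnorm x.
Proof. by case: x => a b /=; rewrite !sqrrN. Qed.

Lemma cnormD x y : cnorm (x + y) <= cnorm x + cnorm y.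
Proof. exact: le_normcD. Qed.

Lemma cnormB x y : cnorm (x - y) <= cnorm x + cnorm y.
Proof. by rewrite (le_trans (cnormD _ _))// cnormN. Qed.

Lemma cdistC x y : cnorm (x - y) = cnorm (y - x).
Proof. by rewrite -cnormN opprB. Qed.

Lemma cdist_le x y : cnorm x <= cnorm y + cnorm (x - y).
Proof. by rewrite -{1}(subrKC y x); exact: cnormD. Qed.

Lemma cnormX z n : cnorm (z ^+ n) = cnorm z ^+ n.
Proof.
elim: n => [|n IH]; first by rewrite !expr0 cnorm1.
by rewrite !exprS cnormM IH.
Qed.

Lemma cnormR (a : R) : cnorm a%:C = `|a|.
Proof. by rewrite /= expr0n addr0 sqrtr_sqr. Qed.

Lemma cnorm_nat n : cnorm (n%:R : C) = n%:R.
Proof. by rewrite -[n%:R](rmorph_nat (real_complex R)) cnormR ger0_norm. Qed.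

Lemma cnormJ z : cnorm (conjc z) = cnorm z.
Proof. by case: z => a b /=; rewrite sqrrN. Qed.

Lemma cnormi : cnorm ('i : C) = 1.
Proof. by rewrite /= expr0n add0r expr1n sqrtr1. Qed.

Lemma normr_cnorm z : `|z| = (cnorm z)%:C.
Proof. by []. Qed.

Lemma Re_le_cnorm z : `|complex.Re z| <= cnorm z.
Proof. by rewrite cnormE -sqrtr_sqr ler_wsqrtr// lerDl sqr_ge0. Qed.

Lemma Im_le_cnorm z : `|complex.Im z| <= cnorm z.
Proof. by rewrite cnormE -sqrtr_sqr ler_wsqrtr// lerDr sqr_ge0. Qed.

Lemma cnorm_le_ReIm z : cnorm z <= `|complex.Re z| + `|complex.Im z|.
Proof.
rewrite cnormE -(ger0_norm (addr_ge0 (normr_ge0 _) (normr_ge0 _))) -sqrtr_sqr.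
rewrite ler_wsqrtr// sqrrD !real_normK ?num_real//.
by rewrite -addrA lerD2l lerDr mulrn_wge0// mulr_ge0.
Qed.

Lemma cnorm_sqr z : cnorm z ^+ 2 = complex.Re z ^+ 2 + complex.Im z ^+ 2.
Proof. by rewrite cnormE sqr_sqrtr// addr_ge0// sqr_ge0. Qed.

Lemma conj_conjc z : Num.conj z = conjc z.
Proof. by []. Qed.

Lemma mulcJ z : z * conjc z = (cnorm z ^+ 2)%:C.
Proof. by rewrite cnorm_sqr; case: z => a b /=; rewrite /GRing.mul /=; congr Complex; ring. Qed.

Lemma cnorm_sum I (r : seq I) (P : pred I) (F : I -> C) :
  cnorm (\sum_(i <- r | P i) F i) <= \sum_(i <- r | P i) cnorm (F i).
Proof.
elim/big_rec2: _ => [|i y x _ le_xy]; first by rewrite cnorm0.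
by apply: le_trans (cnormD _ _) _; rewrite lerD2l.
Qed.

Lemma ReD x y : complex.Re (x + y) = complex.Re x + complex.Re y.
Proof. by case: x y => [a b] [c d]. Qed.
Lemma ImD x y : complex.Im (x + y) = complex.Im x + complex.Im y.
Proof. by case: x y => [a b] [c d]. Qed.
Lemma ReN x : complex.Re (- x) = - complex.Re x.
Proof. by case: x. Qed.
Lemma ImN x : complex.Im (- x) = - complex.Im x.
Proof. by case: x. Qed.
Lemma ReM x y : complex.Re (x * y) =
  complex.Re x * complex.Re y - complex.Im x * complex.Im y.
Proof. by case: x y => [a b] [c d]. Qed.
Lemma ImM x y : complex.Im (x * y) =
  complex.Re x * complex.Im y + complex.Im x * complex.Re y.
Proof. by case: x y => [a b] [c d]. Qed.
Lemma ReJ x : complex.Re (conjc x) = complex.Re x. Proof. by case: x. Qed.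
Lemma ImJ x : complex.Im (conjc x) = - complex.Im x. Proof. by case: x. Qed.

Lemma complex_ext x y : complex.Re x = complex.Re y ->
  complex.Im x = complex.Im y -> x = y.
Proof. by case: x y => [a b] [c d] /= -> ->. Qed.

Lemma conjcM x y : conjc (x * y) = conjc x * conjc y. Proof. exact: rmorphM. Qed.
Lemma conjcD x y : conjc (x + y) = conjc x + conjc y. Proof. exact: rmorphD. Qed.
Lemma conjcB x y : conjc (x - y) = conjc x - conjc y. Proof. exact: rmorphB. Qed.
Lemma conjcX x n : conjc (x ^+ n) = conjc x ^+ n. Proof. exact: rmorphXn. Qed.
Lemma conjc_sum I (r : seq I) (F : I -> C) :
  conjc (\sum_(i <- r) F i) = \sum_(i <- r) conjc (F i).
Proof. exact: rmorph_sum. Qed.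

End ComplexNorm.

(** * Complex-valued integrals *)

Section ComplexIntegral.
Context {R : realType} {d : measure_display} {T : measurableType d}.
Local Notation C := R[i].
Variable mu : {measure set T -> \bar R}.
Implicit Types (D : set T) (f g : T -> C).

Definition cmeasurable D f :=
  measurable_fun D (@complex.Re R \o f) /\ measurable_fun D (@complex.Im R \o f).

Definition cintegrable D f :=
  mu.-integrable D (EFin \o (@complex.Re R \o f)) /\
  mu.-integrable D (EFin \o (@complex.Im R \o f)).

Definition cint D f : C :=
  (\int[mu]_(x in D) complex.Re (f x)) +i* (\int[mu]_(x in D) complex.Im (f x)).

Lemma cmeasurable_cst D (c : C) : cmeasurable D (cst c).
Proof. by split; exact: measurable_cst. Qed.

Lemma cmeasurableD D f g : cmeasurable D f -> cmeasurable D g ->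
  cmeasurable D (fun x => f x + g x).
Proof.
move=> [f1 f2] [g1 g2]; split.
  by rewrite (_ : _ \o _ = (@complex.Re R \o f) \+ (@complex.Re R \o g)); [exact: measurable_funD|apply/funext => x; exact: ReD].
by rewrite (_ : _ \o _ = (@complex.Im R \o f) \+ (@complex.Im R \o g)); [exact: measurable_funD|apply/funext => x; exact: ImD].
Qed.

Lemma cmeasurableM D f g : cmeasurable D f -> cmeasurable D g ->
  cmeasurable D (fun x => f x * g x).
Proof.
move=> [f1 f2] [g1 g2]; split.
  rewrite (_ : _ \o _ = ((@complex.Re R \o f) \* (@complex.Re R \o g)) \- ((@complex.Im R \o f) \* (@complex.Im R \o g))).
    by apply: measurable_funB; apply: measurable_funM.
  by apply/funext => x; exact: ReM.
rewrite (_ : _ \o _ = ((@complex.Re R \o f) \* (@complex.Im R \o g)) \+ ((@complex.Im R \o f) \* (@complex.Re R \o g))).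
  by apply: measurable_funD; apply: measurable_funM.
by apply/funext => x; exact: ImM.
Qed.

Lemma cmeasurableN D f : cmeasurable D f -> cmeasurable D (fun x => - f x).
Proof.
move=> mf; have := cmeasurableM _ _ _ (cmeasurable_cst D (-1)) mf.
by rewrite (_ : (fun x => _ * _) = (fun x => - f x))//; apply/funext => x; rewrite /= mulN1r.
Qed.

Lemma cmeasurableB D f g : cmeasurable D f -> cmeasurable D g ->
  cmeasurable D (fun x => f x - g x).
Proof. by move=> mf /cmeasurableN; exact: cmeasurableD. Qed.

Lemma cmeasurableJ D f : cmeasurable D f -> cmeasurable D (fun x => conjc (f x)).
Proof.
move=> [f1 f2]; split.
  by rewrite (_ : _ \o _ = @complex.Re R \o f)//; apply/funext => x; exact: ReJ.
rewrite (_ : _ \o _ = \- (@complex.Im R \o f)); first exact: measurable_funN.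
by apply/funext => x; exact: ImJ.
Qed.

Lemma cmeasurableX D f n : cmeasurable D f -> cmeasurable D (fun x => f x ^+ n).
Proof.
move=> mf; elim: n => [|n IH].
  by rewrite (_ : (fun x => _) = cst 1); [exact: cmeasurable_cst|apply/funext => x; rewrite expr0].
rewrite (_ : (fun x => _) = (fun x => f x * f x ^+ n)); first exact: cmeasurableM.
by apply/funext => x; rewrite exprS.
Qed.

Lemma cmeasurable_sum D I (r : seq I) (F : I -> T -> C) :
  (forall i, cmeasurable D (F i)) ->
  cmeasurable D (fun x => \sum_(i <- r) F i x).
Proof.
move=> mF; elim: r => [|i r IH].
  by rewrite (_ : (fun x => _) = cst 0); [exact: cmeasurable_cst|apply/funext => x; rewrite big_nil].
rewrite (_ : (fun x => _) = (fun x => F i x + \sum_(j <- r) F j x)).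
  exact: cmeasurableD.
by apply/funext => x; rewrite big_cons.
Qed.

Lemma measurable_cnorm D f : cmeasurable D f ->
  measurable_fun D (fun x => cnorm (f x)).
Proof.
move=> [f1 f2]; rewrite (_ : (fun x => _) = Num.sqrt \o
    (fun x => (@complex.Re R \o f) x ^+ 2 + (@complex.Im R \o f) x ^+ 2)); last first.
  by apply/funext => x; rewrite /= cnormE.
apply: measurableT_comp.
  by apply: continuous_measurable_fun; exact: sqrt_continuous.
by apply: measurable_funD; apply: measurable_funX.
Qed.

(** Convergence of complex sequences is stated, here and below, as convergence to 0 of the real
    sequence [cnorm (h n x - f x)], so that limits reduce to squeezing real sequences. *)
Lemma cmeasurable_lim D (h : nat -> T -> C) f :
  (forall n, cmeasurable D (h n)) ->
  (forall x, D x -> cnorm (h n x - f x) @[n --> \oo] --> (0 : R)) ->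
  cmeasurable D f.
Proof.
move=> mh hf; split; apply: (measurable_fun_cvg (h := fun n => _ \o h n)).
- by move=> n; exact: (mh n).1.
- move=> x /hf /cvgr0Pnorm_lt hx; apply/cvgrPdist_lt => e e0.
  near=> n; apply: (@le_lt_trans _ _ `|cnorm (h n x - f x)|); last by near: n; exact: hx.
  rewrite /= distrC -ReN -ReD; exact: le_trans (Re_le_cnorm _) (ler_norm _).
- by move=> n; exact: (mh n).2.
- move=> x /hf /cvgr0Pnorm_lt hx; apply/cvgrPdist_lt => e e0.
  near=> n; apply: (@le_lt_trans _ _ `|cnorm (h n x - f x)|); last by near: n; exact: hx.
  rewrite /= distrC -ImN -ImD; exact: le_trans (Im_le_cnorm _) (ler_norm _).
Unshelve. all: by end_near. Qed.

Lemma cintegrable_measurable D f : cintegrable D f -> cmeasurable D f.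
Proof.
move=> [/measurable_int f1 /measurable_int f2].
by split; apply/measurable_EFinP.
Qed.

Section OnMeasurableSet.
Variables (D : set T) (mD : measurable D).

Lemma cintegrable_le f (g : T -> R) : cmeasurable D f ->
  mu.-integrable D (EFin \o g) -> (forall x, D x -> cnorm (f x) <= g x) ->
  cintegrable D f.
Proof.
move=> [f1 f2] ig fg; split; apply: (le_integrable mD _ _ ig).
- exact/measurable_EFinP.
- move=> x Dx /=; rewrite lee_fin; apply: le_trans (Re_le_cnorm _) _.
  exact: le_trans (fg _ Dx) (ler_norm _).
- exact/measurable_EFinP.
- move=> x Dx /=; rewrite lee_fin; apply: le_trans (Im_le_cnorm _) _.
  exact: le_trans (fg _ Dx) (ler_norm _).
Qed.

Lemma cintegrable_norm f : cintegrable D f ->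
  mu.-integrable D (EFin \o (fun x => cnorm (f x))).
Proof.
move=> If; have [f1 f2] := If.
have := integrableD mD (integrable_abse f1) (integrable_abse f2).
apply: le_integrable => //.
  by apply/measurable_EFinP/measurable_cnorm/cintegrable_measurable.
move=> x Dx /=; rewrite lee_fin [X in X <= _]ger0_norm ?cnorm_ge0//.
by rewrite [X in _ <= X]ger0_norm ?addr_ge0//; exact: cnorm_le_ReIm.
Qed.

Lemma eq_cintegrable f g : {in D, f =1 g} -> cintegrable D f -> cintegrable D g.
Proof.
move=> fg [f1 f2]; split; [move: f1|move: f2]; apply: eq_integrable => // x xD /=; by rewrite fg.
Qed.

Lemma eq_cint f g : {in D, f =1 g} -> cint D f = cint D g.
Proof. by move=> fg; congr Complex; apply: eq_Rintegral => x xD; rewrite fg. Qed.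

Lemma cintegrableD f g : cintegrable D f -> cintegrable D g ->
  cintegrable D (fun x => f x + g x).
Proof.
move=> [f1 f2] [g1 g2]; split.
  apply: eq_integrable (integrableD mD f1 g1) => // x _.
  by rewrite /= ReD.
apply: eq_integrable (integrableD mD f2 g2) => // x _.
by rewrite /= ImD.
Qed.

Lemma cintD f g : cintegrable D f -> cintegrable D g ->
  cint D (fun x => f x + g x) = cint D f + cint D g.
Proof.
move=> [f1 f2] [g1 g2]; apply: complex_ext; rewrite ?ReD ?ImD /=.
  by rewrite -RintegralD//; apply: eq_Rintegral => x _; rewrite ReD.
by rewrite -RintegralD//; apply: eq_Rintegral => x _; rewrite ImD.
Qed.

Lemma cintegrableM_bounded f g (M : R) : cmeasurable D f ->
  (forall x, D x -> cnorm (f x) <= M) -> cintegrable D g ->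
  cintegrable D (fun x => f x * g x).
Proof.
move=> mf fM Ig.
apply: (cintegrable_le _ (fun x => M * cnorm (g x))).
- by apply: cmeasurableM => //; exact: cintegrable_measurable.
- have := integrableZl mD M (cintegrable_norm _ Ig).
  by apply: eq_integrable => // x _; rewrite /= EFinM.
- by move=> x Dx; rewrite cnormM ler_wpM2r ?cnorm_ge0 ?fM.
Qed.

Lemma cintegrableZ (c : C) f : cintegrable D f ->
  cintegrable D (fun x => c * f x).
Proof.
move=> If; apply: (cintegrableM_bounded _ _ (cnorm c)) => //.
exact: cmeasurable_cst.
Qed.

Lemma cintZ (c : C) f : cintegrable D f ->
  cint D (fun x => c * f x) = c * cint D f.
Proof.
move=> [f1 f2]; have i1 k := integrableZl mD k f1.
have i2 k := integrableZl mD k f2.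
have j1 k : mu.-integrable D (EFin \o (fun x => k * complex.Re (f x))).
  by apply: eq_integrable (i1 k) => // x _; rewrite /= EFinM.
have j2 k : mu.-integrable D (EFin \o (fun x => k * complex.Im (f x))).
  by apply: eq_integrable (i2 k) => // x _; rewrite /= EFinM.
apply: complex_ext; rewrite ?ReM ?ImM /=.
  by rewrite -!RintegralZl// -RintegralB//; apply: eq_Rintegral => x _; rewrite ReM.
by rewrite -!RintegralZl// -RintegralD//; apply: eq_Rintegral => x _; rewrite ImM.
Qed.

Lemma cintegrableN f : cintegrable D f -> cintegrable D (fun x => - f x).
Proof.
move=> /(cintegrableZ (-1)); apply: eq_cintegrable => x _; by rewrite mulN1r.
Qed.

Lemma cintN f : cintegrable D f -> cint D (fun x => - f x) = - cint D f.
Proof.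
move=> If; rewrite -mulN1r -cintZ//; apply: eq_cint => x _; by rewrite mulN1r.
Qed.

Lemma cintegrableB f g : cintegrable D f -> cintegrable D g ->
  cintegrable D (fun x => f x - g x).
Proof. by move=> If /cintegrableN; exact: cintegrableD. Qed.

Lemma cintB f g : cintegrable D f -> cintegrable D g ->
  cint D (fun x => f x - g x) = cint D f - cint D g.
Proof. by move=> If Ig; rewrite cintD ?cintN//; exact: cintegrableN. Qed.

Lemma cint0 : cint D (fun=> 0) = 0.
Proof. by apply: complex_ext; rewrite /= Rintegral_cst// mul0r. Qed.

Lemma cintegrable0 : cintegrable D (fun=> 0).
Proof. by split; exact: (integrable0 mu). Qed.

Lemma cintegrable_sum I (r : seq I) (F : I -> T -> C) :
  (forall i, cintegrable D (F i)) ->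
  cintegrable D (fun x => \sum_(i <- r) F i x).
Proof.
move=> IF; elim: r => [|i r IH].
  by apply: eq_cintegrable cintegrable0 => x _; rewrite big_nil.
by apply: eq_cintegrable (cintegrableD _ _ (IF i) IH) => x _; rewrite big_cons.
Qed.

Lemma cint_sum I (r : seq I) (F : I -> T -> C) :
  (forall i, cintegrable D (F i)) ->
  cint D (fun x => \sum_(i <- r) F i x) = \sum_(i <- r) cint D (F i).
Proof.
move=> IF; elim: r => [|i r IH].
  by rewrite [RHS]big_nil -[RHS]cint0; apply: eq_cint => x _; rewrite big_nil.
rewrite big_cons -IH -cintD//; last exact: cintegrable_sum.
by apply: eq_cint => x _; rewrite big_cons.
Qed.

Lemma cintJ f : cintegrable D f -> cint D (fun x => conjc (f x)) = conjc (cint D f).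
Proof.
move=> [_ f2]; apply: complex_ext; rewrite ?ReJ ?ImJ /=.
  by apply: eq_Rintegral => x _; rewrite ReJ.
rewrite -mulN1r -RintegralZl//; apply: eq_Rintegral => x _.
by rewrite ImJ mulN1r.
Qed.

Lemma cintegrableJ f : cintegrable D f -> cintegrable D (fun x => conjc (f x)).
Proof.
move=> /[dup] If /cintegrable_norm/(cintegrable_le (fun x => conjc (f x))); apply.
  exact/cmeasurableJ/cintegrable_measurable.
by move=> x _; rewrite cnormJ.
Qed.

Lemma cnorm_cint_le f : cintegrable D f ->
  cnorm (cint D f) <= \int[mu]_(x in D) cnorm (f x).
Proof.
move=> If; have [->|I0] := eqVneq (cint D f) 0.
  by rewrite cnorm0 Rintegral_ge0// => x _; exact: cnorm_ge0.
have nI0 : 0 < cnorm (cint D f) by rewrite cnorm_gt0.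
(* The unimodular factor that turns the integral onto the positive real axis, where its norm is the
   real part of an integral. *)
set u := conjc (cint D f) / (cnorm (cint D f))%:C.
have u1 : cnorm u = 1.
  by rewrite /u cnormM cnormV cnormR ger0_norm ?cnorm_ge0// cnormJ divff// gt_eqF.
have uI : u * cint D f = (cnorm (cint D f))%:C.
  rewrite /u mulrAC [conjc _ * _]mulrC mulcJ.
  rewrite expr2 rmorphM /= mulfK//; rewrite -cnorm_eq0 cnormR ger0_norm ?cnorm_ge0//.
  by rewrite gt_eqF.
have -> : cnorm (cint D f) = complex.Re (cint D (fun x => u * f x)).
  by rewrite cintZ// uI.
apply: le_Rintegral => //.
- by have [] := cintegrableZ u _ If.
- exact: cintegrable_norm.
- move=> x _; apply: le_trans (ler_norm _) _; apply: le_trans (Re_le_cnorm _) _.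
  by rewrite cnormM u1 mul1r.
Qed.

Lemma cint_dominated (f_ : nat -> T -> C) f (g : T -> R) :
  (forall n, cmeasurable D (f_ n)) ->
  (forall x, D x -> cnorm (f_ n x - f x) @[n --> \oo] --> (0 : R)) ->
  mu.-integrable D (EFin \o g) ->
  (forall n x, D x -> cnorm (f_ n x) <= g x) ->
  cintegrable D f /\ cnorm (cint D (f_ n) - cint D f) @[n --> \oo] --> (0 : R).
Proof.
move=> mf_ f_f ig fg; have mf := cmeasurable_lim _ _ _ mf_ f_f.
have fle x : D x -> cnorm (f x) <= g x.
  move=> Dx; apply/ler_addgt0Pl => e e0.
  have /cvgr0Pnorm_lt/(_ _ e0)[n _ /(_ _ (leqnn n))] := f_f _ Dx.
  rewrite ger0_norm ?cnorm_ge0// => ltn.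
  apply: le_trans (cdist_le _ (f_ n x)) _.
  by rewrite addrC lerD//; [rewrite cdistC ltW|exact: fg].
have If_ n : cintegrable D (f_ n) by apply: (cintegrable_le _ g) => // x; exact: fg.
have If : cintegrable D f by exact: (cintegrable_le _ g).
split => //.
have i2g : mu.-integrable D (EFin \o (fun x => 2 * g x)).
  by apply: eq_integrable (integrableZl mD 2 ig) => // x _; rewrite /= EFinM.
have [|||||_ _ ] := @dominated_convergence _ _ _ mu D mD
  (fun n => EFin \o (fun x => cnorm (f_ n x - f x))) (cst 0%E) (EFin \o (fun x => 2 * g x)).
- move=> n; apply/measurable_EFinP/measurable_cnorm/cmeasurableB => //.
- exact: measurable_cst.
- apply: aeW => x Dx /=; apply: cvg_EFin; first by apply: nearW.
  exact: f_f.
- exact: i2g.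
- apply: aeW => x n Dx /=; rewrite lee_fin ger0_norm ?cnorm_ge0//.
  apply: le_trans (cnormB _ _) _; rewrite mulrDl mul1r lerD//; [exact: fg|exact: fle].
rewrite integral0 => /fine_cvg h.
apply: (@squeeze_cvgr _ _ _ _ (cst 0) _ _ _ _ _ h); last exact: cvg_cst.
apply: nearW => n; apply/andP; split; first exact: cnorm_ge0.
rewrite -cintB//; apply: cnorm_cint_le; exact: cintegrableB.
Qed.

End OnMeasurableSet.
End ComplexIntegral.

(** * Complex limits and derivatives through real epsilons *)

Section ComplexTopology.
Context {R : realType}.
Local Notation C := R[i].

Lemma cvg_cnormP (T : Type) (F : set_system T) {FF : Filter F} (f : T -> C) (l : C) :
  f x @[x --> F] --> l <->
  forall e : R, 0 < e -> \forall x \near F, cnorm (l - f x) < e.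
Proof.
split=> [/cvgrPdist_lt h e e0|h].
  have := h e%:C; rewrite -[0 : C]/(0%:C) ltcR => /(_ e0).
  by apply: filterS => x; rewrite normr_cnorm ltcR.
apply/cvgrPdist_lt => -[a b]; rewrite ltcE /= => /andP[/eqP -> a0].
have := h a a0; apply: filterS => x; by rewrite normr_cnorm ltcR.
Qed.

Lemma nbhs_cnormP (z : C) (P : set C) :
  nbhs z P <-> exists2 d : R, 0 < d & forall w, cnorm (z - w) < d -> P w.
Proof.
split=> [/nbhs_normP[[a b] /=]|[d d0 h]].
  rewrite ltcE /= => /andP[/eqP -> a0] h; exists a => // w zw.
  by apply: h; rewrite /= normr_cnorm ltcR.
apply/nbhs_normP; exists d%:C; first by rewrite /= -[0 : C]/(0%:C) ltcR.
by move=> w; rewrite /= normr_cnorm ltcR; exact: h.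
Qed.

(** Differentiability in remainder form: without division by [h] and with a real [e], the linear
    error of Goursat's argument and the quadratic remainder of a Cauchy integral fit it directly. *)
Definition cderiv (f : C -> C) (z l : C) := forall e : R, 0 < e ->
  exists2 d : R, 0 < d &
    forall h, cnorm h < d -> cnorm (f (z + h) - f z - l * h) <= e * cnorm h.

Lemma cderivP (f : C -> C) (z l : C) :
  cderiv f z l <-> derivable f z 1 /\ derive1 f z = l.
Proof.
have key : cderiv f z l <-> h^-1 *: (f (h *: (1 : C) + z) - f z) @[h --> (0 : C)^'] --> l.
  split.
    move=> dl; apply/cvg_cnormP => e e0.
    have e20 : 0 < e / 2 by rewrite divr_gt0.
    have [d d0 hd] := dl _ e20.
    apply/nbhs_cnormP; exists d => // h; rewrite sub0r cnormN => hd' h0.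
    have /hd := hd'; rewrite -ler_pdivrMr ?cnorm_gt0//.
    rewrite -cnormV -cnormM => hle; apply: (@le_lt_trans _ _ (e / 2)); last by rewrite ltr_pdivrMr// mulr2n mulrDr mulr1 ltrDl.
    apply: le_trans hle; rewrite cdistC.
    rewrite le_eqVlt; apply/orP; left; apply/eqP; congr cnorm.
    rewrite /GRing.scale /= mulr1 [h + z]addrC mulrBl mulfK//.
    by rewrite [in LHS]mulrC.
  move=> /cvg_cnormP dl e e0.
  have /nbhs_cnormP[d d0 hd] := dl _ e0.
  exists d => // h; have [->|h0 hd'] := eqVneq h 0.
    by rewrite addr0 subrr mulr0 subr0 cnorm0 mulr0.
  have := hd h; rewrite sub0r cnormN => /(_ hd' h0).
  rewrite /GRing.scale /= mulr1 [h + z]addrC => /ltW hle.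
  rewrite -ler_pdivrMr ?cnorm_gt0// -cnormV -cnormM; apply: le_trans hle.
  rewrite cdistC le_eqVlt; apply/orP; left; apply/eqP; congr cnorm.
  by rewrite mulrBl mulfK// [in LHS]mulrC.
split=> [/key h|[df dl]]; last first.
  by apply/key; rewrite -dl derive1E; exact: df.
split; first by apply/cvg_ex; exists l.
by rewrite derive1E /derive; apply: cvg_lim => //.
Qed.

Lemma derivable_cderiv (f : C -> C) (z : C) :
  derivable f z 1 -> cderiv f z (derive1 f z).
Proof. by move=> df; apply/cderivP. Qed.

Definition ccont (f : C -> C) (z : C) := forall e : R, 0 < e ->
  exists2 d : R, 0 < d & forall w, cnorm (w - z) < d -> cnorm (f w - f z) < e.

Lemma ccontP f z : ccont f z <-> {for z, continuous f}.
Proof.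
split=> [h|/(@cvg_cnormP _ (nbhs z)) h].
  apply/(@cvg_cnormP _ (nbhs z)) => e /h[d d0 hd]; apply/nbhs_cnormP; exists d => // w zw.
  by rewrite cdistC; apply: hd; rewrite cdistC.
move=> e /h /nbhs_cnormP[d d0 hd]; exists d => // w zw.
by rewrite cdistC; apply: hd; rewrite cdistC.
Qed.

Lemma cderiv_cont f z l : cderiv f z l -> ccont f z.
Proof.
move=> df e e0; have [d d0 hd] := df 1 ltr01.
have k0 : 0 < 1 + cnorm l by rewrite ltr_pwDl// cnorm_ge0.
exists (Num.min d (e / (1 + cnorm l))).
  by rewrite lt_min d0 divr_gt0.
move=> w; rewrite lt_min => /andP[wd we].
have := hd _ wd; rewrite subrKC mul1r => hle.
apply: le_lt_trans (cdist_le _ (l * (w - z))) _.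
apply: (@le_lt_trans _ _ (cnorm (w - z) * (1 + cnorm l))).
  apply: le_trans (lerD (lexx _) hle) _.
  by rewrite cnormM [leRHS]mulrDr mulr1 addrC lerD2l mulrC.
by rewrite -ltr_pdivlMr.
Qed.

Lemma ccont_RE (T : topologicalType) (g : T -> C) (t : T) :
  {for t, continuous (@complex.Re R \o g)} ->
  {for t, continuous (@complex.Im R \o g)} -> {for t, continuous g}.
Proof.
move=> /cvgrPdist_lt gr /cvgrPdist_lt gi; apply/(@cvg_cnormP _ (nbhs t)) => e e0.
have e20 : 0 < e / 2 by rewrite divr_gt0.
have := gr _ e20; have := gi _ e20; apply: filterS2 => x h1 h2.
apply: le_lt_trans (cnorm_le_ReIm _) _.
rewrite !(ReD, ImD, ReN, ImN) [ltRHS]splitr; exact: ltrD.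
Qed.

Lemma continuous_Re (T : topologicalType) (g : T -> C) (t : T) :
  {for t, continuous g} -> {for t, continuous (@complex.Re R \o g)}.
Proof.
move=> /(@cvg_cnormP _ (nbhs t)) gr; apply/cvgrPdist_lt => e /gr; apply: filterS => x.
by apply: le_lt_trans; rewrite -ReN -ReD Re_le_cnorm.
Qed.

Lemma continuous_Im (T : topologicalType) (g : T -> C) (t : T) :
  {for t, continuous g} -> {for t, continuous (@complex.Im R \o g)}.
Proof.
move=> /(@cvg_cnormP _ (nbhs t)) gr; apply/cvgrPdist_lt => e /gr; apply: filterS => x.
by apply: le_lt_trans; rewrite -ImN -ImD Im_le_cnorm.
Qed.

Lemma continuous_cnorm (T : topologicalType) (g : T -> C) (t : T) :
  {for t, continuous g} -> {for t, continuous (fun x => cnorm (g x))}.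
Proof.
move=> /(@cvg_cnormP _ (nbhs t)) gr; apply/cvgrPdist_lt => e /gr; apply: filterS => x.
apply: le_lt_trans; rewrite ler_norml; apply/andP; split.
  by rewrite lerNl opprB lerBlDl cdistC; exact: cdist_le.
by rewrite lerBlDl; exact: cdist_le.
Qed.

End ComplexTopology.

(** * Cauchy's formula and Taylor series *)

Section IntervalIntegral.
Context {R : realType}.
Local Notation C := R[i].
Local Notation leb := (@lebesgue_measure R).

Definition rcint (a b : R) (g : R -> C) : C := cint leb `[a, b]%classic g.

Definition cont_on (a b : R) (g : R -> C) :=
  forall x, a <= x <= b -> {for x, continuous g}.

Lemma cont_on_integrable a b g : cont_on a b g ->
  cintegrable leb `[a, b]%classic g.
Proof.
move=> cg; split; apply: continuous_compact_integrable.
- exact: segment_compact.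
- apply: continuous_in_subspaceT => x; rewrite inE /= in_itv /= => xab.
  by apply: continuous_Re; exact: cg.
- exact: segment_compact.
- apply: continuous_in_subspaceT => x; rewrite inE /= in_itv /= => xab.
  by apply: continuous_Im; exact: cg.
Qed.

Lemma rcint_split a c b g : a <= c -> c <= b -> cont_on a b g ->
  rcint a b g = rcint a c g + rcint c b g.
Proof.
move=> ac cb cg; have [i1 i2] := cont_on_integrable _ _ _ cg.
have key (h : R -> R) : leb.-integrable `[a, b] (EFin \o h) ->
    \int[leb]_(t in `[a, b]) h t =
    \int[leb]_(t in `[a, c]) h t + \int[leb]_(t in `[c, b]) h t.
  move=> ih; have ih' : leb.-integrable `]c, b] (EFin \o h).
    by apply: integrableS ih => //; apply: subset_itvr; rewrite bnd_simp.
  rewrite -(@Rintegral_itv_obnd_cbnd _ c)// -(Rintegral_itvB ih) ?bnd_simp//.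
  by rewrite subrKC.
by apply: complex_ext; rewrite ?ReD ?ImD /=; exact: key.
Qed.

Lemma rcint_bound a b g M : a <= b -> cont_on a b g ->
  (forall x, a <= x <= b -> cnorm (g x) <= M) ->
  cnorm (rcint a b g) <= M * (b - a).
Proof.
move=> ab cg gM; have ig := cont_on_integrable _ _ _ cg.
apply: le_trans (cnorm_cint_le _ _ _ _ ig) _ => //.
have -> : M * (b - a) = \int[leb]_(x in `[a, b]) M.
  rewrite Rintegral_cst//= lebesgue_measure_itv/= lte_fin.
  by case: ltP => // ba; congr (_ * _); apply/eqP; rewrite subr_eq0; apply/eqP/le_anti; rewrite ab ba.
apply: le_Rintegral => //.
- exact: cintegrable_norm.
- apply: continuous_compact_integrable; first exact: segment_compact.
  by apply: continuous_subspaceT => x; exact: cvg_cst.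
Qed.

Lemma rcintD a b g h : cont_on a b g -> cont_on a b h ->
  rcint a b (fun x => g x + h x) = rcint a b g + rcint a b h.
Proof. by move=> /cont_on_integrable ? /cont_on_integrable ?; exact: cintD. Qed.

Lemma rcintB a b g h : cont_on a b g -> cont_on a b h ->
  rcint a b (fun x => g x - h x) = rcint a b g - rcint a b h.
Proof. by move=> /cont_on_integrable ? /cont_on_integrable ?; exact: cintB. Qed.

Lemma rcintZ a b c g : cont_on a b g ->
  rcint a b (fun x => c * g x) = c * rcint a b g.
Proof. by move=> /cont_on_integrable ?; exact: cintZ. Qed.

Lemma eq_rcint a b g h : (forall x, a <= x <= b -> g x = h x) ->
  rcint a b g = rcint a b h.
Proof.
move=> gh; apply: eq_cint => x.
by rewrite inE /= in_itv /=; exact: gh.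
Qed.

Lemma rcint_cst a b (c : C) : a <= b -> rcint a b (fun=> c) = (b - a)%:C * c.
Proof.
move=> ab; have key (r : R) : \int[leb]_(x in `[a, b]) r = (b - a) * r.
  rewrite Rintegral_cst//= lebesgue_measure_itv/= lte_fin mulrC.
  by case: ltP => // ba; congr (_ * _); apply/esym/eqP; rewrite subr_eq0; apply/eqP/le_anti; rewrite ab ba.
by apply: complex_ext; rewrite ?ReM ?ImM /= key ?mul0r ?subr0 ?addr0.
Qed.

(** [R[i]] is normed over itself, so the derivative of the curve [G] along the reals is given part
    by part. *)
Lemma rcint_FTC (a b : R) (G g : R -> C) : a <= b ->
  (forall x : R, is_derive x (1 : R) (@complex.Re R \o G) (complex.Re (g x))) ->
  (forall x : R, is_derive x (1 : R) (@complex.Im R \o G) (complex.Im (g x))) ->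
  (forall x, {for x, continuous g}) -> rcint a b g = G b - G a.
Proof.
rewrite le_eqVlt => /predU1P[<- _ _ cg|ab dR dI cg].
  rewrite subrr; apply/eqP; rewrite -cnorm_eq0 eq_le cnorm_ge0 andbT.
  have := rcint_bound a a g (cnorm (g a)) (lexx a) (fun x _ => cg x).
  rewrite subrr mulr0; apply => x /andP[h1 h2].
  by rewrite (@le_anti _ _ x a)// h1 h2.
have key (F f : R -> R) : (forall x : R, is_derive x (1 : R) F (f x)) -> continuous f ->
    \int[leb]_(x in `[a, b]) f x = F b - F a.
  move=> dF cf; rewrite /Rintegral (@continuous_FTC2 _ f F a b)//.
  - exact: continuous_subspaceT.
  - have dF' x : derivable F x 1 by case: (dF x).
    have cF x : {for x, continuous F}.
      by apply/differentiable_continuous/derivable1_diffP.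
    split=> //.
    + by apply: cvg_at_right_filter; exact: cF.
    + by apply: cvg_at_left_filter; exact: cF.
  - by move=> x _; rewrite derive1E; apply: derive_val.
apply: complex_ext; rewrite ?ReD ?ReN ?ImD ?ImN /=; apply: key => //.
- by move=> x; apply: (@continuous_Re _ _ g); exact: cg.
- by move=> x; apply: (@continuous_Im _ _ g); exact: cg.
Qed.

End IntervalIntegral.

(** * Goursat's bisection argument *)

Section Bisection.
Context {R : realType}.
Local Notation C := R[i].

Lemma nested_intervals (u v : nat -> R) :
  (forall n, u n <= u n.+1) -> (forall n, v n.+1 <= v n) ->
  (forall n, u n <= v n) -> exists x, forall n, u n <= x <= v n.
Proof.
move=> hu hv uv.
have hu' : {homo u : m n / (m <= n)%N >-> m <= n} by apply: homo_leq => //; exact: le_trans.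
have hv' : {homo v : m n / (m <= n)%N >-> n <= m}.
  by apply: (homo_leq (r := fun x y => y <= x)) => // x y z yx zy; exact: le_trans zy yx.
have uvmn m n : u m <= v n.
  apply: le_trans (hu' _ _ (leq_maxl m n)) _.
  exact: le_trans (uv _) (hv' _ _ (leq_maxr m n)).
exists (sup (range u)) => n; apply/andP; split.
  apply: ub_le_sup; last by exists n.
  by exists (v 0%N) => _ [m _ <-].
apply: ge_sup; first by exists (u 0%N), 0%N.
by move=> _ [m _ <-].
Qed.

Definition rect : Type := (R * R) * (R * R).

Variables (I : R -> R -> R -> R -> C).
Let J (S : rect) := cnorm (I S.1.1 S.1.2 S.2.1 S.2.2).
Let mid (p : R * R) : R := (p.1 + p.2) / 2.
Let lo (p : R * R) := (p.1, mid p).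
Let hi (p : R * R) := (mid p, p.2).

Let step (S : rect) : rect :=
  if J S / 4 <= J (lo S.1, lo S.2) then (lo S.1, lo S.2) else
  if J S / 4 <= J (lo S.1, hi S.2) then (lo S.1, hi S.2) else
  if J S / 4 <= J (hi S.1, lo S.2) then (hi S.1, lo S.2) else (hi S.1, hi S.2).

(** Goursat's argument for an abstract additive function of rectangles. Some quarter always keeps a
    quarter of the absolute value, so |I(S_n)| >= |I(S_0)| / 4^n along a nested sequence, whereas
    the local estimate at the common point is e times the square of a half-perimeter, itself of
    order 4^-n. *)
Lemma bisection_vanish (a b c d : R) : a <= b -> c <= d ->
  (forall t1 t2 x1 x2, a <= t1 -> t1 <= t2 -> t2 <= b ->
     c <= x1 -> x1 <= x2 -> x2 <= d ->
     let m := (t1 + t2) / 2 in let n := (x1 + x2) / 2 in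
     I t1 t2 x1 x2 = I t1 m x1 n + I t1 m n x2 + I m t2 x1 n + I m t2 n x2) ->
  (forall t0 x0, a <= t0 <= b -> c <= x0 <= d -> forall e, 0 < e ->
     exists2 r, 0 < r & forall t1 t2 x1 x2, a <= t1 -> t2 <= b ->
       c <= x1 -> x2 <= d -> t1 <= t0 <= t2 -> x1 <= x0 <= x2 ->
       t2 - t1 < r -> x2 - x1 < r ->
       cnorm (I t1 t2 x1 x2) <= e * (t2 - t1 + (x2 - x1)) ^+ 2) ->
  I a b c d = 0.
Proof.
move=> ab cd add loc.
pose S n := iter n step ((a, b), (c, d)).
have stepE T : exists p q, step T = (p, q) /\ (p = lo T.1 \/ p = hi T.1) /\
    (q = lo T.2 \/ q = hi T.2).
  rewrite /step; case: ifP => _; first by do 2 eexists; split; [by []|split; left].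
  case: ifP => _; first by do 2 eexists; split; [by []|split; [left|right]].
  case: ifP => _; first by do 2 eexists; split; [by []|split; [right|left]].
  by do 2 eexists; split; [by []|split; right].
have half (p q : R * R) : p.1 <= p.2 -> q = lo p \/ q = hi p ->
    [/\ p.1 <= q.1, q.1 <= q.2, q.2 <= p.2 & q.2 - q.1 = (p.2 - p.1) / 2].
  case: p => p1 p2 /= p12 [->|->]; rewrite /lo /hi /mid /=; split; lra.
have inv n : [/\ a <= (S n).1.1, (S n).1.1 <= (S n).1.2, (S n).1.2 <= b &
              [/\ c <= (S n).2.1, (S n).2.1 <= (S n).2.2 & (S n).2.2 <= d]].
  elim: n => [|n [h1 h2 h3 [h4 h5 h6]]]; first by [].
  have [p [q [Sn [hp hq]]]] := stepE (S n).
  have [k1 k2 k3 _] := half _ _ h2 hp; have [k4 k5 k6 _] := half _ _ h5 hq.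
  have -> : S n.+1 = (p, q) by rewrite -Sn.
  by split=> //=; [lra|lra|split=> //; lra].
have nest n : [/\ (S n).1.1 <= (S n.+1).1.1, (S n.+1).1.2 <= (S n).1.2,
    (S n).2.1 <= (S n.+1).2.1, (S n.+1).2.2 <= (S n).2.2 &
    (S n.+1).1.2 - (S n.+1).1.1 = ((S n).1.2 - (S n).1.1) / 2 /\
    (S n.+1).2.2 - (S n.+1).2.1 = ((S n).2.2 - (S n).2.1) / 2].
  have [h1 h2 h3 [h4 h5 h6]] := inv n.
  have [p [q [Sn [hp hq]]]] := stepE (S n).
  have [k1 k2 k3 k7] := half _ _ h2 hp; have [k4 k5 k6 k8] := half _ _ h5 hq.
  by have -> : S n.+1 = (p, q) by rewrite -Sn.
have [t0 ht0] := nested_intervals (fun n => (S n).1.1) (fun n => (S n).1.2)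
  (fun n => let: And5 h _ _ _ _ := nest n in h)
  (fun n => let: And5 _ h _ _ _ := nest n in h)
  (fun n => let: And4 _ h _ _ := inv n in h).
have [x0 hx0] := nested_intervals (fun n => (S n).2.1) (fun n => (S n).2.2)
  (fun n => let: And5 _ _ h _ _ := nest n in h)
  (fun n => let: And5 _ _ _ h _ := nest n in h)
  (fun n => let: And4 _ _ _ (And3 _ h _) := inv n in h).
have width n : (S n).1.2 - (S n).1.1 = (b - a) / 2 ^+ n /\
               (S n).2.2 - (S n).2.1 = (d - c) / 2 ^+ n.
  elim: n => [|n [IH1 IH2]]; first by rewrite expr0 !divr1.
  have [_ _ _ _ [-> ->]] := nest n; rewrite IH1 IH2 exprSr invfM.
  by rewrite -!mulrA.
have JS n : J (S n.+1) >= J (S n) / 4.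
  have [h1 h2 h3 [h4 h5 h6]] := inv n.
  rewrite [S n.+1]/(step (S n)) /step.
  case: ifPn => //; rewrite -ltNge => l1.
  case: ifPn => //; rewrite -ltNge => l2.
  case: ifPn => //; rewrite -ltNge => l3.
  (* If the first three quarters each carry less than [J S / 4], additivity forces the last one to
     carry more, which is why [step] does not test it. *)
  have := add _ _ _ _ h1 h2 h3 h4 h5 h6 => /= addS.
  have : J (S n) <= J (lo (S n).1, lo (S n).2) + J (lo (S n).1, hi (S n).2) +
      J (hi (S n).1, lo (S n).2) + J (hi (S n).1, hi (S n).2).
    rewrite {1}/J addS; apply: le_trans (cnormD _ _) _; rewrite lerD2r.
    by apply: le_trans (cnormD _ _) _; rewrite lerD2r; exact: cnormD.
  by move: l1 l2 l3; lra.
have J0 n : J (S 0%N) / 4 ^+ n <= J (S n).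
  elim: n => [|n IH]; first by rewrite expr0 divr1.
  apply: le_trans (JS n); rewrite exprSr invfM mulrA.
  by rewrite ler_wpM2r.
apply/eqP; rewrite -cnorm_eq0 eq_le cnorm_ge0 andbT.
(* The summand 1 keeps the divisor of [e] positive for a degenerate rectangle. *)
have W0 : 0 < (b - a + (d - c)) ^+ 2 + 1 by rewrite ltr_wpDl// sqr_ge0.
apply/ler_addgt0Pr => e e0; rewrite add0r.
have [|||r r0 hr] := loc t0 x0 _ _ (e / ((b - a + (d - c)) ^+ 2 + 1)).
- by have := ht0 0%N.
- by have := hx0 0%N.
- by rewrite divr_gt0.
have [n hn1 hn2] : exists2 n, (b - a) / 2 ^+ n < r & (d - c) / 2 ^+ n < r.
  have [n hn] : exists n, (b - a + (d - c) + 1) / r < 2 ^+ n.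
    exists (Num.truncn ((b - a + (d - c) + 1) / r)).+1.
    have := truncnS_gt ((b - a + (d - c) + 1) / r).
    move=> /lt_le_trans; apply; rewrite -natrX ler_nat.
    exact/ltnW/ltn_expl.
  exists n; rewrite ltr_pdivrMr ?exprn_gt0// mulrC; move: hn; rewrite ltr_pdivrMr//; lra.
have [h1 h2 h3 [h4 h5 h6]] := inv n.
have [w1 w2] := width n.
have := hr _ _ _ _ h1 h3 h4 h6 (ht0 n) (hx0 n).
rewrite w1 w2 => /(_ hn1 hn2) => hle.
have := le_trans (J0 n) hle.
rewrite -mulrDl expr_div_n -exprM mulnC exprM (_ : 2 ^+ 2 = 4 :> R); last by lra.
rewrite mulrA ler_pM2r ?invr_gt0 ?exprn_gt0// => /le_trans; apply.
rewrite -mulrA ler_piMr ?(ltW e0)// mulrC ler_pdivrMr// mul1r; lra.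
Qed.

End Bisection.

(** * Parametrized circles *)

Section Circle.
Context {R : realType}.
Local Notation C := R[i].

Definition circ (r x : R) : C := (r * cos x) +i* (r * sin x).

Lemma cnorm_circ r x : 0 <= r -> cnorm (circ r x) = r.
Proof.
move=> r0; rewrite /= !exprMn -mulrDr cos2Dsin2 mulr1 sqrtr_sqr.
by rewrite ger0_norm.
Qed.

Lemma circ_2pi r : circ r (2 * pi) = circ r 0.
Proof.
have -> : 2 * pi = pi *+ 2 :> R by rewrite mulr2n; lra.
by rewrite /circ cos2pi sin2pi cos0 sin0.
Qed.

Lemma continuous_circ r (x : R) : {for x, continuous (circ r)}.
Proof.
apply: ccont_RE; apply: continuousM; do ?[exact: cvg_cst].
  exact: continuous_cos.
exact: continuous_sin.
Qed.

Lemma continuous_real_complex (x : R) : {for x, continuous (real_complex R)}.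
Proof. by apply: ccont_RE; [exact: cvg_id|exact: cvg_cst]. Qed.

Lemma rcint_dcirc r a b : a <= b ->
  rcint a b (fun x => 'i * circ r x) = circ r b - circ r a.
Proof.
move=> ab; apply: rcint_FTC => // x.
- have h : is_derive x (1 : R) (cst r * cos) (cst r x *: - sin x + cos x *: 0).
    exact: is_deriveM.
  apply: (is_derive_eq h); rewrite /GRing.scale /= mulr0 addr0 ; ring.
- have h : is_derive x (1 : R) (cst r * sin) (cst r x *: cos x + sin x *: 0).
    exact: is_deriveM.
  apply: (is_derive_eq h); rewrite /GRing.scale /= mulr0 addr0; ring.
- by apply: continuousM; [exact: cvg_cst|exact: continuous_circ].
Qed.

Lemma circ_lipschitz r x y : 0 <= r -> cnorm (circ r x - circ r y) <= r * `|x - y|.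
Proof.
move=> r0; wlog yx : x y / y <= x => [H|].
  by case: (leP y x) => [|/ltW]/H //; rewrite cdistC distrC.
rewrite -rcint_dcirc// [`|_|]ger0_norm ?subr_ge0//; apply: rcint_bound => //.
- by move=> z _; apply: continuousM; [exact: cvg_cst|exact: continuous_circ].
- by move=> z _; rewrite cnormM cnormi mul1r cnorm_circ.
Qed.

End Circle.

Section RealComplex.
Context {R : realType}.
Implicit Types x y : R.
Lemma RCB x y : (x - y)%:C = x%:C - y%:C :> R[i]. Proof. exact: rmorphB. Qed.
Lemma RCM x y : (x * y)%:C = x%:C * y%:C :> R[i]. Proof. exact: rmorphM. Qed.
Lemma RCV x : (x^-1)%:C = (x%:C)^-1 :> R[i]. Proof. exact: fmorphV. Qed.
End RealComplex.

(** * Cauchy's theorem by contraction of the circle *)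

Section CauchyFormula.
Context {R : realType}.
Local Notation C := R[i].
Variables (f : C -> C) (s r : R) (a : C).
Hypotheses (ar : cnorm a < r) (rs : r < s)
  (df : forall z, cnorm z < s -> derivable f z 1).

Let r0 : 0 < r. Proof. exact: le_lt_trans (cnorm_ge0 _) ar. Qed.
Let e x : C := circ r x - a.
(** On the homotopy z = a + t e(x) one has dz / (z - a) = dt / t + k(x) dx, because the derivative
    of [e] is 'i times [circ r]. *)
Let k x : C := 'i * circ r x / e x.
Let eta := r - cnorm a.
Let eta0 : 0 < eta. Proof. by rewrite subr_gt0. Qed.

Let e_ge x : eta <= cnorm (e x).
Proof.
rewrite lerBlDr -{1}(cnorm_circ r x (ltW r0)); have := cdist_le (circ r x) a.
by rewrite addrC.
Qed.

Let e_neq0 x : e x != 0.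
Proof. by rewrite -cnorm_gt0; exact: lt_le_trans (e_ge x). Qed.

Let e_le x : cnorm (e x) <= 2 * r.
Proof.
apply: le_trans (cnormB _ _) _; rewrite cnorm_circ ?(ltW r0)//; move: (ltW ar); lra.
Qed.

Let cont_e (x : R) : {for x, continuous e}.
Proof. by apply: continuousB; [exact: continuous_circ|exact: cvg_cst]. Qed.

Let cont_k (x : R) : {for x, continuous k}.
Proof.
apply: continuousM; first by apply: continuousM; [exact: cvg_cst|exact: continuous_circ].
by apply: continuousV; [exact: e_neq0|exact: cont_e].
Qed.

Let k_le x : cnorm (k x) <= r / eta.
Proof.
rewrite !cnormM cnormi mul1r cnormV cnorm_circ ?(ltW r0)// ler_pM2l//.
by rewrite lef_pV2 ?posrE// (lt_le_trans eta0).
Qed.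

Let p t x : C := a + t%:C * e x.

Let p_in t x : 0 <= t <= 1 -> cnorm (p t x) <= r.
Proof.
move=> /andP[t0 t1]; have -> : p t x = (1 - t)%:C * a + t%:C * circ r x.
  by rewrite /p /e RCB; ring.
apply: le_trans (cnormD _ _) _; rewrite !cnormM !cnormR !ger0_norm ?subr_ge0//.
rewrite cnorm_circ ?(ltW r0)//.
have : (1 - t) * cnorm a <= (1 - t) * r by rewrite ler_wpM2l ?subr_ge0// ltW.
lra.
Qed.

Let p_dist t x t' x' : 0 <= t <= 1 -> 0 <= t' <= 1 ->
  cnorm (p t x - p t' x') <= 2 * r * (`|t - t'| + `|x - x'|).
Proof.
move=> /andP[t0 t1] /andP[t0' t1'].
have -> : p t x - p t' x' = (t - t')%:C * e x + t'%:C * (circ r x - circ r x').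
  by rewrite /p /e RCB; ring.
apply: le_trans (cnormD _ _) _; rewrite !cnormM !cnormR.
have h1 : `|t - t'| * cnorm (e x) <= `|t - t'| * (2 * r) by rewrite ler_wpM2l.
have h2 : `|t'| * cnorm (circ r x - circ r x') <= 1 * (r * `|x - x'|).
  apply: ler_pM; rewrite ?cnorm_ge0 ?normr_ge0//; first by rewrite ger0_norm.
  exact/circ_lipschitz/ltW.
have h3 : 0 <= r * `|x - x'| by rewrite mulr_ge0// ltW.
move: h1 h2 h3; lra.
Qed.

(** Each edge of a rectangle varies one parameter only, so separate continuity is what the edge
    integrals of [form] require. *)
Let sepc (Y : R -> R -> C) := forall t x, 0 <= t <= 1 ->
  {for t, continuous (Y^~ x)} /\ {for x, continuous (Y t)}.

(* For Y = f o p this is the integral of f(z) dz / (z - a) along the boundary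
   of a rectangle of the homotopy p, which contracts the circle to a. *)
Let form (Y : R -> R -> C) t1 t2 x1 x2 : C :=
  rcint t1 t2 (fun t => Y t x1 / t%:C) - rcint t1 t2 (fun t => Y t x2 / t%:C) +
  (rcint x1 x2 (fun x => Y t2 x * k x) - rcint x1 x2 (fun x => Y t1 x * k x)).

Let cont_h Y t1 t2 x : 0 < t1 -> t2 <= 1 -> sepc Y ->
  cont_on t1 t2 (fun t => Y t x / t%:C).
Proof.
move=> t10 t21 cY t /andP[t1t tt2].
have t0 : 0 < t by exact: lt_le_trans t1t.
apply: continuousM; first by apply: (cY _ _ _).1; rewrite ltW//= (le_trans tt2).
apply: continuousV; last exact: continuous_real_complex.
by rewrite eq_complex /= eqxx andbT gt_eqF.
Qed.

Let cont_v Y t x1 x2 : 0 <= t <= 1 -> sepc Y ->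
  cont_on x1 x2 (fun x => Y t x * k x).
Proof.
move=> t01 cY x _; apply: continuousM; last exact: cont_k.
by apply: (cY _ _ t01).2.
Qed.

Let formD Y Z t1 t2 x1 x2 : 0 < t1 -> t1 <= t2 -> t2 <= 1 -> sepc Y -> sepc Z ->
  form (fun t x => Y t x + Z t x) t1 t2 x1 x2 = form Y t1 t2 x1 x2 + form Z t1 t2 x1 x2.
Proof.
move=> t10 t12 t21 cY cZ.
have t1' : 0 <= t1 <= 1 by rewrite ltW//= (le_trans t12).
have t2' : 0 <= t2 <= 1 by rewrite t21 (le_trans (ltW t10)).
have eh x : rcint t1 t2 (fun t => (Y t x + Z t x) / t%:C) =
    rcint t1 t2 (fun t => Y t x / t%:C) + rcint t1 t2 (fun t => Z t x / t%:C).
  rewrite -rcintD; [|exact: cont_h|exact: cont_h].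
  by apply: eq_rcint => t _; rewrite mulrDl.
have ev t : 0 <= t <= 1 -> rcint x1 x2 (fun x => (Y t x + Z t x) * k x) =
    rcint x1 x2 (fun x => Y t x * k x) + rcint x1 x2 (fun x => Z t x * k x).
  move=> t01; rewrite -rcintD; [|exact: cont_v|exact: cont_v].
  by apply: eq_rcint => x _; rewrite mulrDl.
by rewrite /form !eh !ev//; ring.
Qed.

Let form_split Y t1 t2 t3 x1 x2 x3 : 0 < t1 -> t1 <= t2 -> t2 <= t3 -> t3 <= 1 ->
  x1 <= x2 -> x2 <= x3 -> sepc Y ->
  form Y t1 t3 x1 x3 = form Y t1 t2 x1 x2 + form Y t1 t2 x2 x3 +
                       form Y t2 t3 x1 x2 + form Y t2 t3 x2 x3.
Proof.
move=> t10 t12 t23 t31 x12 x23 cY.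
have t1' : 0 <= t1 <= 1 by rewrite ltW//=; lra.
have t3' : 0 <= t3 <= 1 by lra.
have eh x : rcint t1 t3 (fun t => Y t x / t%:C) =
    rcint t1 t2 (fun t => Y t x / t%:C) + rcint t2 t3 (fun t => Y t x / t%:C).
  exact: (rcint_split _ _ _ _ t12 t23 (cont_h Y _ _ x t10 t31 cY)).
have ev t : 0 <= t <= 1 -> rcint x1 x3 (fun x => Y t x * k x) =
    rcint x1 x2 (fun x => Y t x * k x) + rcint x2 x3 (fun x => Y t x * k x).
  by move=> t01; exact: (rcint_split _ _ _ _ x12 x23 (cont_v Y t _ _ t01 cY)).
rewrite /form !eh !ev//.
set A1 := rcint _ _ _; set A2 := rcint _ _ _; set A3 := rcint _ _ _.
set A4 := rcint _ _ _; set A5 := rcint _ _ _; set A6 := rcint _ _ _.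
set A7 := rcint _ _ _; set A8 := rcint _ _ _; set A9 := rcint _ _ _.
set A10 := rcint _ _ _; set A11 := rcint _ _ _; set A12 := rcint _ _ _.
ring.
Qed.

(** After centring at [a], the constant part cancels because dt / t does not depend on x nor [k] on
    t. The linear part leaves the exact form c1 dz, which integrates to 0 round a rectangle. *)
Let form_affine (c0 c1 : C) t1 t2 x1 x2 : 0 < t1 -> t1 <= t2 -> t2 <= 1 -> x1 <= x2 ->
  form (fun t x => c0 + c1 * p t x) t1 t2 x1 x2 = 0.
Proof.
move=> t10 t12 t21 x12.
have ccst c : sepc (fun _ _ => c) by move=> t x _; split; exact: cvg_cst.
have clin c : sepc (fun t x => c * (t%:C * e x)).
  move=> t x _; split; apply: continuousM; do ?[exact: cvg_cst].
    by apply: continuousM; [exact: continuous_real_complex|exact: cvg_cst].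
  by apply: continuousM; [exact: cvg_cst|exact: cont_e].
have -> : (fun t x => c0 + c1 * p t x) =
    (fun t x => (c0 + c1 * a) + c1 * (t%:C * e x)).
  by apply/funext => t; apply/funext => x; rewrite /p; ring.
rewrite (formD _ _ _ _ x1 x2 t10 t12 t21 (ccst _) (clin _)) {1}/form !subrr !add0r.
have hk t : rcint x1 x2 (fun x => c1 * (t%:C * e x) * k x) =
    c1 * t%:C * (circ r x2 - circ r x1).
  rewrite -rcint_dcirc// -rcintZ; last first.
    by move=> x _; apply: continuousM; [exact: cvg_cst|exact: continuous_circ].
  apply: eq_rcint => x _; rewrite /k; move: (e x) (e_neq0 x) (circ r x) (t%:C).
  by move=> E E0 Z T; field.
have hh x : rcint t1 t2 (fun t => c1 * (t%:C * e x) / t%:C) = (t2 - t1)%:C * (c1 * e x).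
  rewrite -rcint_cst//; apply: eq_rcint => t /andP[t1t _].
  rewrite mulrCA mulrAC divff ?mul1r//.
  by rewrite eq_complex /= eqxx andbT gt_eqF// (lt_le_trans t10).
rewrite /form !hk !hh /e RCB.
by move: (circ r x1) (circ r x2) (t1%:C) (t2%:C) => z1 z2 u1 u2; ring.
Qed.

(** Rectangles stay in t >= lo, where 1 / t is at most 1 / lo, and [k] is at most r / eta; adding
    the two bounds gives one constant for both kinds of edges, and 2 counts opposite edges. *)
Let form_bound Y t1 t2 x1 x2 (lo M : R) : 0 < lo -> lo <= t1 -> t1 <= t2 -> t2 <= 1 ->
  x1 <= x2 -> sepc Y ->
  (forall t x, t1 <= t <= t2 -> x1 <= x <= x2 -> cnorm (Y t x) <= M) ->
  cnorm (form Y t1 t2 x1 x2) <= 2 * (lo^-1 + r / eta) * M * (t2 - t1 + (x2 - x1)).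
Proof.
move=> lo0 lot1 t12 t21 x12 cY YM.
have t10 : 0 < t1 by exact: lt_le_trans lot1.
have M0 : 0 <= M by apply: le_trans (YM t1 x1 _ _); rewrite ?cnorm_ge0 ?lexx.
have hh x : x1 <= x <= x2 ->
    cnorm (rcint t1 t2 (fun t => Y t x / t%:C)) <= M / lo * (t2 - t1).
  move=> xx; apply: (rcint_bound _ _ _ _ t12 (cont_h Y _ _ x t10 t21 cY)).
  move=> t tt; have /andP[t1t tt2] := tt.
  rewrite cnormM cnormV cnormR ler_pM ?cnorm_ge0 ?invr_ge0 ?YM//.
  rewrite lef_pV2 ?posrE ?ger0_norm; lra.
have hv t : t1 <= t <= t2 ->
    cnorm (rcint x1 x2 (fun x => Y t x * k x)) <= M * (r / eta) * (x2 - x1).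
  move=> tt; have t01 : 0 <= t <= 1 by lra.
  apply: (rcint_bound _ _ _ _ x12 (cont_v Y t _ _ t01 cY)).
  by move=> x xx; rewrite cnormM ler_pM ?cnorm_ge0 ?YM.
apply: (@le_trans _ _ (M / lo * (t2 - t1) + M / lo * (t2 - t1) +
  (M * (r / eta) * (x2 - x1) + M * (r / eta) * (x2 - x1)))).
  apply: le_trans (cnormD _ _) _; apply: lerD; apply: le_trans (cnormB _ _) _.
    by apply: lerD; apply: hh; rewrite lexx ?x12.
  by apply: lerD; apply: hv; rewrite lexx ?t12.
have h1 : 0 <= M * lo^-1 * (x2 - x1) by rewrite !mulr_ge0 ?invr_ge0 ?subr_ge0// ltW.
have h2 : 0 <= M * (r / eta) * (t2 - t1).
  by rewrite !mulr_ge0 ?subr_ge0 ?invr_ge0// ltW.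
move: h1 h2; lra.
Qed.

Let X t x := f (p t x).

Let ccont_f z : cnorm z < s -> ccont f z.
Proof. by move=> /df/derivable_cderiv/cderiv_cont. Qed.

Let sepcX : sepc X.
Proof.
move=> t x t01; have fp : {for p t x, continuous f}.
  by apply/ccontP/ccont_f; exact: le_lt_trans (p_in _ _ t01) rs.
have c1 : {for t, continuous (p^~ x)}.
  apply: continuousD; first exact: cvg_cst.
  by apply: continuousM; [exact: continuous_real_complex|exact: cvg_cst].
have c2 : {for x, continuous (p t)}.
  apply: continuousD; first exact: cvg_cst.
  by apply: continuousM; [exact: cvg_cst|exact: cont_e].
by split; [exact: (continuous_comp c1 fp)|exact: (continuous_comp c2 fp)].
Qed.

Let sepc_affine (c0 c1 : C) : sepc (fun t x => c0 + c1 * p t x).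
Proof.
move=> t x _; split; (apply: continuousD; first exact: cvg_cst);
  (apply: continuousM; first exact: cvg_cst);
  (apply: continuousD; first exact: cvg_cst).
  by apply: continuousM; [exact: continuous_real_complex|exact: cvg_cst].
by apply: continuousM; [exact: cvg_cst|exact: cont_e].
Qed.

Let goursat lo : 0 < lo -> lo <= 1 -> form X lo 1 0 (2 * pi) = 0.
Proof.
move=> lo0 lo1; have pi0 : 0 <= 2 * pi :> R by rewrite mulr_ge0// pi_ge0.
apply: bisection_vanish; [exact: lo1|exact: pi0| |].
  move=> t1 t2 x1 x2 h1 h2 h3 h4 h5 h6 /=.
  apply: form_split; [lra|lra|lra|lra|lra|lra|exact: sepcX].
move=> t0 x0 t0I x0I eps eps0.
have t01 : 0 <= t0 <= 1 by lra.
have /df/derivable_cderiv := le_lt_trans (p_in _ x0 t01) rs.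
set l := derive1 f _ => dl.
(* [K] is the constant of [form_bound] times the Lipschitz constant 2 r of [p], so that an error of
   eps / K yields exactly eps w^2. *)
pose K := 2 * (lo^-1 + r / eta) * (2 * r).
have K0 : 0 < K.
  by rewrite /K mulr_gt0 ?mulr_gt0// addr_gt0 ?invr_gt0// divr_gt0.
have [d d0 hd] := dl (eps / K) (divr_gt0 eps0 K0).
(* Two sides shorter than d / (4 r) add up to less than d / (2 r), which keeps [p] within d of
   [p t0 x0]. *)
exists (d / (4 * r)); first by rewrite divr_gt0// mulr_gt0.
move=> t1 t2 x1 x2 h1 h2 h3 h4 /andP[t10 t02] /andP[x10 x02] wt wx.
pose c1 := l; pose c0 := X t0 x0 - l * p t0 x0.
(* [Y] is [f] along the homotopy minus its first-order expansion at [p t0 x0]; the part removed is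
   affine and has zero form. *)
pose Y t x := X t x + ((- c0) + (- c1) * p t x).
have cY : sepc Y.
  move=> t x tt; have [u1 u2] := sepcX t x tt; have [v1 v2] := sepc_affine (- c0) (- c1) t x tt.
  by split; [exact: (continuousD u1 v1)|exact: (continuousD u2 v2)].
have -> : form X t1 t2 x1 x2 = form Y t1 t2 x1 x2.
  have t1p : 0 < t1 by lra.
  have t12 : t1 <= t2 by lra.
  have x12 : x1 <= x2 by lra.
  rewrite (formD X _ _ _ x1 x2 t1p t12 h2 sepcX (sepc_affine _ _)).
  by rewrite (form_affine _ _ _ _ _ _ t1p t12 h2 x12) addr0.
pose w := t2 - t1 + (x2 - x1).
have w0 : 0 <= w by rewrite /w; lra.
have wd : 2 * r * w < d.
  move: wt wx; rewrite !ltr_pdivlMr ?mulr_gt0//.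
  rewrite /w; move=> u1 u2.
  have u3 := ltrD u1 u2; move: u3; lra.
have t12 : t1 <= t2 by lra.
have x12 : x1 <= x2 by lra.
apply: le_trans (form_bound Y _ _ _ _ lo (eps / K * (2 * r * w)) lo0 h1 t12 h2 x12 cY _) _.
  move=> t x tt xx; have pd : cnorm (p t x - p t0 x0) <= 2 * r * w.
    apply: le_trans (p_dist _ _ _ _ _ t01) _; first lra.
    rewrite ler_pM2l ?mulr_gt0// /w lerD// ler_norml; lra.
  have := hd (p t x - p t0 x0) (le_lt_trans pd wd).
  rewrite subrKC => hle; apply: (@le_trans _ _ (eps / K * cnorm (p t x - p t0 x0))).
    apply: le_trans hle; rewrite le_eqVlt; apply/orP; left; apply/eqP; congr cnorm.
    rewrite /Y /c0 /c1 /X.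
    by move: (f (p t x)) (f (p t0 x0)) (p t x) (p t0 x0) => u1 u2 u3 u4; ring.
  by rewrite ler_wpM2l// divr_ge0// ltW.
rewrite -/w le_eqVlt; apply/orP; left; apply/eqP.
transitivity (K / K * (eps * w ^+ 2)); last by rewrite divff ?mul1r// gt_eqF.
by move: (K^-1) => Ki; rewrite /K; ring.
Qed.

(** The edges x = 0 and x = 2 pi cancel by periodicity, so [goursat] makes the integral over the
    circle contracted by t independent of t, and continuity at [a] gives its limit as t tends to 0.
    The integral of [k] is left as a factor; [cmean_kernel] evaluates it. *)
Lemma cauchy_const : rcint 0 (2 * pi) (fun x => f (circ r x) * k x) =
  f a * rcint 0 (2 * pi) k.
Proof.
have pi0 : 0 < 2 * pi :> R by rewrite mulr_gt0// pi_gt0.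
pose A t := rcint 0 (2 * pi) (fun x => X t x * k x).
have AE lo : 0 < lo -> lo <= 1 -> A 1 = A lo.
  move=> lo0 lo1; have := goursat _ lo0 lo1; rewrite /form.
  have -> : (fun t => X t (2 * pi) / t%:C) = (fun t => X t 0 / t%:C).
    by apply/funext => t; rewrite /X /p /e circ_2pi.
  by rewrite subrr add0r => /eqP; rewrite subr_eq0 => /eqP.
have -> : rcint 0 (2 * pi) (fun x => f (circ r x) * k x) = A 1.
  by apply: eq_rcint => x _; rewrite /X /p /e mul1r subrKC.
have ck0 : cont_on 0 (2 * pi) k by move=> x _; exact: cont_k.
rewrite -rcintZ//; apply/eqP; rewrite -subr_eq0 -cnorm_eq0 eq_le cnorm_ge0 andbT.
apply/ler_addgt0Pr => eps eps0; rewrite add0r.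
have K0 : 0 < r / eta * (2 * pi) by rewrite mulr_gt0// divr_gt0.
have as_ : cnorm a < s by apply: lt_trans rs.
have [d d0 hd] := ccont_f _ as_ _ (divr_gt0 eps0 K0).
(* Since |e| <= 2 r, the contracted circle then stays strictly within d of [a]. *)
pose lo := Num.min 1 (d / (4 * r)).
have lo0 : 0 < lo by rewrite lt_min ltr01 divr_gt0// mulr_gt0.
have lo1 : lo <= 1 by rewrite ge_min lexx.
have lod : lo * (4 * r) <= d by rewrite -ler_pdivlMr ?mulr_gt0// ge_min lexx orbT.
have lo01 : 0 <= lo <= 1 by rewrite ltW.
rewrite (AE lo)// -rcintB; last 2 first.
- exact: (cont_v X lo _ _ lo01 sepcX).
- by move=> x _; apply: continuousM; [exact: cvg_cst|exact: cont_k].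
apply: le_trans (rcint_bound _ _ _ (eps / (r / eta * (2 * pi)) * (r / eta)) (ltW pi0) _ _) _.
- move=> x xx; apply: continuousB; first exact: (cont_v X lo 0 (2 * pi) lo01 sepcX x xx).
  by apply: continuousM; [exact: cvg_cst|exact: cont_k].
- move=> x _; rewrite -mulrBl cnormM ler_pM ?cnorm_ge0//.
  apply/ltW/hd; rewrite /p addrC addKr cnormM cnormR ger0_norm ?ltW//.
  apply: le_lt_trans (ler_wpM2l (ltW lo0) (e_le x)) _.
  apply: lt_le_trans lod; rewrite ltr_pM2l//; move: r0; lra.
apply: (@le_trans _ _ (eps / (r / eta * (2 * pi)) * (r / eta * (2 * pi)))).
  by rewrite subr0 !mulrA.
by rewrite divfK// gt_eqF.
Qed.

End CauchyFormula.

(** * Geometric decay and geometric sums *)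

Section PowerLimits.
Context {R : realType}.

(** Take p half way between q and 1 and y = q / p < 1. The n + 1 terms y^i with i <= n all dominate
    y^n, whence (n + 1) y^n <= 1 / (1 - y). *)
Lemma natX_lt (q : R) : 0 <= q -> q < 1 ->
  exists2 K : R, 0 <= K & exists2 p : R, 0 <= p < 1 &
    forall n, n.+1%:R * q ^+ n <= K * p ^+ n.
Proof.
move=> q0 q1; pose p := (1 + q) / 2.
have p0 : 0 < p by rewrite /p; lra.
have p1 : p < 1 by rewrite /p; lra.
have qp : q / p < 1 by rewrite ltr_pdivrMr// mul1r /p; lra.
pose y := q / p; have y0 : 0 <= y by rewrite divr_ge0// ltW.
have yb n : n.+1%:R * y ^+ n <= (1 - y)^-1.
  rewrite -[leRHS]mul1r ler_pdivlMr ?subr_gt0//.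
  apply: (@le_trans _ _ (\sum_(i < n.+1) y ^+ i * (1 - y))).
    rewrite -mulr_suml ler_wpM2r ?subr_ge0 ?(ltW qp)//.
    apply: (@le_trans _ _ (\sum_(i < n.+1) y ^+ n)).
      by rewrite sumr_const card_ord mulr_natl.
    by apply: ler_sum => i _; rewrite ler_wiXn2l// ?ltW// -ltnS.
  rewrite -mulr_suml -[1 - y]opprB mulrN mulrC -subrX1 opprB.
  by rewrite lerBlDr lerDl exprn_ge0.
exists (1 - y)^-1; first by rewrite invr_ge0 subr_ge0 ltW.
exists p; first by rewrite ltW.
move=> n; have -> : q ^+ n = y ^+ n * p ^+ n by rewrite -exprMn divfK// gt_eqF.
by rewrite mulrA ler_wpM2r// exprn_ge0// ltW.
Qed.

Lemma cvg_geo0 (K p : R) : 0 <= p < 1 -> K * p ^+ n @[n --> \oo] --> 0.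
Proof.
move=> /andP[p0 p1]; rewrite -[X in _ --> X](mulr0 K); apply: cvgM.
  exact: cvg_cst.
by apply: cvg_expr; rewrite ger0_norm.
Qed.

Lemma cvg_natX0 (q : R) : 0 <= q -> q < 1 -> n.+1%:R * q ^+ n @[n --> \oo] --> 0.
Proof.
move=> q0 q1; have [K K0 [p p01 h]] := natX_lt _ q0 q1.
apply: (squeeze_cvgr _ (cvg_cst 0) (cvg_geo0 K p p01)).
by apply: nearW => n; rewrite h andbT mulr_ge0// exprn_ge0.
Qed.

End PowerLimits.

Section GeometricSums.
Context {F : fieldType}.
Implicit Types y : F.

Lemma geo_sum y n : y != 1 -> (1 - y)^-1 - \sum_(j < n) y ^+ j = y ^+ n / (1 - y).
Proof.
move=> y1; have y1' : 1 - y != 0 by rewrite subr_eq0 eq_sym.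
elim: n => [|n IH]; first by rewrite big_ord0 subr0 expr0 mul1r.
by rewrite big_ord_recr /= opprD addrA IH [y ^+ n.+1]exprS; field.
Qed.

Lemma geo_sum2 y n : y != 1 -> (1 - y) ^- 2 - \sum_(j < n) j.+1%:R * y ^+ j =
  (n.+1%:R - n%:R * y) * y ^+ n / (1 - y) ^+ 2.
Proof.
move=> y1; have y1' : 1 - y != 0 by rewrite subr_eq0 eq_sym.
elim: n => [|n IH].
  by rewrite big_ord0 subr0 expr0 mul0r subr0 mulr1 mul1r.
rewrite big_ord_recr /= opprD addrA IH [y ^+ n.+1]exprS -!natr1.
by field.
Qed.

End GeometricSums.

(** * Means over circles and Cauchy integrals *)

Section CircleMean.
Context {R : realType}.
Local Notation C := R[i].
Implicit Types (phi psi : R -> C).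

Definition cmean phi : C := ((2 * pi)^-1)%:C * rcint 0 (2 * pi) phi.

Let pi2 : 0 < 2 * pi :> R. Proof. by rewrite mulr_gt0// pi_gt0. Qed.

(* An inductive wrapper: unfolding continuity makes conversion very slow. *)
Variant curve phi : Prop := Curve of forall x : R, {for x, continuous phi}.

Lemma curve_on phi a b : curve phi -> cont_on a b phi.
Proof. by move=> [c] x _; exact: c. Qed.

Lemma cmeanD phi psi : curve phi -> curve psi ->
  cmean (fun x => phi x + psi x) = cmean phi + cmean psi.
Proof.
move=> c1 c2; rewrite /cmean (rcintD _ _ _ _ (curve_on _ _ _ c1) (curve_on _ _ _ c2)).
by rewrite mulrDr.
Qed.

Lemma cmeanB phi psi : curve phi -> curve psi ->
  cmean (fun x => phi x - psi x) = cmean phi - cmean psi.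
Proof.
move=> c1 c2; rewrite /cmean (rcintB _ _ _ _ (curve_on _ _ _ c1) (curve_on _ _ _ c2)).
by rewrite mulrBr.
Qed.

Lemma cmeanZ c phi : curve phi -> cmean (fun x => c * phi x) = c * cmean phi.
Proof.
by move=> c1; rewrite /cmean (rcintZ _ _ _ _ (curve_on _ _ _ c1)) mulrCA.
Qed.

Lemma cmean_cst c : cmean (fun=> c) = c.
Proof.
rewrite /cmean rcint_cst ?ltW// subr0 mulrA -RCM mulVf ?mul1r//.
by rewrite gt_eqF.
Qed.

Lemma eq_cmean phi psi : phi =1 psi -> cmean phi = cmean psi.
Proof. by move=> e; congr (_ * _); apply: eq_rcint => x _; exact: e. Qed.

Lemma cmean_le phi M : curve phi ->
  (forall x, 0 <= x <= 2 * pi -> cnorm (phi x) <= M) ->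
  cnorm (cmean phi) <= M.
Proof.
move=> c1 le_M; rewrite cnormM cnormR ger0_norm ?invr_ge0 ?(ltW pi2)//.
rewrite mulrC ler_pdivrMr//.
have := rcint_bound 0 (2 * pi) phi M (ltW pi2) (curve_on _ _ _ c1) le_M.
by rewrite subr0.
Qed.

Lemma cmeanJ phi : curve phi -> cmean (fun x => conjc (phi x)) = conjc (cmean phi).
Proof.
move=> c1; rewrite /cmean rmorphM /= oppr0; congr (_ * _).
exact: cintJ (cont_on_integrable _ _ _ (curve_on _ _ _ c1)).
Qed.

Lemma curve_cst c : curve (fun=> c). Proof. by split=> x; exact: cvg_cst. Qed.
Lemma curveD phi psi : curve phi -> curve psi -> curve (fun x => phi x + psi x).
Proof. by move=> [c1] [c2]; split=> x; exact: (continuousD (c1 x) (c2 x)). Qed.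
Lemma curveB phi psi : curve phi -> curve psi -> curve (fun x => phi x - psi x).
Proof. by move=> [c1] [c2]; split=> x; exact: (continuousB (c1 x) (c2 x)). Qed.
Lemma curveM phi psi : curve phi -> curve psi -> curve (fun x => phi x * psi x).
Proof. by move=> [c1] [c2]; split=> x; exact: (continuousM (c1 x) (c2 x)). Qed.
Lemma curveV phi : curve phi -> (forall x, phi x != 0) -> curve (fun x => (phi x)^-1).
Proof. by move=> [c1] p0; split=> x; exact: (continuousV (p0 x) (c1 x)). Qed.
Lemma curveX phi n : curve phi -> curve (fun x => phi x ^+ n).
Proof.
move=> c1; elim: n => [|n IH].
  by rewrite (_ : (fun x => _) = fun=> 1); [exact: curve_cst|apply/funext => x; rewrite expr0].
rewrite (_ : (fun x => _) = (fun x => phi x * phi x ^+ n)); first exact: curveM.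
by apply/funext => x; rewrite exprS.
Qed.
Lemma curve_sum I (r : seq I) (P : I -> R -> C) :
  (forall i, curve (P i)) -> curve (fun x => \sum_(i <- r) P i x).
Proof.
move=> cP; elim: r => [|i r IH].
  rewrite (_ : (fun x => _) = fun=> 0); first exact: curve_cst.
  by apply/funext => x; rewrite big_nil.
rewrite (_ : (fun x => _) = (fun x => P i x + \sum_(i <- r) P i x)).
  exact: curveD.
by apply/funext => x; rewrite big_cons.
Qed.
Lemma cmean_sum I (r : seq I) (P : I -> R -> C) : (forall i, curve (P i)) ->
  cmean (fun x => \sum_(i <- r) P i x) = \sum_(i <- r) cmean (P i).
Proof.
move=> cP; elim: r => [|i r IH].
  rewrite big_nil -[RHS](cmean_cst 0); apply: eq_cmean => x; exact: big_nil.
rewrite big_cons -IH -cmeanD//; last exact: curve_sum.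
by apply: eq_cmean => x; exact: big_cons.
Qed.
Lemma curve_circ r : curve (circ r). Proof. by split; exact: continuous_circ. Qed.
End CircleMean.

Section CauchyIntegral.
Context {R : realType}.
Local Notation C := R[i].
Variables (r M : R) (phi : R -> C).
Hypotheses (r0 : 0 < r) (cphi : curve phi) 
  (phiM : forall x, 0 <= x <= 2 * pi -> cnorm (phi x) <= M).
Local Notation Z := (circ r).

Definition ccoef (phi : R -> C) j := cmean (fun x => phi x / circ r x ^+ j).
(** With z = circ r x, dz / (2 pi 'i (z - a)) becomes Z / (Z - a) dx / (2 pi): these are the Cauchy
    integral of [phi] and its derivative in a. Here [phi] is any continuous function, not yet the
    boundary values of a holomorphic one; [derivable_mixed] depends on this generality. *)
Definition cauchy0 (phi : R -> C) a := cmean (fun x => phi x * (Z x / (Z x - a))).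
Definition cauchy1 (phi : R -> C) a := cmean (fun x => phi x * (Z x / (Z x - a) ^+ 2)).

Let M0 : 0 <= M. Proof.
apply: le_trans (cnorm_ge0 _) (phiM 0 _).
by rewrite lexx mulr_ge0// pi_ge0.
Qed.
Let nZ x : cnorm (Z x) = r. Proof. by rewrite cnorm_circ// ltW. Qed.
Let Z0 x : Z x != 0. Proof. by rewrite -cnorm_gt0 nZ. Qed.
Let cZ : curve Z. Proof. exact: curve_circ. Qed.

Let dist_ge a x : r - cnorm a <= cnorm (Z x - a).
Proof. by have := cdist_le (Z x) a; rewrite nZ lerBlDl. Qed.

Let Za a x : cnorm a < r -> Z x - a != 0.
Proof.
move=> ar; rewrite -cnorm_gt0; apply: lt_le_trans (dist_ge a x).
by rewrite subr_gt0.
Qed.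

Lemma ccoef_le j : cnorm (ccoef phi j) <= M / r ^+ j.
Proof.
apply: cmean_le.
  apply: curveM => //; apply: curveV; first exact: curveX.
  by move=> x; rewrite expf_neq0.
by move=> x /phiM pM; rewrite cnormM cnormV cnormX nZ ler_wpM2r// invr_ge0 exprn_ge0// ltW.
Qed.

Lemma cauchy0_series a : cnorm a < r ->
  cnorm (\sum_(j < n) ccoef phi j * a ^+ j - cauchy0 phi a) @[n --> \oo] --> (0 : R).
Proof.
move=> ar; pose q := cnorm a / r.
have q0 : 0 <= q by rewrite divr_ge0 ?cnorm_ge0// ltW.
have q1 : q < 1 by rewrite ltr_pdivrMr// mul1r.
apply: (squeeze_cvgr _ (cvg_cst 0) (cvg_geo0 (M * (r / (r - cnorm a))) q _)); last by rewrite q0.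
apply: nearW => n; rewrite cnorm_ge0 /= cdistC.
have ck : curve (fun x => Z x / (Z x - a)).
  by apply: curveM => //; apply: curveV; [apply: curveB => //; exact: curve_cst|move=> x; exact: Za].
have cj (j : 'I_n) : curve (fun x => phi x / Z x ^+ j).
  apply: curveM => //; apply: curveV; first exact: curveX.
  by move=> x; rewrite expf_neq0.
have cja (j : 'I_n) : curve (fun x => a ^+ j * (phi x / Z x ^+ j)).
  by apply: curveM => //; exact: curve_cst.
have -> : \sum_(j < n) ccoef phi j * a ^+ j =
    cmean (fun x => \sum_(j < n) a ^+ j * (phi x / Z x ^+ j)).
  by rewrite cmean_sum//; apply: eq_bigr => j _; rewrite cmeanZ// mulrC.
rewrite -cmeanB; [|exact: curveM|exact: curve_sum].
apply: cmean_le; first by apply: curveB; [exact: curveM|exact: curve_sum].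
move=> x /phiM pM; have za := Za a x ar; have z0 := Z0 x.
have -> : phi x * (Z x / (Z x - a)) - \sum_(j < n) a ^+ j * (phi x / Z x ^+ j) =
    phi x * ((a / Z x) ^+ n * (Z x / (Z x - a))).
  have y1 : a / Z x != 1.
    by rewrite -subr_eq0 -(divff z0) -mulrBl mulf_neq0 ?invr_eq0// -opprB oppr_eq0.
  have -> : \sum_(j < n) a ^+ j * (phi x / Z x ^+ j) =
      phi x * \sum_(j < n) (a / Z x) ^+ j.
    by rewrite mulr_sumr; apply: eq_bigr => j _; rewrite expr_div_n mulrCA.
  have kE : Z x / (Z x - a) = (1 - a / Z x)^-1.
    by move: (Z x) za z0 => z za z0; field; rewrite za z0.
  by rewrite kE -mulrBr geo_sum.
rewrite !cnormM cnormX cnormM !cnormV nZ -/q mulrCA mulrC.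
rewrite ler_wpM2r ?exprn_ge0// ler_pM ?cnorm_ge0 ?divr_ge0 ?cnorm_ge0//; first exact: ltW.
by rewrite ler_wpM2l ?(ltW r0)// lef_pV2 ?posrE ?cnorm_gt0 ?subr_gt0.
Qed.

Lemma cauchy1_series a : cnorm a < r ->
  cnorm (\sum_(j < n) j.+1%:R * ccoef phi j.+1 * a ^+ j - cauchy1 phi a)
    @[n --> \oo] --> (0 : R).
Proof.
move=> ar; pose q := cnorm a / r.
have q0 : 0 <= q by rewrite divr_ge0 ?cnorm_ge0// ltW.
have q1 : q < 1 by rewrite ltr_pdivrMr// mul1r.
(* M / r bounds phi / Z. In the remainder of [geo_sum2], |n + 1 - n y| <= 2 (n + 1) and |1 - y| >= 1
   - q give the other factor. *)
pose K := M / r * (2 / (1 - q) ^+ 2).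
have : K * (n.+1%:R * q ^+ n) @[n --> \oo] --> (0 : R).
  rewrite -[X in _ --> X](mulr0 K); apply: cvgM; first exact: cvg_cst.
  exact: cvg_natX0.
apply: (squeeze_cvgr _ (cvg_cst 0)).
apply: nearW => n; rewrite cnorm_ge0 /= cdistC.
have ck : curve (fun x => Z x / (Z x - a) ^+ 2).
  apply: curveM => //; apply: curveV; last by move=> x; rewrite expf_neq0// Za.
  by apply: curveX; apply: curveB => //; exact: curve_cst.
have cj (j : 'I_n) : curve (fun x => phi x / Z x ^+ j.+1).
  apply: curveM => //; apply: curveV; first exact: curveX.
  by move=> x; rewrite expf_neq0.
have cja (j : 'I_n) : curve (fun x => j.+1%:R * a ^+ j * (phi x / Z x ^+ j.+1)).
  by apply: curveM => //; exact: curve_cst.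
have -> : \sum_(j < n) j.+1%:R * ccoef phi j.+1 * a ^+ j =
    cmean (fun x => \sum_(j < n) j.+1%:R * a ^+ j * (phi x / Z x ^+ j.+1)).
  by rewrite cmean_sum//; apply: eq_bigr => j _; rewrite cmeanZ// mulrAC.
rewrite -cmeanB; [|exact: curveM|exact: curve_sum].
apply: cmean_le; first by apply: curveB; [exact: curveM|exact: curve_sum].
move=> x /phiM pM; have za := Za a x ar; have z0 := Z0 x.
set y := a / Z x.
have ny : cnorm y = q by rewrite /y cnormM cnormV nZ.
have y1 : y != 1 by apply/eqP => yE; move: q1; rewrite -ny yE cnorm1 ltxx.
have -> : phi x * (Z x / (Z x - a) ^+ 2) -
    \sum_(j < n) j.+1%:R * a ^+ j * (phi x / Z x ^+ j.+1) =
    phi x / Z x * ((n.+1%:R - n%:R * y) * y ^+ n / (1 - y) ^+ 2).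
  have -> : \sum_(j < n) j.+1%:R * a ^+ j * (phi x / Z x ^+ j.+1) =
      phi x / Z x * \sum_(j < n) j.+1%:R * y ^+ j.
    rewrite mulr_sumr; apply: eq_bigr => j _; rewrite expr_div_n exprS invfM.
    by move: (Z x ^+ j)^-1 (Z x)^-1 (phi x) (a ^+ j) => u1 u2 u3 u4; ring.
  have kE : Z x / (Z x - a) ^+ 2 = (Z x)^-1 * (1 - y) ^- 2.
    by rewrite /y; move: (Z x) za z0 => z za z0; field; rewrite za z0.
  by rewrite kE mulrA -mulrBr geo_sum2.
rewrite cnormM [cnorm (phi x / _)]cnormM cnormV nZ /K -[leRHS]mulrA.
apply: ler_pM; rewrite ?cnorm_ge0 ?mulr_ge0 ?cnorm_ge0 ?invr_ge0 ?(ltW r0)//.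
  by rewrite ler_wpM2r ?invr_ge0 ?(ltW r0).
rewrite 2!cnormM cnormV !cnormX ny.
have n1 : cnorm (n.+1%:R - n%:R * y) <= 2 * n.+1%:R.
  apply: le_trans (cnormB _ _) _; rewrite cnormM !cnorm_nat ny mulr2n mulrDl mul1r lerD2l.
  apply: (@le_trans _ _ (n%:R * 1)); first by rewrite ler_wpM2l// ltW.
  by rewrite mulr1 ler_nat.
have y2 : 1 - q <= cnorm (1 - y).
  by rewrite lerBlDl -ny; have := cdist_le 1 y; rewrite cnorm1.
have q1' : 0 < 1 - q by rewrite subr_gt0.
have -> : 2 / (1 - q) ^+ 2 * (n.+1%:R * q ^+ n) = 2 * n.+1%:R * q ^+ n / (1 - q) ^+ 2.
  by move: (_^-1) => u; ring.
apply: ler_pM; rewrite ?invr_ge0 ?exprn_ge0 ?mulr_ge0 ?cnorm_ge0 ?exprn_ge0//.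
  by rewrite ler_wpM2r ?exprn_ge0.
rewrite lef_pV2 ?posrE ?exprn_gt0 ?(lt_le_trans q1' y2)//.
by rewrite lerXn2r ?nnegrE ?cnorm_ge0 ?(ltW q1').
Qed.

(** The remainder is exactly the mean of phi Z h^2 / ((Z - a - h) (Z - a)^2), and |Z - a - h| is at
    least half of r - |a|. The constant depends on [phi] only through [M], which makes difference
    quotients converge uniformly over families of such functions. *)
Lemma cauchy0_quad a h : cnorm a < r -> cnorm h < (r - cnorm a) / 2 ->
  cnorm (cauchy0 phi (a + h) - cauchy0 phi a - cauchy1 phi a * h) <=
  M * (r * (2 / (r - cnorm a) ^+ 3)) * cnorm h ^+ 2.
Proof.
move=> ar; set eta := r - cnorm a; have eta0 : 0 < eta by rewrite subr_gt0.
move=> h1.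
have ahr : cnorm (a + h) < r.
  apply: le_lt_trans (cnormD _ _) _; move: h1; rewrite /eta.
  have := cnorm_ge0 h; lra.
have cz b : cnorm b < r -> curve (fun x => Z x / (Z x - b)).
  move=> br; apply: curveM => //.
  by apply: curveV; [apply: curveB => //; exact: curve_cst|move=> x; exact: Za].
have ck b : cnorm b < r -> curve (fun x => phi x * (Z x / (Z x - b))).
  by move=> /cz; exact: curveM.
have cz2 : curve (fun x => (Z x - a) ^+ 2).
  by apply: curveX; apply: curveB => //; exact: curve_cst.
have cz3 : curve (fun x => Z x / (Z x - a) ^+ 2).
  by apply: curveM => //; apply: curveV => // x; rewrite expf_neq0// Za.
have ck2 : curve (fun x => phi x * (Z x / (Z x - a) ^+ 2)) by exact: curveM.
have ck3 : curve (fun x => h * (phi x * (Z x / (Z x - a) ^+ 2))).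
  by apply: curveM => //; exact: curve_cst.
have ck4 : curve (fun x => phi x * (Z x / (Z x - (a + h))) - phi x * (Z x / (Z x - a))).
  by apply: curveB; exact: ck.
rewrite [_ * h]mulrC -cmeanZ// -cmeanB; [|exact: ck|exact: ck].
rewrite -cmeanB//; apply: cmean_le; first exact: curveB.
move=> x /phiM pM; have z1 := Za a x ar; have z2 := Za (a + h) x ahr.
have -> : phi x * (Z x / (Z x - (a + h))) - phi x * (Z x / (Z x - a)) -
   h * (phi x * (Z x / (Z x - a) ^+ 2)) =
   phi x * (Z x * ((Z x - (a + h))^-1 * (Z x - a) ^- 2)) * h ^+ 2.
  by move: (Z x) (phi x) z1 z2 => z p z1 z2; field; rewrite z1 z2.
rewrite cnormM cnormX ler_wpM2r ?exprn_ge0 ?cnorm_ge0//.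
rewrite !cnormM nZ !cnormV cnormX.
apply: ler_pM => //; [exact: cnorm_ge0|by rewrite !mulr_ge0 ?invr_ge0 ?exprn_ge0 ?cnorm_ge0// ltW|].
rewrite ler_wpM2l ?(ltW r0)//.
have -> : 2 / eta ^+ 3 = (eta / 2)^-1 * (eta ^+ 2)^-1.
  by field; rewrite gt_eqF.
have dh : eta / 2 <= cnorm (Z x - (a + h)).
  apply: le_trans (dist_ge _ _); move: h1 (cnormD a h); rewrite /eta; lra.
apply: ler_pM; rewrite ?invr_ge0 ?exprn_ge0 ?cnorm_ge0//.
  by rewrite lef_pV2 ?posrE ?cnorm_gt0// divr_gt0.
rewrite lef_pV2 ?posrE ?exprn_gt0 ?cnorm_gt0// lerXn2r ?nnegrE ?cnorm_ge0 ?(ltW eta0)//.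
exact: dist_ge.
Qed.

Lemma cauchy0_deriv a : cnorm a < r -> cderiv (cauchy0 phi) a (cauchy1 phi a).
Proof.
move=> ar; pose eta := r - cnorm a; have eta0 : 0 < eta by rewrite subr_gt0.
pose K := M * (r * (2 / eta ^+ 3)) + 1.
have K0 : 0 < K.
  rewrite /K ltr_wpDl// mulr_ge0// mulr_ge0 ?(ltW r0)// divr_ge0//.
  by rewrite exprn_ge0// ltW.
move=> e e0; exists (Num.min (eta / 2) (e / K)).
  by rewrite lt_min !divr_gt0.
move=> h; rewrite lt_min => /andP[h1 h2].
apply: le_trans (cauchy0_quad _ _ ar h1) _; rewrite expr2 [leLHS]mulrA -/eta.
rewrite ler_wpM2r ?cnorm_ge0//; apply: (@le_trans _ _ (K * cnorm h)).
  by rewrite ler_wpM2r ?cnorm_ge0// /K lerDl.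
by move: h2; rewrite ltr_pdivlMr// mulrC => /ltW.
Qed.

Lemma cauchy0_le a : cnorm a < r -> cnorm (cauchy0 phi a) <= M * (r / (r - cnorm a)).
Proof.
move=> ar; have cz : curve (fun x => Z x / (Z x - a)).
  apply: curveM => //.
  by apply: curveV; [apply: curveB => //; exact: curve_cst|move=> x; exact: Za].
apply: cmean_le; first exact: curveM.
move=> x /phiM pM; rewrite !cnormM cnormV nZ.
apply: ler_pM; rewrite ?cnorm_ge0 ?mulr_ge0 ?invr_ge0 ?cnorm_ge0 ?(ltW r0)//.
rewrite ler_wpM2l ?(ltW r0)// lef_pV2 ?posrE ?subr_gt0 ?cnorm_gt0 ?Za//.
Qed.

End CauchyIntegral.

Section CurveBound.
Context {R : realType}.
Local Notation C := R[i].

Lemma curve_bounded (phi : R -> C) (a b : R) : curve phi ->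
  exists M, forall x, a <= x <= b -> cnorm (phi x) <= M.
Proof.
move=> [cphi]; have [ab|ba] := leP a b; last first.
  by exists 0 => x /andP[ax xb]; have := lt_le_trans ba (le_trans ax xb); rewrite ltxx.
have cc : {within `[a, b], continuous (fun x => cnorm (phi x))}.
  by apply: continuous_subspaceT => x; exact: (continuous_cnorm _ _ _ (cphi x)).
have [c _ hc] := EVT_max ab cc.
by exists (cnorm (phi c)) => x xab; apply: hc; rewrite in_itv.
Qed.

End CurveBound.

Section CauchyFormulaDisk.
Context {R : realType}.
Local Notation C := R[i].

Lemma curve_comp (f : C -> C) (phi : R -> C) : curve phi ->
  (forall x, {for phi x, continuous f}) -> curve (fun x => f (phi x)).
Proof. by move=> [cp] cf; split=> x; exact: (continuous_comp (cp x) (cf x)). Qed.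

Lemma curve_circ_derivable (f : C -> C) (s r : R) : 0 < r -> r < s ->
  (forall z, cnorm z < s -> derivable f z 1) -> curve (fun x => f (circ r x)).
Proof.
move=> r0 rs df; apply: curve_comp; first exact: curve_circ.
move=> x; apply/ccontP/cderiv_cont/derivable_cderiv/df.
by rewrite cnorm_circ ?ltW.
Qed.

(** Let F(z) = 1 / (1 - b z) with b = conj a / r^2, whose pole r^2 / conj a lies outside the circle.
    On the circle the conjugate of F(Z) is Z / (Z - a). Since the kernel at centre 0 is the constant
    'i, [cauchy_const] at 0 gives F the mean F(0) = 1. *)
Lemma cmean_kernel (r : R) (a : C) : cnorm a < r ->
  cmean (fun x => circ r x / (circ r x - a)) = 1.
Proof.
move=> ar; have r0 : 0 < r := le_lt_trans (cnorm_ge0 _) ar.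
have nZ x : cnorm (circ r x) = r by rewrite cnorm_circ// ltW.
have Z0 x : circ r x != 0 by rewrite -cnorm_gt0 nZ.
have Za x : circ r x - a != 0.
  rewrite subr_eq0; apply/eqP => za; move: ar; rewrite -za nZ ltxx//.
have ra0 : 0 < r + cnorm a by rewrite ltr_wpDr// cnorm_ge0.
pose b : C := conjc a / (r ^+ 2)%:C.
(* The harmonic mean of r and the modulus r^2 / |a| of the pole, in a form that also makes sense for
   a = 0. *)
pose s := 2 * r ^+ 2 / (r + cnorm a).
have rs : r < s.
  rewrite /s ltr_pdivlMr// expr2 mulrA -[ltLHS]mulrC ltr_pM2r//; move: ar; lra.
have bz z : cnorm z < s -> 1 - b * z != 0.
  move=> zs; rewrite subr_eq0; apply/eqP => bz1.
  have : cnorm (b * z) < 1.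
    rewrite /b !cnormM cnormV cnormJ cnormR ger0_norm ?exprn_ge0 ?(ltW r0)//.
    rewrite mulrAC ltr_pdivrMr ?exprn_gt0// mul1r.
    have [a0|a0] := eqVneq (cnorm a) 0; first by rewrite a0 mul0r exprn_gt0.
    have a0' : 0 < cnorm a by rewrite lt_neqAle eq_sym a0 cnorm_ge0.
    apply: lt_le_trans (_ : cnorm a * s <= _); first by rewrite ltr_pM2l.
    rewrite /s mulrA ler_pdivrMr//.
    have : 0 <= r ^+ 2 * (r - cnorm a) by apply: mulr_ge0; rewrite ?exprn_ge0 ?subr_ge0 ?(ltW r0) ?(ltW ar).
    lra.
  by rewrite -bz1 cnorm1 ltxx.
pose F z : C := (1 - b * z)^-1.
have dF z : cnorm z < s -> derivable F z 1.
  move=> zs; have z1 := bz z zs.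
  have [] // := (cderivP F z (b / (1 - b * z) ^+ 2)).1.
  have d0 : 0 < cnorm (1 - b * z) by rewrite cnorm_gt0.
  have nb1 : 0 < 2 * cnorm b + 1 by rewrite ltr_wpDl// mulr_ge0// cnorm_ge0.
  have nb2 : 0 < 2 * cnorm b ^+ 2 + 1 by rewrite ltr_wpDl// mulr_ge0// exprn_ge0// cnorm_ge0.
  move=> e e0; exists (Num.min (cnorm (1 - b * z) / (2 * cnorm b + 1))
      (e * cnorm (1 - b * z) ^+ 3 / (2 * cnorm b ^+ 2 + 1))).
    by rewrite lt_min !divr_gt0 ?mulr_gt0 ?exprn_gt0.
  move=> h; rewrite lt_min => /andP[h1 h2].
  have hb : cnorm (b * h) <= cnorm (1 - b * z) / 2.
    rewrite cnormM; move: h1; rewrite ltr_pdivlMr//; have := cnorm_ge0 h; lra.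
  have big : cnorm (1 - b * z) / 2 <= cnorm (1 - b * (z + h)).
    have := cdist_le (1 - b * z) (1 - b * (z + h)).
    by rewrite (_ : 1 - b * z - (1 - b * (z + h)) = b * h); [move: hb; lra|ring].
  have z2 : 1 - b * (z + h) != 0.
    by rewrite -cnorm_gt0; apply: lt_le_trans big; rewrite divr_gt0.
  have -> : F (z + h) - F z - b / (1 - b * z) ^+ 2 * h =
      b ^+ 2 * h ^+ 2 / ((1 - b * (z + h)) * (1 - b * z) ^+ 2).
    by rewrite /F; clear -z1 z2; move: b z1 z2 => b' z1 z2; field; rewrite z1 z2.
  rewrite (cnormM (b ^+ 2 * h ^+ 2)) (cnormM (b ^+ 2)) cnormV (cnormM (1 - b * (z + h))) !cnormX.
  rewrite ler_pdivrMr ?mulr_gt0 ?exprn_gt0 ?cnorm_gt0//.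
  apply: (@le_trans _ _ (e * cnorm h * (cnorm (1 - b * z) / 2 * cnorm (1 - b * z) ^+ 2))); last first.
    rewrite ler_wpM2l ?mulr_ge0 ?cnorm_ge0 ?(ltW e0)// ler_wpM2r// exprn_ge0// cnorm_ge0//.
  rewrite (_ : _ * _ = cnorm h * (cnorm h * cnorm b ^+ 2)); last by ring.
  rewrite [e * _]mulrC -[leRHS]mulrA ler_wpM2l ?cnorm_ge0//.
  move: h2; rewrite ltr_pdivlMr// => h2.
  have : cnorm h * (2 * cnorm b ^+ 2) <= e * cnorm (1 - b * z) ^+ 3.
    apply: le_trans (ltW h2); rewrite ler_wpM2l ?cnorm_ge0// lerDl//.
  rewrite exprS; lra.
have := @cauchy_const R F s r 0 _ rs dF.
rewrite cnorm0 => /(_ r0).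
rewrite {2}/F mulr0 subr0 invr1 mul1r.
have kE : (fun x => 'i * circ r x / (circ r x - 0)) = (fun=> 'i) :> (R -> C).
  by apply/funext => x; rewrite subr0 mulfK.
rewrite kE => cF; have {}cF : cmean (fun x => 'i * F (circ r x)) = 'i.
  rewrite -[RHS](cmean_cst 'i) /cmean -cF; congr (_ * _).
  apply: eq_rcint => x _; rewrite mulrC; congr (_ * _).
  by have := congr1 (fun g => g x) kE => /= ->.
have cFc : curve (fun x => F (circ r x)) by exact: (curve_circ_derivable _ s).
move: cF; rewrite cmeanZ// -[X in _ = X -> _]mulr1 => /mulfI cF.
have {}cF : cmean (fun x => F (circ r x)) = 1.
  by apply: cF; rewrite eq_complex /= oner_eq0 andbF.
rewrite -[RHS]conjc1 -cF -cmeanJ//; apply: eq_cmean => x.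
have -> : conjc (F (circ r x)) = (1 - conjc b * conjc (circ r x))^-1.
  by rewrite /F conjc_inv rmorphB rmorph1 rmorphM.
have -> : conjc b = a / (r ^+ 2)%:C.
  by rewrite /b conjcM conjcK conjc_inv conjc_real.
have -> : (r ^+ 2)%:C = circ r x * conjc (circ r x) by rewrite mulcJ nZ.
have J0 : conjc (circ r x) != 0 by rewrite conjc_eq0.
move: (circ r x) (Z0 x) (Za x) (conjc (circ r x)) J0 => z z0 za w w0.
have w1 : 1 - a / (z * w) * w = (z - a) / z by field; rewrite z0 w0.
by rewrite w1 invf_div.
Qed.

Lemma cauchy_formula (f : C -> C) (s r : R) (a : C) : cnorm a < r -> r < s ->
  (forall z, cnorm z < s -> derivable f z 1) ->
  cauchy0 r (fun x => f (circ r x)) a = f a.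
Proof.
move=> ar rs df; have r0 : 0 < r := le_lt_trans (cnorm_ge0 _) ar.
have Za x : circ r x - a != 0.
  rewrite subr_eq0; apply/eqP => za; move: ar; rewrite -za cnorm_circ ?ltxx// ltW//.
have ck : curve (fun x => circ r x / (circ r x - a)).
  apply: curveM; first exact: curve_circ.
  by apply: curveV => //; apply: curveB; [exact: curve_circ|exact: curve_cst].
have cf := curve_circ_derivable _ _ _ r0 rs df.
have i0 : 'i != 0 :> C by rewrite eq_complex /= oner_eq0 andbF.
apply: (mulfI i0); rewrite /cauchy0 -cmeanZ; last exact: curveM.
have -> : 'i * f a = f a * cmean (fun x => 'i * (circ r x / (circ r x - a))).
  by rewrite cmeanZ// cmean_kernel// mulr1 mulrC.
rewrite /cmean [RHS]mulrCA; congr (_ * _).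
have := cauchy_const f s r a ar rs df.
under [in X in X = _ -> _]eq_rcint => x _ do rewrite -mulrA mulrCA.
under [in X in _ = X -> _]eq_rcint => x _ do rewrite -mulrA.
by [].
Qed.

End CauchyFormulaDisk.

(** * Taylor series on the unit disk *)

Section Taylor.
Context {R : realType}.
Local Notation C := R[i].
Implicit Types (c : nat -> C) (f : C -> C).

Lemma geo_le (q : R) n : 0 <= q -> q < 1 -> \sum_(i < n) q ^+ i <= (1 - q)^-1.
Proof.
move=> q0 q1; have q1' : 0 < 1 - q by rewrite subr_gt0.
rewrite -[leRHS]mul1r ler_pdivlMr// -[1 - q]opprB mulrN mulrC -subrX1 opprB.
by rewrite lerBlDr lerDl exprn_ge0.
Qed.

Lemma cvg0_le0 (u : nat -> R) (x : R) : u n @[n --> \oo] --> 0 ->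
  (forall n, x <= u n) -> x <= 0.
Proof.
move=> u0 xu; rewrite -(cvg_lim _ u0)//; apply: limr_ge; first by apply/cvg_ex; exists 0.
exact: nearW.
Qed.

(** By strong induction the lower coefficients vanish, so |c_n| t^n is at most the tail, of order
    t^(n+1). For t <= r / 2 the ratio t / r is at most 1 / 2, hence the factor 2 in the bound; then
    t tends to 0. *)
Lemma power_series_eq0 c (r M : R) : 0 < r ->
  (forall j, cnorm (c j) <= M / r ^+ j) ->
  (forall z, cnorm z < r ->
    cnorm (\sum_(j < n) c j * z ^+ j) @[n --> \oo] --> (0 : R)) ->
  forall j, c j = 0.
Proof.
move=> r0 cM sum0; elim/ltn_ind => n IH.
have M0 : 0 <= M by have := le_trans (cnorm_ge0 _) (cM 0%N); rewrite expr0 divr1.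
suff key t : 0 < t -> t <= r / 2 -> cnorm (c n) <= (2 * M / r ^+ n.+1) * t.
  apply/eqP; rewrite -cnorm_eq0 eq_le cnorm_ge0 andbT.
  apply/ler_addgt0Pr => e e0; rewrite add0r.
  have K0 : 0 < 2 * M / r ^+ n.+1 + 1.
    by rewrite ltr_wpDl// divr_ge0 ?mulr_ge0// exprn_ge0// ltW.
  pose t := Num.min (r / 2) (e / (2 * M / r ^+ n.+1 + 1)).
  have t0 : 0 < t by rewrite lt_min !divr_gt0.
  apply: le_trans (key t t0 _) _; first by rewrite ge_min lexx.
  apply: (@le_trans _ _ ((2 * M / r ^+ n.+1 + 1) * t)).
    by rewrite ler_wpM2r ?(ltW t0)// lerDl.
  by rewrite mulrC -ler_pdivlMr// ge_min lexx orbT.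
move=> t0 tr.
have tltr : t < r by move: tr; lra.
have h0 := sum0 t%:C; rewrite cnormR gtr0_norm// in h0; have {}h0 := h0 tltr.
have := h0; rewrite -(cvg_shiftn n.+1) => {}h0.
have tn0 : 0 < t ^+ n by rewrite exprn_gt0.
rewrite -(ler_pM2r tn0) -subr_le0.
apply: (cvg0_le0 _ _ h0) => k; rewrite lerBlDr /=.
rewrite addnC big_split_ord /= big_ord_recr /= big1 ?add0r; last first.
  by move=> i _; rewrite IH ?mul0r.
set S := \sum_(_ < k) _.
have Sle : cnorm S <= 2 * M / r ^+ n.+1 * t * t ^+ n.
  apply: le_trans (cnorm_sum _ _ _ _) _.
  apply: (@le_trans _ _ (\sum_(i < k) M * (t / r) ^+ n.+1 * (t / r) ^+ i)).
    apply: ler_sum => i _; rewrite cnormM cnormX cnormR gtr0_norm//.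
    rewrite -mulrA -exprD expr_div_n [leRHS]mulrA [leRHS]mulrAC.
    by apply: ler_wpM2r; [rewrite exprn_ge0// ltW|exact: cM].
  rewrite -mulr_sumr.
  have q1 : t / r <= 2^-1 by rewrite ler_pdivrMr// mulrC.
  have -> : 2 * M / r ^+ n.+1 * t * t ^+ n = M * (t / r) ^+ n.+1 * 2.
    by rewrite expr_div_n [t ^+ n.+1]exprS; move: (_^-1) => u; ring.
  rewrite ler_wpM2l ?mulr_ge0 ?exprn_ge0 ?divr_ge0 ?(ltW t0) ?(ltW r0)//.
  apply: le_trans (geo_le _ _ _ _) _; first by apply: divr_ge0; exact: ltW.
    by apply: le_lt_trans q1 _; rewrite invf_lt1// ltr1n.
  rewrite -[leRHS]invrK lef_pV2 ?posrE//; move: q1; lra.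
have -> : cnorm (c n) * t ^+ n = cnorm (c n * t%:C ^+ n).
  by rewrite cnormM cnormX cnormR gtr0_norm.
apply: le_trans (cdist_le _ (c n * t%:C ^+ n + S)) _.
by rewrite lerD2l opprD addrA subrr add0r cnormN.
Qed.

(** The Cauchy estimates at every radius below 1 accompany pointwise convergence: they supply the
    uniform bounds for dominated convergence and for the uniqueness of coefficients. *)
Definition has_taylor f c :=
  (forall r : R, 0 < r < 1 -> exists M, forall j, cnorm (c j) <= M / r ^+ j) /\
  (forall z, cnorm z < 1 ->
    cnorm (\sum_(j < n) c j * z ^+ j - f z) @[n --> \oo] --> (0 : R)).

Lemma squeeze0 (u v : nat -> R) : (forall n, 0 <= u n) -> (forall n, u n <= v n) ->
  v n @[n --> \oo] --> 0 -> u n @[n --> \oo] --> 0.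
Proof.
move=> u0 uv; apply: (squeeze_cvgr _ (cvg_cst 0)).
by apply: nearW => n; rewrite u0 uv.
Qed.

Lemma squeeze0D (u v w : nat -> R) : (forall n, 0 <= u n) ->
  (forall n, u n <= v n + w n) ->
  v n @[n --> \oo] --> 0 -> w n @[n --> \oo] --> 0 -> u n @[n --> \oo] --> 0.
Proof.
move=> u0 uvw v0 w0; apply: (squeeze0 _ (fun n => v n + w n) u0 uvw).
by rewrite -[X in _ --> X]addr0; apply: cvgD.
Qed.

Lemma series_unique f c d (r M : R) : 0 < r ->
  (forall j, cnorm (c j) <= M / r ^+ j) -> (forall j, cnorm (d j) <= M / r ^+ j) ->
  (forall z, cnorm z < r ->
    cnorm (\sum_(j < n) c j * z ^+ j - f z) @[n --> \oo] --> (0 : R)) ->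
  (forall z, cnorm z < r ->
    cnorm (\sum_(j < n) d j * z ^+ j - f z) @[n --> \oo] --> (0 : R)) ->
  forall j, c j = d j.
Proof.
move=> r0 cM dM cf df j; apply/eqP; rewrite -subr_eq0; apply/eqP.
apply: (power_series_eq0 (fun j => c j - d j) r (M + M)) => //.
  by move=> i; rewrite mulrDl; apply: le_trans (cnormB _ _) (lerD _ _).
move=> z zr; apply: (squeeze0D _ _ _ _ _ (cf z zr) (df z zr)).
  by move=> n; exact: cnorm_ge0.
move=> n; have -> : \sum_(j < n) (c j - d j) * z ^+ j =
    \sum_(j < n) c j * z ^+ j - \sum_(j < n) d j * z ^+ j.
  by rewrite -sumrB; apply: eq_bigr => i _; rewrite mulrBl.
apply: le_trans (cnormB _ _).
by rewrite opprB addrA subrK.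
Qed.

Lemma has_taylor_unique f c d : has_taylor f c -> has_taylor f d -> forall j, c j = d j.
Proof.
move=> [cb cf] [db df]; have h2 : 0 < (2^-1 : R) < 1 by rewrite invr_gt0 ltr0n invf_lt1 ?ltr1n.
have [M1 h1] := cb _ h2; have [M2 h3] := db _ h2.
have p0 : 0 < 2^-1 :> R by case/andP: h2.
apply: (series_unique f c d 2^-1 (Num.max M1 M2)) => //.
- move=> j; apply: le_trans (h1 j) _; rewrite ler_wpM2r ?invr_ge0 ?exprn_ge0 ?(ltW p0)//.
  by rewrite le_max lexx.
- move=> j; apply: le_trans (h3 j) _; rewrite ler_wpM2r ?invr_ge0 ?exprn_ge0 ?(ltW p0)//.
  by rewrite le_max lexx orbT.
- move=> z zr; apply: cf; apply: lt_trans zr _; by case/andP: h2.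
- move=> z zr; apply: df; apply: lt_trans zr _; by case/andP: h2.
Qed.

Lemma cderiv_local f g (z l : C) (r : R) : cnorm z < r ->
  (forall w, cnorm w < r -> f w = g w) -> cderiv f z l -> cderiv g z l.
Proof.
move=> zr fg df e e0; have [d d0 hd] := df e e0.
exists (Num.min d (r - cnorm z)); first by rewrite lt_min d0 subr_gt0.
move=> h; rewrite lt_min => /andP[hd' hr].
rewrite -!fg//; first exact: hd.
by apply: le_lt_trans (cnormD _ _) _; rewrite -ltrBrDl.
Qed.

Lemma cderiv_unique f z l l' : cderiv f z l -> cderiv f z l' -> l = l'.
Proof. by move=> /cderivP[_ <-] /cderivP[_ <-]. Qed.

(** Each circle of radius r < 1 yields coefficients whose series represents [f] and its derivative
    inside that circle. Uniqueness identifies them with those of the circle of radius 1/2, so one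
    sequence serves the whole disk. *)
Lemma taylor_disk f : (forall z, cnorm z < 1 -> derivable f z 1) ->
  exists c, has_taylor f c /\ forall z, cnorm z < 1 ->
    cnorm (\sum_(j < n) j.+1%:R * c j.+1 * z ^+ j - derive1 f z)
      @[n --> \oo] --> (0 : R).
Proof.
move=> df.
have loc (r : R) : 0 < r -> r < 1 -> exists M : R, [/\ forall j, cnorm (ccoef r (fun x => f (circ r x)) j) <= M / r ^+ j,
   forall z, cnorm z < r -> cnorm (\sum_(j < n) ccoef r (fun x => f (circ r x)) j * z ^+ j - f z) @[n --> \oo] --> (0 : R) &
   forall z, cnorm z < r -> cnorm (\sum_(j < n) j.+1%:R * ccoef r (fun x => f (circ r x)) j.+1 * z ^+ j - derive1 f z)
      @[n --> \oo] --> (0 : R)].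
  move=> r0 r1; have cf := curve_circ_derivable f 1 r r0 r1 df.
  have [M hM] := curve_bounded _ 0 (2 * pi) cf.
  exists M; split.
  - by move=> j; exact: ccoef_le.
  - move=> z zr; have := cauchy0_series r M _ r0 cf hM z zr.
    by rewrite (cauchy_formula f 1 r z zr r1 df).
  - move=> z zr; have := cauchy1_series r M _ r0 cf hM z zr.
    suff -> : cauchy1 r (fun x => f (circ r x)) z = derive1 f z by [].
    apply: (cderiv_unique f z); last first.
      by apply/derivable_cderiv/df; exact: lt_trans r1.
    apply: (cderiv_local (cauchy0 r (fun x => f (circ r x))) f z _ r zr).
      by move=> w wr; exact: (cauchy_formula f 1 r w wr r1 df).
    exact: (cauchy0_deriv r M _ r0 cf hM z zr).
have h0 : 0 < 2^-1 :> R by rewrite invr_gt0.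
have h1 : 2^-1 < 1 :> R by rewrite invf_lt1 ?ltr1n.
have [M1 [b1 s1 d1]] := loc _ h0 h1.
have same (r : R) : 0 < r -> r < 1 ->
    forall j, ccoef 2^-1 (fun x => f (circ 2^-1 x)) j = ccoef r (fun x => f (circ r x)) j.
  move=> r0 r1; have [M2 [b2 s2 d2]] := loc _ r0 r1.
  (* Both series are known to converge on the smaller of the two disks, where uniqueness is
     applied. *)
  pose m := Num.min 2^-1 r; have m0 : 0 < m by rewrite lt_min h0.
  have mono (N N' x : R) j : 0 <= N -> N <= N' -> 0 < x -> m <= x -> N / x ^+ j <= N' / m ^+ j.
    move=> N0 NN x0 mx; apply: ler_pM => //; first by rewrite invr_ge0 exprn_ge0// ltW.
    by rewrite lef_pV2 ?posrE ?exprn_gt0// lerXn2r ?nnegrE ?(ltW m0) ?(ltW x0).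
  have M10 : 0 <= M1 by have := le_trans (cnorm_ge0 _) (b1 0%N); rewrite expr0 divr1.
  have M20 : 0 <= M2 by have := le_trans (cnorm_ge0 _) (b2 0%N); rewrite expr0 divr1.
  apply: (series_unique f _ _ m (Num.max M1 M2)) => //.
  - move=> j; apply: le_trans (b1 j) _; apply: mono => //; first by rewrite le_max lexx.
    by rewrite ge_min lexx.
  - move=> j; apply: le_trans (b2 j) _; apply: mono => //; first by rewrite le_max lexx orbT.
    by rewrite ge_min lexx orbT.
  - by move=> z; rewrite lt_min => /andP[z1 z2]; exact: s1.
  - by move=> z; rewrite lt_min => /andP[z1 z2]; exact: s2.
exists (ccoef 2^-1 (fun x => f (circ 2^-1 x))).
have mid (z : C) : cnorm z < 1 -> exists r : R, [/\ 0 < r, r < 1 & cnorm z < r].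
  move=> z1; exists ((1 + cnorm z) / 2); have := cnorm_ge0 z.
  by split; lra.
split; first split.
- move=> r /andP[r0 r1]; have [M [b _ _]] := loc _ r0 r1.
  by exists M => j; rewrite (same _ r0 r1).
- move=> z /mid[r [r0 r1 zr]]; have [M [_ s _]] := loc _ r0 r1.
  by rewrite (funext (same _ r0 r1)); exact: s.
- move=> z /mid[r [r0 r1 zr]]; have [M [_ _ s]] := loc _ r0 r1.
  by rewrite (funext (same _ r0 r1)); exact: s.
Qed.

End Taylor.

Section Arithmetic.
Context {R : realFieldType}.
Lemma lt_third (a b c k e : R) :
  a < e / 3 -> b <= k -> c <= k -> k <= e / 3 -> a + (b + c) < e.
Proof. lra. Qed.
Lemma le_half (a b k h e : R) :
  0 <= h -> a <= k * h -> b <= e / 2 -> h * (k + 1) < e / 2 -> a + b <= e.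
Proof. lra. Qed.
End Arithmetic.

(** * Holomorphic functions of two variables *)

Section Bidisk.
Context {R : realType}.
Local Notation C := R[i].
Variable (Q : C -> C -> C).
Hypothesis holQ : holomorphic_bidisk Q.

Lemma derivable_z z w : disk z -> disk w -> derivable (Q^~ w) z 1.
Proof.
move=> zD wD; apply/derivable1_diffP.
have dp : differentiable (fun z : C => (z, w)) z.
  by apply: differentiable_pair; [exact: ex_diff|exact: differentiable_cst].
exact: (differentiable_comp dp (holQ z w zD wD)).
Qed.

Lemma derivable_w z w : disk z -> disk w -> derivable (Q z) w 1.
Proof.
move=> zD wD; apply/derivable1_diffP.
have dp : differentiable (fun w : C => (z, w)) w.
  by apply: differentiable_pair; [exact: differentiable_cst|exact: ex_diff].
exact: (differentiable_comp dp (holQ z w zD wD)).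
Qed.

(** One bound is needed for all [x] and [y] at once, hence the joint continuity contained in
    [holomorphic_bidisk]. The intervals are arbitrary because continuity at a parameter x is later
    studied on [x - 1, x + 1]. *)
Lemma torus_bounded (r a b c d : R) : 0 < r -> r < 1 ->
  exists M, forall x y, a <= x <= b -> c <= y <= d ->
    cnorm (Q (circ r x) (circ r y)) <= M.
Proof.
move=> r0 r1; have cD x : disk (circ r x) by change (cnorm (circ r x) < 1); rewrite cnorm_circ ?ltW.
pose h (p : R * R) : R := cnorm (Q (circ r p.1) (circ r p.2)).
have ch : continuous h.
  move=> p; apply: (@continuous_cnorm _ _ (fun p : R * R => Q (circ r p.1) (circ r p.2))).
  have c1 : {for p, continuous (fun p : R * R => (circ r p.1, circ r p.2) : C * C)}.
    have h1 : {for p, continuous (circ r \o fst)}.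
      by apply: continuous_comp; [exact: cvg_fst|exact: continuous_circ].
    have h2 : {for p, continuous (circ r \o snd)}.
      by apply: continuous_comp; [exact: cvg_snd|exact: continuous_circ].
    exact: (cvg_pair h1 h2).
  have c2 := differentiable_continuous (holQ _ _ (cD p.1) (cD p.2)).
  exact: (@continuous_comp _ _ _ _ (fun p : C * C => Q p.1 p.2) p c1 c2).
have K : compact (`[a, b]%classic `*` `[c, d]%classic).
  by apply: compact_setX; exact: segment_compact.
have := compact_bounded (continuous_compact (continuous_subspaceT ch) K).
move=> [M0 [_ hM]]; exists (M0 + 1) => x y xab ycd.
have := hM (M0 + 1); rewrite ltrDl => /(_ ltr01) /(_ (h (x, y))).
move=> H; apply: le_trans (ler_norm _) _; apply: H.
by exists (x, y) => //=; split; rewrite /= in_itv.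
Qed.

(* By Cauchy's formula in w, d_w Q is a circle mean of Q, whose difference
   quotients in z converge uniformly on the circle. *)
Lemma derivable_mixed z w : disk z -> disk w -> derivable (fun z => d_w Q z w) z 1.
Proof.
move=> zD wD; pose m := Num.max (cnorm z) (cnorm w).
have m1 : m < 1 by rewrite gt_max; apply/andP.
have m0 : 0 <= m by rewrite le_max cnorm_ge0.
have [r [r0 r1 mr]] : exists r : R, [/\ 0 < r, r < 1 & m < r].
  by exists ((1 + m) / 2); split; lra.
have zr : cnorm z < r by apply: le_lt_trans mr; rewrite le_max lexx.
have wr : cnorm w < r by apply: le_lt_trans mr; rewrite le_max lexx orbT.
have cD x : disk (circ r x) by change (cnorm (circ r x) < 1); rewrite cnorm_circ ?ltW.
have dz u : disk u -> forall z, cnorm z < 1 -> derivable (Q^~ u) z 1.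
  by move=> uD v vD; exact: derivable_z.
have dw u : disk u -> forall z, cnorm z < 1 -> derivable (Q u) z 1.
  by move=> uD v vD; exact: derivable_w.
have cw u : disk u -> curve (fun y => Q u (circ r y)).
  by move=> /dw; exact: curve_circ_derivable.
have cz u : disk u -> curve (fun x => Q (circ r x) u).
  by move=> uD; exact: (curve_circ_derivable _ 1 r r0 r1 (dz u uD)).
have pi0 : 0 <= 2 * pi :> R by rewrite mulr_ge0// pi_ge0.
have qw u v : disk u -> cnorm v < r ->
    cauchy0 r (fun y => Q u (circ r y)) v = Q u v.
  by move=> uD vr; exact: (cauchy_formula (Q u) 1 r v vr r1 (dw u uD)).
have dwE u : disk u -> d_w Q u w = cauchy1 r (fun y => Q u (circ r y)) w.
  move=> uD; have [M hM] := curve_bounded _ 0 (2 * pi) (cw u uD).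
  apply: (cderiv_unique (Q u) w); first by apply/derivable_cderiv/dw.
  apply: (cderiv_local (cauchy0 r (fun y => Q u (circ r y))) (Q u) w _ r wr).
    by move=> v vr; exact: qw.
  exact: (cauchy0_deriv r M _ r0 (cw u uD) hM w wr).
pose psi x := d_w Q (circ r x) w.
pose G (h : C) u := (Q u (w + h) - Q u w) / h.
pose d := (r - cnorm w) / 2; have d0 : 0 < d by rewrite /d divr_gt0// subr_gt0.
(* The bound of [cauchy0_quad] is uniform in [x], as its constant involves only the bound of [Q] on
   the torus. *)
have quad a b : exists K, 0 <= K /\ forall h x, h != 0 -> cnorm h < d -> a <= x <= b ->
    cnorm (G h (circ r x) - psi x) <= K * cnorm h.
  have [M hM] := torus_bounded r a b 0 (2 * pi) r0 r1.
  pose M' := Num.max M 0; have M'0 : 0 <= M' by rewrite le_max lexx orbT.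
  exists (M' * (r * (2 / (r - cnorm w) ^+ 3))); split.
    by rewrite !mulr_ge0 ?invr_ge0 ?exprn_ge0 ?subr_ge0 ?(ltW wr) ?(ltW r0).
  move=> h x h0 hd xab.
  have hM' y : 0 <= y <= 2 * pi -> cnorm (Q (circ r x) (circ r y)) <= M'.
    by move=> yI; rewrite le_max hM.
  have := cauchy0_quad r M' _ r0 (cw _ (cD x)) hM' w h wr hd.
  have whr : cnorm (w + h) < r.
    by apply: le_lt_trans (cnormD _ _) _; move: hd; rewrite /d; have := cnorm_ge0 h; lra.
  rewrite !qw// -dwE// -/(psi x) => hle.
  have -> : G h (circ r x) - psi x = (Q (circ r x) (w + h) - Q (circ r x) w - psi x * h) / h.
    by rewrite /G [RHS]mulrBl mulfK.
  rewrite cnormM cnormV ler_pdivrMr ?cnorm_gt0//; apply: le_trans hle _.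
  by rewrite expr2 [leLHS]mulrA.
have cG h : h != 0 -> cnorm h < d -> curve (fun x => G h (circ r x)).
  move=> h0 hd; have whr : disk (w + h).
    apply: lt_trans r1; apply: le_lt_trans (cnormD _ _) _.
    by move: hd; rewrite /d; have := cnorm_ge0 h; lra.
  by apply: curveM; [apply: curveB; exact: cz|exact: curve_cst].
have small e : 0 < e -> exists2 h : C, h != 0 & cnorm h < d /\ cnorm h < e.
  move=> e0; pose t := Num.min d e / 2.
  have t0 : 0 < t by rewrite divr_gt0// lt_min d0.
  have td : t < d /\ t < e.
    have : t < Num.min d e by rewrite /t ltr_pdivrMr// mulr2n mulrDr mulr1 ltrDl lt_min d0.
    by rewrite lt_min => /andP.
  exists t%:C; first by rewrite -cnorm_eq0 cnormR normr_eq0 gt_eqF.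
  by rewrite cnormR gtr0_norm.
(* [psi] is a locally uniform limit of the continuous quotients [G h]; this is the usual argument
   with e / 3. *)
have cpsi : curve psi.
  split=> x; have [K [K0 hK]] := quad (x - 1) (x + 1).
  apply/(@cvg_cnormP _ _ (nbhs x)) => e e0.
  have e30 : 0 < e / 3 by rewrite divr_gt0.
  have [h h0 [hd he]] := small (e / 3 / (K + 1)) (divr_gt0 e30 (ltr_wpDl K0 ltr01)).
  have Kh : K * cnorm h <= e / 3.
    move: he; rewrite ltr_pdivlMr ?ltr_wpDl// => he.
    by have := cnorm_ge0 h; move: he; lra.
  have [cg] := cG h h0 hd; have /(@cvg_cnormP _ _ (nbhs x)) /(_ _ e30) := cg x.
  have nx : \forall y \near x, `|x - y| < 1 by apply: (@cvgr_dist_lt _ _ _ (nbhs x)).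
  apply: filterS2 nx => y xy gy.
  have h1 := hK h y h0 hd; have h2 := hK h x h0 hd.
  have -> : psi x - psi y = (G h (circ r x) - G h (circ r y)) +
     ((G h (circ r y) - psi y) - (G h (circ r x) - psi x)).
    by move: (psi x) (psi y) (G h (circ r x)) (G h (circ r y)) => a1 a2 a3 a4; ring.
  apply: le_lt_trans (cnormD _ _) _.
  apply: le_lt_trans (lerD (lexx _) (cnormB _ _)) _.
  have xI : x - 1 <= x <= x + 1 by clear; lra.
  have yI : x - 1 <= y <= x + 1.
    by move: xy; rewrite ltr_norml => xy; clear -xy; lra.
  exact: (lt_third _ _ _ _ _ gy (h1 yI) (h2 xI) Kh).
(* Cauchy's formula in z holds for each [G h], which is holomorphic in z; it passes to the limit h
   -> 0 by the uniform estimate on the circle. *)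
have psiE u : cnorm u < r -> d_w Q u w = cauchy0 r psi u.
  move=> ur; have uD : disk u by exact: lt_trans r1.
  have [K [K0 hK]] := quad 0 (2 * pi).
  apply/eqP; rewrite -subr_eq0 -cnorm_eq0 eq_le cnorm_ge0 andbT.
  apply/ler_addgt0Pr => e e0; rewrite add0r.
  have e20 : 0 < e / 2 by rewrite divr_gt0.
  have [d' d'0 hd'] := derivable_cderiv _ _ (dw u uD w wD) _ e20.
  pose L := K * (r / (r - cnorm u)).
  have L0 : 0 <= L by rewrite !mulr_ge0 ?invr_ge0 ?subr_ge0 ?(ltW ur) ?(ltW r0).
  have [h h0 [hd he]] := small (Num.min d' (e / 2 / (L + 1)))
    ltac:(by rewrite lt_min d'0 divr_gt0// ltr_wpDl).
  move: he; rewrite lt_min => /andP[he1 he2].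
  have g1 : cnorm (G h u - d_w Q u w) <= e / 2.
    have -> : G h u - d_w Q u w = (Q u (w + h) - Q u w - d_w Q u w * h) / h.
      by rewrite /G [RHS]mulrBl mulfK.
    by rewrite cnormM cnormV ler_pdivrMr ?cnorm_gt0//; exact: hd'.
  have whr : disk (w + h).
    apply: lt_trans r1; apply: le_lt_trans (cnormD _ _) _.
    by move: hd; rewrite /d; have := cnorm_ge0 h; lra.
  have g2 : cauchy0 r (fun x => G h (circ r x)) u = G h u.
    apply: (cauchy_formula (G h) 1 r u ur r1) => v vD.
    apply: derivableM; last exact: derivable_cst.
    by apply: derivableB; exact: derivable_z.
  have cGp : curve (fun x => G h (circ r x) - psi x) by apply: curveB => //; exact: cG.
  have ck : curve (fun x => circ r x / (circ r x - u)).
    apply: curveM; first exact: curve_circ.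
    apply: curveV; first by apply: curveB; [exact: curve_circ|exact: curve_cst].
    move=> x; rewrite subr_eq0; apply/eqP => xu; move: ur.
    by rewrite -xu cnorm_circ ?(ltW r0)// ltxx.
  have g3 : cnorm (G h u - cauchy0 r psi u) <= L * cnorm h.
    rewrite -g2 /cauchy0 -cmeanB; [|apply: curveM => //; exact: cG|exact: curveM].
    have := cauchy0_le r (K * cnorm h) _ r0 cGp (fun x xI => hK h x h0 hd xI) u ur.
    rewrite /L mulrAC; congr (cnorm _ <= _).
    by apply: eq_cmean => x; rewrite mulrBl.
  have -> : d_w Q u w - cauchy0 r psi u = (G h u - cauchy0 r psi u) - (G h u - d_w Q u w).
    by move: (G h u) (d_w Q u w) (cauchy0 r psi u) => a1 a2 a3; ring.
  apply: le_trans (cnormB _ _) _; move: he2; rewrite ltr_pdivlMr ?ltr_wpDl// => he2.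
  exact: (le_half _ _ _ _ _ (cnorm_ge0 h) g3 g1 he2).
have [M hM] := curve_bounded _ 0 (2 * pi) cpsi.
have := cauchy0_deriv r M _ r0 cpsi hM z zr.
move=> /(cderiv_local _ (fun z => d_w Q z w) _ _ r zr) h.
by have /cderivP[] := h (fun u ur => esym (psiE u ur)).
Qed.

End Bidisk.

(** * The damped wave equation *)

Section DerivativeRules.
Context {R : realType}.
Local Notation C := R[i].
Implicit Types (f g : C -> C) (z a b : C).

Lemma cderiv_is_derive f z a : cderiv f z a <-> is_derive z (1 : C) f a.
Proof.
split=> [/cderivP[df e]|[df e]].
  have e' : 'D_1 f z = a by rewrite -derive1E.
  exact: (DeriveDef df e').
have e' : derive1 f z = a by rewrite derive1E.
exact: (proj2 (cderivP f z a) (conj df e')).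
Qed.

Lemma cderivM f g z a b : cderiv f z a -> cderiv g z b ->
  cderiv (fun z => f z * g z) z (f z * b + g z * a).
Proof.
move=> /cderiv_is_derive df /cderiv_is_derive dg.
exact: (proj2 (cderiv_is_derive _ _ _) (is_deriveM df dg)).
Qed.

Lemma cderivB f g z a b : cderiv f z a -> cderiv g z b ->
  cderiv (fun z => f z - g z) z (a - b).
Proof.
move=> /cderiv_is_derive df /cderiv_is_derive dg.
exact: (proj2 (cderiv_is_derive _ _ _) (is_deriveB df dg)).
Qed.

Lemma cderiv_cst (c z : C) : cderiv (fun=> c) z 0.
Proof. exact: (proj2 (cderiv_is_derive _ _ _) (is_derive_cst _ _ _)). Qed.

Lemma cderiv_id z : cderiv (fun z => z) z 1.
Proof. exact: (proj2 (cderiv_is_derive _ _ _) (is_derive_id _ _)). Qed.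

Lemma cderivZ (c : C) f z a : cderiv f z a -> cderiv (fun z => c * f z) z (c * a).
Proof.
move=> df; have := cderivM (fun=> c) f z 0 a (cderiv_cst c z) df.
by rewrite mulr0 addr0.
Qed.

Lemma cderiv_eq f z a b : cderiv f z a -> a = b -> cderiv f z b.
Proof. by move=> ? <-. Qed.
End DerivativeRules.

Section TaylorCalculus.
Context {R : realType}.

Lemma cvg0Z (k : R) (u : nat -> R) : u n @[n --> \oo] --> 0 ->
  k * u n @[n --> \oo] --> 0.
Proof.
move=> u0; rewrite -[X in _ --> X](mulr0 k).
by apply: cvgM => //; exact: cvg_cst.
Qed.

Local Notation C := R[i].
Implicit Types (c d : nat -> C) (f g : C -> C).

Definition geo_bounded c := forall r : R, 0 < r < 1 ->
  exists M, forall j, cnorm (c j) <= M / r ^+ j.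

Lemma sum_ord2 (F : nat -> C) n :
  \sum_(j < n.+2) F j = F 0%N + (F 1%N + \sum_(j < n) F j.+2).
Proof. by rewrite 2!big_ord_recl. Qed.

(** The factor [j] is absorbed by a radius [s] between [r] and 1, since (j + 1) (r / s)^j stays
    bounded. *)
Lemma geo_bounded_natM c : geo_bounded c -> geo_bounded (fun j => j%:R * c j).
Proof.
move=> hc r /andP[r0 r1]; pose s := (1 + r) / 2.
have s0 : 0 < s by rewrite /s; lra.
have s1 : s < 1 by rewrite /s; lra.
have rs : r < s by rewrite /s; lra.
have s01 : 0 < s < 1 by rewrite s0.
have [M hM] := hc s s01.
have q0 : 0 <= r / s by rewrite divr_ge0 ?ltW.
have q1 : r / s < 1 by rewrite ltr_pdivrMr// mul1r.
have [K K0 [p /andP[p0 p1] hK]] := natX_lt _ q0 q1.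
have M0 : 0 <= M by have := le_trans (cnorm_ge0 _) (hM 0%N); rewrite expr0 divr1.
exists (M * K) => j; rewrite ler_pdivlMr ?exprn_gt0// cnormM cnorm_nat.
apply: (@le_trans _ _ (j.+1%:R * (M / s ^+ j) * r ^+ j)).
  rewrite ler_wpM2r ?exprn_ge0 ?(ltW r0)//.
  by apply: ler_pM; rewrite ?ler0n ?cnorm_ge0 ?ler_nat.
have -> : j.+1%:R * (M / s ^+ j) * r ^+ j = M * (j.+1%:R * (r / s) ^+ j).
  by rewrite [(r / s) ^+ j]expr_div_n; move: ((s ^+ j)^-1) => u; ring.
rewrite ler_wpM2l//; apply: le_trans (hK j) _.
by rewrite ler_piMr// exprn_ile1// ltW.
Qed.

Lemma geo_boundedB c d : geo_bounded c -> geo_bounded d ->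
  geo_bounded (fun j => c j - d j).
Proof.
move=> hc hd r r01; have [M hM] := hc r r01; have [N hN] := hd r r01.
by exists (M + N) => j; rewrite mulrDl; apply: le_trans (cnormB _ _) (lerD _ _).
Qed.

Lemma geo_boundedZ (a : C) c : geo_bounded c -> geo_bounded (fun j => a * c j).
Proof.
move=> hc r r01; have [M hM] := hc r r01.
by exists (cnorm a * M) => j; rewrite cnormM -mulrA ler_wpM2l ?cnorm_ge0.
Qed.

Lemma geo_bounded_shift c : geo_bounded c -> geo_bounded (fun j => c j.+1).
Proof.
move=> hc r r01; have [M hM] := hc r r01; have /andP[r0 r1] := r01.
exists (M / r) => j; apply: le_trans (hM _) _.
by rewrite exprS invfM mulrA.
Qed.

Lemma has_taylorB f g c d : has_taylor f c -> has_taylor g d ->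
  has_taylor (fun z => f z - g z) (fun j => c j - d j).
Proof.
move=> [cb cf] [db dg]; split; first exact: geo_boundedB.
move=> z z1; apply: (squeeze0D _ _ _ _ _ (cf z z1) (dg z z1)).
  by move=> n; exact: cnorm_ge0.
move=> n; have -> : \sum_(j < n) (c j - d j) * z ^+ j =
    \sum_(j < n) c j * z ^+ j - \sum_(j < n) d j * z ^+ j.
  by rewrite -sumrB; apply: eq_bigr => i _; rewrite mulrBl.
apply: le_trans (cnormB _ _); rewrite le_eqVlt; apply/orP; left; apply/eqP.
congr cnorm; move: (\sum_(j < n) c j * _) (\sum_(j < n) d j * _) => S T; ring.
Qed.

Lemma has_taylor_zderiv f c : has_taylor f c ->
  (forall z, cnorm z < 1 ->
    cnorm (\sum_(j < n) j.+1%:R * c j.+1 * z ^+ j - derive1 f z)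
      @[n --> \oo] --> (0 : R)) ->
  has_taylor (fun z => z * derive1 f z) (fun j => j%:R * c j).
Proof.
move=> [cb _] df; split; first exact: geo_bounded_natM.
move=> z z1; rewrite -(cvg_shiftS).
apply: (squeeze0 _ _ _ _ (df z z1)); first by move=> n; exact: cnorm_ge0.
move=> n /=; rewrite big_ord_recl mul0r mul0r add0r.
have -> : \sum_(i < n) (lift ord0 i)%:R * c (lift ord0 i) * z ^+ lift ord0 i =
    z * \sum_(j < n) j.+1%:R * c j.+1 * z ^+ j.
  rewrite mulr_sumr; apply: eq_bigr => i _.
  by rewrite /= /bump leq0n add1n exprS mulrCA.
rewrite -mulrBr cnormM ler_piMl ?cnorm_ge0//; exact: ltW.
Qed.

(* Comparing Taylor coefficients in z f' = f, (j - 1) c_j = 0. *)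
Lemma euler_linear f : (forall z, cnorm z < 1 -> derivable f z 1) ->
  (forall z, cnorm z < 1 -> z * derive1 f z = f z) ->
  forall z w, cnorm z < 1 -> cnorm w < 1 -> w * f z = z * f w.
Proof.
move=> df fE; have [c [tc dc]] := taylor_disk f df.
have tz := has_taylor_zderiv f c tc dc.
have tf : has_taylor f (fun j => j%:R * c j).
  by split; [exact: tz.1|move=> z z1; rewrite -fE//; exact: tz.2].
have c0 j : j != 1%N -> c j = 0.
  move=> j1; have /eqP := has_taylor_unique f _ _ tc tf j.
  rewrite -subr_eq0 -{1}[c j]mul1r -mulrBl mulf_eq0 subr_eq0 eq_sym.
  by rewrite -[1]/(1%:R) eqr_nat (negbTE j1) => /eqP.
suff key z : cnorm z < 1 -> f z = c 1%N * z.
  by move=> z w z1 w1; rewrite !key//; ring.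
move=> z1; apply/eqP; rewrite eq_sym -subr_eq0 -cnorm_eq0 eq_le cnorm_ge0 andbT.
have := tc.2 z z1; rewrite -(cvg_shiftn 2) => h.
apply: (cvg0_le0 _ _ h) => n; rewrite addn2 big_ord_recl /= big_ord_recl /=.
rewrite big1 ?addr0 => [|i _]; last by rewrite c0 ?mul0r.
by rewrite (c0 0%N)// mul0r add0r expr1.
Qed.

End TaylorCalculus.

Section WaveEquation.
Context {R : realType}.
Local Notation C := R[i].
Variable (Q : C -> C -> C).
Hypotheses (holQ : holomorphic_bidisk Q)
  (Qz0 : forall z, disk z -> Q z 0 = 0) (Q0w : forall w, disk w -> Q 0 w = 0)
  (waveQ : damped_wave Q).

(** The base point z0 of the overview; any nonzero point of the disk would do. [trace_fun] below is
    B. *)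
Definition half : C := (2^-1 : R)%:C.

Let half_disk : disk half.
Proof.
change (cnorm half < 1); rewrite cnormR gtr0_norm ?invr_gt0//.
by rewrite invf_lt1 ?ltr1n.
Qed.

Let half0 : half != 0.
Proof. by rewrite -cnorm_eq0 cnormR normr_eq0 invr_eq0. Qed.

Definition trace_fun w : C := (half - w) * Q half w.

Let dQw z w : disk z -> disk w -> cderiv (Q z) w (d_w Q z w).
Proof. by move=> zD wD; exact/derivable_cderiv/derivable_w. Qed.

Let dQz z w : disk z -> disk w -> cderiv (Q^~ w) z (d_z Q z w).
Proof. by move=> zD wD; exact/derivable_cderiv/derivable_z. Qed.

Let dQwz z w : disk z -> disk w ->
  cderiv (fun z => d_w Q z w) z (d_z (d_w Q) z w).
Proof. by move=> zD wD; exact/derivable_cderiv/derivable_mixed. Qed.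

(* The wave equation says that z d_z (N w) = N w. *)
Let N w z := (z - w) * (w * d_w Q z w) - z * Q z w.

Let N_linear z w : disk z -> disk w -> half * N w z = z * N w half.
Proof.
move=> zD wD.
have dN u : disk u -> cderiv (N w) u
   ((u - w) * (w * d_z (d_w Q) u w) + w * d_w Q u w - (u * d_z Q u w + Q u w)).
  move=> uD; rewrite /N; apply: cderivB.
    have d1 : cderiv (fun z => z - w) u (1 - 0).
      exact: (cderivB (fun z => z) (fun=> w) u 1 0 (cderiv_id u) (cderiv_cst w u)).
    have d2 : cderiv (fun z => w * d_w Q z w) u (w * d_z (d_w Q) u w).
      exact: (cderivZ w (fun z => d_w Q z w) u _ (dQwz u w uD wD)).
    apply: (cderiv_eq _ _ _ _ (cderivM _ _ _ _ _ d1 d2)).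
    by rewrite subr0 mulr1.
  apply: (cderiv_eq _ _ _ _ (cderivM (fun z => z) (Q^~ w) _ _ _ (cderiv_id u) (dQz u w uD wD))).
  by rewrite mulr1.
apply: euler_linear => // u uD; have /cderivP[] := dN u uD; first by [].
move=> _ ->; rewrite /N; have := waveQ u w uD wD.
move: (d_z (d_w Q) u w) (d_w Q u w) (d_z Q u w) (Q u w) => a b c d wv.
apply/eqP; rewrite -subr_eq0; apply/eqP.
(* Up to the order of factors, u N'(u) - N(u) is the difference of the two sides of the wave
   equation. *)
transitivity (u * w * (u - w) * a - (u ^+ 2 * c - w ^+ 2 * b)); first by ring.
by rewrite wv subrr.
Qed.

Lemma trace_identity z w : disk z -> disk w ->
  half * ((z - w) * Q z w) = z * trace_fun w - w * trace_fun z.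
Proof.
move=> zD wD; have D0 : disk (0 : C) by change (cnorm (0 : C) < 1); rewrite cnorm0.
(* A factor [z] is cancelled at the end, so z = 0 is settled first by the boundary conditions. *)
have [->|z0] := eqVneq z 0.
  by rewrite Q0w// /trace_fun Qz0//; ring.
pose V u := half * ((z - u) * Q z u) - z * ((half - u) * Q half u).
have dlin (a u : C) : cderiv (fun u => a - u) u (0 - 1).
  exact: (cderivB (fun=> a) (fun u => u) u 0 1 (cderiv_cst a u) (cderiv_id u)).
have dV u : disk u -> cderiv V u (half * ((z - u) * d_w Q z u - Q z u) -
    z * ((half - u) * d_w Q half u - Q half u)).
  move=> uD; apply: cderivB; apply: cderivZ.
    apply: (cderiv_eq _ _ _ _ (cderivM _ (Q z) _ _ _ (dlin z u) (dQw z u zD uD))).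
    by rewrite sub0r mulrN1.
  apply: (cderiv_eq _ _ _ _ (cderivM _ (Q half) _ _ _ (dlin half u) (dQw half u half_disk uD))).
  by rewrite sub0r mulrN1.
(* In the variable u, u V'(u) - V(u) is half N(u, z) - z N(u, half), which [N_linear] makes 0. *)
have : z * V w = w * V z.
  apply: euler_linear => // u uD; have /cderivP[] := dV u uD; first by [].
  move=> _ ->; rewrite /V; have := N_linear z u zD uD; rewrite /N.
  move: (d_w Q z u) (d_w Q half u) (Q z u) (Q half u) => a b c d.
  move: half => h e; apply/eqP; rewrite -subr_eq0; apply/eqP.
  transitivity (h * ((z - u) * (u * a) - z * c) - z * ((h - u) * (u * b) - h * d)).
    by ring.
  by rewrite e subrr.
(* At u = z the first term of [V] vanishes, leaving -z B(z). *)
have -> : w * V z = z * (- (w * trace_fun z)).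
  rewrite /V /trace_fun subrr mul0r mulr0 sub0r.
  by move: ((half - z) * Q half z) => T; ring.
move=> /(mulfI z0); rewrite /V -/(trace_fun w) -/(trace_fun z) => /eqP; rewrite subr_eq => /eqP ->.
by rewrite addrC.
Qed.

Lemma trace_derivable z : disk z -> cderiv trace_fun z (derive1 trace_fun z).
Proof.
move=> zD; apply: derivable_cderiv.
have dlin : cderiv (fun u => half - u) z (0 - 1).
  exact: (cderivB (fun=> half) (fun u => u) z 0 1 (cderiv_cst half z) (cderiv_id z)).
by have /cderivP[] := cderivM _ (Q half) _ _ _ dlin (dQw half z half_disk zD).
Qed.

(** Differentiate [trace_identity] in w at w = z, where the factor z - w kills the term with d_w
    Q. *)
Lemma diag_trace z : disk z ->
  half * Q z z = trace_fun z - z * derive1 trace_fun z.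
Proof.
move=> zD; have dlin : cderiv (fun u => z - u) z (0 - 1).
  exact: (cderivB (fun=> z) (fun u => u) z 0 1 (cderiv_cst z z) (cderiv_id z)).
have d1 := cderivZ half _ _ _ (cderivM _ (Q z) _ _ _ dlin (dQw z z zD zD)).
have d2 : cderiv (fun w => z * trace_fun w - w * trace_fun z) z
    (z * derive1 trace_fun z - trace_fun z).
  apply: cderivB; first by apply: cderivZ; exact: trace_derivable.
  apply: (cderiv_eq _ _ _ _ (cderivM (fun w => w) (fun=> trace_fun z) _ _ _
    (cderiv_id z) (cderiv_cst (trace_fun z) z))).
  by rewrite mulr0 mulr1 add0r.
have d3 := cderiv_local _ _ _ _ 1 zD (fun w wD => trace_identity z w zD wD) d1.
have := cderiv_unique _ _ _ _ d3 d2.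
rewrite subrr mul0r add0r sub0r mulrN1 mulrN => e.
by rewrite -[LHS]opprK e opprB.
Qed.

(** b_0 = 0 since Q(half, 0) = 0, and b_1 drops out of z B(w) - w B(z). The term b w^(n+2)
    contributes b z w (w^(n+1) - z^(n+1)), which explains both the shift by 2 and the sign in
    b_(n+2) = - half m_n. The diagonal series leaves out z = 0, where [diag Q] is 0 but the sum is
    m_0. *)
Lemma wave_series : exists b : nat -> C, exists m : nat -> C,
  [/\ has_taylor trace_fun b, forall n, b n.+2 = - half * m n, geo_bounded m,
   forall z w, disk z -> disk w ->
     cnorm (\sum_(n < N) z * w * m n * (z ^+ n.+1 - w ^+ n.+1) - (z - w) * Q z w)
       @[N --> \oo] --> (0 : R) &
   forall z, disk z -> z != 0 ->
     cnorm (\sum_(n < N) n.+1%:R * m n * z ^+ n - diag Q z) @[N --> \oo] --> (0 : R)].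
Proof.
have D0 : disk (0 : C) by change (cnorm (0 : C) < 1); rewrite cnorm0.
have df z : cnorm z < 1 -> derivable trace_fun z 1.
  by move=> zD; have /cderivP[] := trace_derivable z zD.
have [b [tb db]] := taylor_disk trace_fun df.
have b0 : b 0%N = 0.
  have := tb.2 0 D0; rewrite -(cvg_shiftS) => h.
  apply/eqP; rewrite -cnorm_eq0 eq_le cnorm_ge0 andbT; apply: (cvg0_le0 _ _ h) => n.
  rewrite /trace_fun Qz0// mulr0 subr0 big_ord_recl /= expr0 mulr1.
  by rewrite big1 ?addr0// => i _; rewrite /= expr0n mulr0.
pose m n := - half^-1 * b n.+2.
have bm n : b n.+2 = - half * m n.
  by rewrite /m mulrA mulrNN divff ?mul1r.
have h0 : cnorm half != 0 by rewrite cnorm_eq0.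
exists b, m; split => //.
- exact: (geo_boundedZ _ _ (geo_bounded_shift _ (geo_bounded_shift _ tb.1))).
- move=> z w zD wD; have sz := tb.2 z zD; have sw := tb.2 w wD.
  rewrite -(cvg_shiftn 2) in sz; rewrite -(cvg_shiftn 2) in sw.
  have h : cnorm half^-1 * cnorm z * cnorm (\sum_(j < n + 2) b j * w ^+ j - trace_fun w)
     @[n --> \oo] --> (0 : R).
    exact: (cvg0Z _ _ sw).
  have h' : cnorm half^-1 * cnorm w * cnorm (\sum_(j < n + 2) b j * z ^+ j - trace_fun z)
     @[n --> \oo] --> (0 : R).
    exact: (cvg0Z _ _ sz).
  apply: (squeeze0D _ _ _ _ _ h h'); first by move=> n; exact: cnorm_ge0.
  move=> n; rewrite -!cnormM; apply: le_trans (cnormB _ _).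
  rewrite le_eqVlt; apply/orP; left; apply/eqP; congr cnorm.
  have sE u : \sum_(j < n + 2) b j * u ^+ j =
      b 1%N * u - half * \sum_(j < n) m j * u ^+ j.+2.
    rewrite addn2 (sum_ord2 (fun j => b j * u ^+ j)) b0 mul0r add0r expr1 mulr_sumr -sumrN; congr (_ + _).
    by apply: eq_bigr => i _; rewrite bm; move: (u ^+ i.+2) half (m i) => *; ring.
  have -> : (z - w) * Q z w = half^-1 * (z * trace_fun w - w * trace_fun z).
    by rewrite -trace_identity// mulKf.
  have -> : \sum_(n0 < n) z * w * m n0 * (z ^+ n0.+1 - w ^+ n0.+1) =
      w * (\sum_(j < n) m j * z ^+ j.+2) - z * (\sum_(j < n) m j * w ^+ j.+2).
    rewrite !mulr_sumr -sumrB; apply: eq_bigr => i _.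
    by rewrite [z ^+ i.+2]exprS [w ^+ i.+2]exprS; ring.
  rewrite !sE; move: (\sum_(j < n) _) (\sum_(j < n) _) => S1 S2.
  move: (trace_fun z) (trace_fun w) (b 1%N) half half0 => t1 t2 b1 h2 h2n.
  by field.
- move=> z zD z0.
  have := (has_taylorB _ _ _ _ tb (has_taylor_zderiv _ _ tb db)).2 z zD.
  rewrite -(cvg_shiftn 2) => h.
  pose k := cnorm (half^-1 * z ^- 2).
  have hk : k * cnorm (\sum_(j < n + 2) (b j - j%:R * b j) * z ^+ j -
     (trace_fun z - z * derive1 trace_fun z)) @[n --> \oo] --> (0 : R).
    exact: (cvg0Z _ _ h).
  apply: (squeeze0 _ _ _ _ hk); first by move=> n; exact: cnorm_ge0.
  move=> n; rewrite /k -cnormM -diag_trace//.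
  rewrite le_eqVlt; apply/orP; left; apply/eqP; congr cnorm.
  (* The coefficients of B - z B' are (1 - j) b_j; at j = n + 2 this is half (n + 1) m_n, while j =
     0 and j = 1 contribute nothing. *)
  have -> : \sum_(j < n + 2) (b j - j%:R * b j) * z ^+ j =
      half * z ^+ 2 * \sum_(j < n) j.+1%:R * m j * z ^+ j.
    rewrite addn2 (sum_ord2 (fun j => (b j - j%:R * b j) * z ^+ j)) b0 mulr0 subrr mul0r add0r mul1r subrr mul0r add0r.
    rewrite mulr_sumr; apply: eq_bigr => i _.
    rewrite bm -!natr1 [z ^+ i.+2]exprS [z ^+ i.+1]exprS.
    by move: half => hh; ring.
  rewrite /diag; move: (\sum_(j < n) _) (Q z z) half half0 => S q hh hh0.
  by field; rewrite z0 hh0.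
Qed.

End WaveEquation.

(** * Area measure on the disk *)

Section Transport.
Context {R : realType} {d : measure_display} {X : measurableType d}.
Variable mu : {measure set X -> \bar R}.
Implicit Types (T : X -> X) (c : R).

Lemma pushforward_measureP d1 d2 (U : measurableType d1) (V : measurableType d2)
    (m : {measure set U -> \bar R}) (phi : U -> V) :
  measurable_fun [set: U] phi ->
  exists m' : {measure set V -> \bar R}, forall A, m' A = m (phi @^-1` A).
Proof.
by move=> mphi; unshelve eexists (pushforward m phi : {measure set V -> \bar R}).
Qed.

(** As preimages are measured, [c] is the inverse of the Jacobian of [T]. *)
Definition transports T c := measurable_fun setT T /\
  forall A, measurable A -> mu (T @^-1` A) = (c%:E * mu A)%E.

Lemma transports_comp T T' c c' : transports T c -> transports T' c' ->
  transports (T' \o T) (c * c').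
Proof.
move=> [mT hT] [mT' hT']; split; first exact: measurableT_comp.
move=> A mA; rewrite comp_preimage hT ?hT' ?EFinM ?muleA//.
by rewrite -[X in measurable X]setTI; exact: mT'.
Qed.

Lemma transports_ge0_integral T c D (g : X -> \bar R) : 0 <= c -> transports T c ->
  measurable D -> measurable_fun D g -> (forall x, D x -> (0 <= g x)%E) ->
  (\int[mu]_(x in T @^-1` D) g (T x) = c%:E * \int[mu]_(x in D) g x)%E.
Proof.
move=> c0 [mT hT] mD mg g0.
have := @ge0_integral_pushforward _ _ _ _ R T mT mu D g mD mg.
move=> <-; last by move=> y; rewrite inE; exact: g0.
transitivity (\int[mscale (NngNum c0) mu]_(x in D) g x)%E.
  by apply: eq_measure_integral => A mA _; exact: hT.
by rewrite ge0_integral_mscale.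
Qed.

End Transport.

(** * Shears, scalings and rotations of the plane *)

Section Plane.
Context {R : realType}.
Local Notation leb := (@lebesgue_measure R).
Local Notation P := (measurableTypeR R * measurableTypeR R)%type.
Local Notation leb2 := (leb \x leb)%E.

Lemma lebesgue_shift (s : R) (A : set (measurableTypeR R)) : measurable A ->
  leb ((fun y => y + s) @^-1` A) = leb A.
Proof.
move=> mA.
have ms : measurable_fun setT (fun y : measurableTypeR R => y + s : measurableTypeR R).
  by apply: measurable_funD => //; exact: measurable_cst.
have [m' mE] := pushforward_measureP _ _ _ _ leb _ ms.
rewrite -(mE A); apply/esym/(@lebesgue_measure_unique _ m') => //= _ [[a b] _ <-].
rewrite mE.
have -> : (fun y => y + s) @^-1` `]a, b]%classic = `]a - s, b - s]%classic.
  by apply/seteqP; split=> y /=; rewrite !in_itv /= ltrBlDr lerBrDr.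
rewrite !lebesgue_measure_itv /= !lte_fin [RHS]lebesgue_measure_itv /= !lte_fin ltrD2r; case: ifP => // _.
by rewrite -!EFinD; congr EFin; ring.
Qed.

Lemma lebesgue_scale (c : R) (A : set (measurableTypeR R)) : 0 < c -> measurable A ->
  leb ((fun y => c * y) @^-1` A) = (c^-1%:E * leb A)%E.
Proof.
move=> c0 mA.
have ms : measurable_fun setT (fun y : measurableTypeR R => c * y : measurableTypeR R).
  exact: mulrl_measurable.
have c0' : 0 <= c by exact: ltW.
have -> : leb A = (c%:E * leb ((fun y => (c * y)%R) @^-1` A))%E.
  have [m' mE] := pushforward_measureP _ _ _ _ leb _ ms; rewrite -(mE A).
  apply: (@lebesgue_measure_unique _ (mscale (NngNum c0') m')) => //= _ [[a b] _ <-].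
  rewrite /mscale /= mE.
  have -> : (fun y => c * y) @^-1` `]a, b]%classic = `]a / c, b / c]%classic.
    apply/seteqP; split=> y /=; rewrite !in_itv /= ltr_pdivrMr// ler_pdivlMr// ![y * c]mulrC//.
  rewrite lebesgue_measure_itv /= !lte_fin lebesgue_measure_itv /= !lte_fin ltr_pM2r ?invr_gt0//; case: ifP => // _.
    rewrite -!EFinD -EFinM; congr EFin; rewrite -mulrBl mulrC divfK//.
    by rewrite gt_eqF.
  by rewrite mule0.
by rewrite muleA -EFinM mulVf ?mul1e// gt_eqF.
Qed.

Lemma transports_yshear (s : R) : transports leb2 (fun p : P => (p.1, p.2 + s * p.1) : P) 1.
Proof.
split.
  apply/measurable_fun_pairP; split => //=.
    exact: measurable_fst.
  apply: measurable_funD; first exact: measurable_snd.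
  by apply: measurable_funM; [exact: measurable_cst|exact: measurable_fst].
move=> A mA; rewrite mul1e /product_measure1; apply: eq_integral => x _ /=.
rewrite -(lebesgue_shift (s * x) (xsection A x)); last exact: measurable_xsection.
by congr (leb _); apply/seteqP; split => y; rewrite /xsection /= !inE.
Qed.

Lemma transports_yscale (c : R) : 0 < c ->
  transports leb2 (fun p : P => (p.1, c * p.2) : P) c^-1.
Proof.
move=> c0; split.
  apply/measurable_fun_pairP; split => //=.
    exact: measurable_fst.
  by apply: measurable_funM; [exact: measurable_cst|exact: measurable_snd].
move=> A mA; rewrite /product_measure1 -ge0_integralZl//=; last 2 first.
- exact: measurable_fun_xsection.
- by rewrite lee_fin invr_ge0 ltW.
apply: eq_integral => x _ /=.
by rewrite -(lebesgue_scale c (xsection A x))//; exact: measurable_xsection.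
Qed.

Lemma transports_swap : transports leb2 (fun p : P => (p.2, p.1) : P) 1.
Proof.
have ms : measurable_fun setT (fun p : P => (p.2, p.1) : P).
  by apply/measurable_fun_pairP; split; [exact: measurable_snd|exact: measurable_fst].
split => // A mA; rewrite mul1e.
have [m' mE] := pushforward_measureP _ _ _ _ leb2 _ ms; rewrite -(mE A); apply/esym.
apply: (@product_measure_unique _ _ _ _ R leb leb m') => //= B C mB mC.
have -> : m' (B `*` C) = leb2 (C `*` B).
  by rewrite mE; congr (leb2 _); apply/seteqP; split => -[x y] /=; case.
by rewrite product_measure1E// muleC.
Qed.

Lemma transports_ext (T T' : P -> P) (c c' : R) : T =1 T' -> c = c' ->
  transports leb2 T c -> transports leb2 T' c'.
Proof. by move=> /funext <- <-. Qed.

(* A rotation is a product of three shears. *)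
Lemma transports_rot (c s : R) : s != 0 -> c ^+ 2 + s ^+ 2 = 1 ->
  transports leb2 (fun p : P => (c * p.1 - s * p.2, s * p.1 + c * p.2) : P) 1.
Proof.
(* For c = cos t and s = sin t this is a = - tan (t / 2), the slope of the x-shears on either side
   of the y-shear by s. *)
move=> s0 cs; pose a := (c - 1) / s.
(* Conjugation by the swap turns a y-shear into an x-shear. *)
have xs t := transports_comp _ _ _ _ _ transports_swap
  (transports_comp _ _ _ _ _ (transports_yshear t) transports_swap).
have := transports_comp _ _ _ _ _ (xs a)
  (transports_comp _ _ _ _ _ (transports_yshear s) (xs a)).
apply: transports_ext; last by rewrite !mulr1.
move=> [x y] /=; have ab : a * s = c - 1 by rewrite /a divfK.
have e2 : a * (c + 1) = - s.
  apply: (mulIf s0); rewrite mulrAC ab; transitivity (c ^+ 2 - 1); first by ring.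
  by rewrite -[1]cs; ring.
have E2 : y + s * (x + a * y) = s * x + c * y.
  transitivity (s * x + (a * s + 1) * y); first by ring.
  by rewrite ab subrK.
congr pair; rewrite E2//.
transitivity ((a * s + 1) * x + a * (c + 1) * y); first by ring.
by rewrite ab subrK e2 mulNr.
Qed.

Lemma transports_dilation (r : R) : 0 < r ->
  transports leb2 (fun p : P => (r * p.1, r * p.2) : P) (r ^- 2).
Proof.
move=> r0; have := transports_comp _ _ _ _ _ (transports_yscale r r0)
  (transports_comp _ _ _ _ _ transports_swap
    (transports_comp _ _ _ _ _ (transports_yscale r r0) transports_swap)).
by apply: transports_ext; [case|rewrite mul1r mulr1 expr2 invfM].
Qed.

Lemma transports_dA (T : P -> P) (c : R) : transports leb2 T c -> transports (@dA R) T c.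
Proof.
move=> [mT hT]; split => // A mA.
by rewrite /= /mscale/= hT// muleCA.
Qed.

End Plane.

Section CTransport.
Context {R : realType} {d : measure_display} {X : measurableType d}.
Variable mu : {measure set X -> \bar R}.
Local Notation C := R[i].

Lemma transports_preimage (T : X -> X) (c : R) (D : set X) : transports mu T c ->
  measurable D -> measurable (T @^-1` D).
Proof. by move=> [mT _] mD; rewrite -[X in measurable X]setTI; exact: mT. Qed.

Lemma transports_Rintegral (T : X -> X) (c : R) (D : set X) (g : X -> R) : 0 <= c ->
  transports mu T c -> measurable D -> mu.-integrable D (EFin \o g) ->
  mu.-integrable (T @^-1` D) (EFin \o (g \o T)) /\
  \int[mu]_(x in T @^-1` D) g (T x) = c * \int[mu]_(x in D) g x.
Proof.
move=> c0 hT mD ig; have mTD := transports_preimage _ _ _ hT mD.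
have mg := measurable_int _ ig.
have mgT : measurable_fun (T @^-1` D) (EFin \o (g \o T)).
  have -> : EFin \o (g \o T) = (EFin \o g) \o T by [].
  apply: (@measurable_comp _ _ _ _ _ _ D) => //.
    by move=> _ [x Dx <-].
  by apply: measurable_funTS; exact: hT.1.
split.
  apply/integrableP; split => //.
  have [_ ] := integrableP _ _ _ ig.
  have -> : (\int[mu]_(x in T @^-1` D) `|(EFin \o (g \o T)) x| =
      c%:E * \int[mu]_(x in D) `|(EFin \o g) x|)%E.
    rewrite -(transports_ge0_integral mu T c D)//.
    exact: measurableT_comp.
  by move=> h; rewrite lte_mul_pinfty// ?integral_ge0// ge0_fin_numE ?integral_ge0//.
have hp : (EFin \o (g \o T))^\+%E = (fun x => (EFin \o g)^\+%E (T x)).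
  exact: (funepos_comp (EFin \o g) T).
have hn : (EFin \o (g \o T))^\-%E = (fun x => (EFin \o g)^\-%E (T x)).
  exact: (funeneg_comp (EFin \o g) T).
have pos : (\int[mu]_(x in T @^-1` D) (EFin \o (g \o T))^\+ x =
    c%:E * \int[mu]_(x in D) (EFin \o g)^\+ x)%E.
  rewrite hp -(transports_ge0_integral mu T c D _ c0 hT mD (measurable_funepos mg) (fun x _ => funepos_ge0 _ x)).
  by [].
have neg : (\int[mu]_(x in T @^-1` D) (EFin \o (g \o T))^\- x =
    c%:E * \int[mu]_(x in D) (EFin \o g)^\- x)%E.
  rewrite hn -(transports_ge0_integral mu T c D _ c0 hT mD (measurable_funeneg mg) (fun x _ => funeneg_ge0 _ x)).
  by [].
rewrite /Rintegral.
have -> : (\int[mu]_(x in T @^-1` D) (g (T x))%:E)%E = (c%:E * \int[mu]_(x in D) (g x)%:E)%E.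
  rewrite [LHS]integralE pos neg [in RHS]integralE.
  have fB := integrable_neg_fin_num mD ig.
  move: fB; set B := (\int[mu]_(x in D) (EFin \o g)^\- x)%E => fB.
  set A := (\int[mu]_(x in D) (EFin \o g)^\+ x)%E.
  move: A B fB => A B fB; apply/esym/muleBr => //.
  by rewrite fin_num_adde_defl// fin_numN.
by rewrite fineM//; exact: integrable_fin_num.
Qed.

Lemma transports_cint (T : X -> X) (c : R) (D : set X) (f : X -> C) : 0 <= c ->
  transports mu T c -> measurable D -> cintegrable mu D f ->
  cintegrable mu (T @^-1` D) (fun x => f (T x)) /\
  cint mu (T @^-1` D) (fun x => f (T x)) = c%:C * cint mu D f.
Proof.
move=> c0 hT mD [f1 f2].
have [i1 e1] := transports_Rintegral _ _ _ _ c0 hT mD f1.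
have [i2 e2] := transports_Rintegral _ _ _ _ c0 hT mD f2.
split; first by split.
by apply: complex_ext; rewrite ?ReM ?ImM /= ?mul0r ?subr0 ?addr0.
Qed.

End CTransport.

(** * The normalized area of the disk *)

Section DiskMeasure.
Context {R : realType}.
Local Notation C := R[i].
Local Notation leb := (@lebesgue_measure R).
Local Notation P := (measurableTypeR R * measurableTypeR R)%type.
Local Notation dA := (@dA R).
Local Notation plane_disk := (@plane_disk R).

Definition subdisk (q : R) : set P := [set p | cnorm (of_plane p) < q].

Lemma cmeasurable_of_plane (D : set P) : cmeasurable D (@of_plane R).
Proof.
split; apply: measurable_funTS; [exact: measurable_fst|exact: measurable_snd].
Qed.

Lemma measurable_subdisk q : measurable (subdisk q).
Proof.
have -> : subdisk q = (fun p : P => cnorm (of_plane p)) @^-1` `]-oo, q[%classic.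
  by apply/seteqP; split => p; rewrite /subdisk /= in_itv.
rewrite -[X in measurable X]setTI; apply: measurable_cnorm => //.
exact: cmeasurable_of_plane.
Qed.

Lemma measurable_plane_disk : measurable plane_disk.
Proof. exact: (measurable_subdisk 1). Qed.

(** The substitution x = sin t turns the integrand into 2 cos^2 t = 1 + (cos^2 t - sin^2 t), with
    primitive t + sin t cos t. *)
Lemma integral_semicircle :
  (\int[leb]_(x in `[(-1)%R, 1%R]) (2 * Num.sqrt (1 - x ^+ 2))%R%:E = (pi : R)%:E)%E.
Proof.
have pi0 : 0 < pi :> R by exact: pi_gt0.
have pi2 : - (pi / 2) <= pi / 2 :> R by lra.
have dsin : (derive1 (@sin R)) = @cos R.
  by apply/funext => x; rewrite derive1E; apply: derive_val.
have cG : {within `[-1, 1], continuous (fun x : R => 2 * Num.sqrt (1 - x ^+ 2))}.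
  apply: continuous_subspaceT => x.
  have c1 : {for x, continuous (fun x : R => 1 - x ^+ 2)}.
    by apply: cvgB; [exact: cvg_cst|exact: exprn_continuous].
  have c2 := continuous_comp c1 (@sqrt_continuous R (1 - x ^+ 2)).
  by apply: cvgM; [exact: cvg_cst|exact: c2].
have := @integration_by_substitution_increasing R sin (fun x => 2 * Num.sqrt (1 - x ^+ 2)) (- (pi / 2)) (pi / 2) pi2.
rewrite sinN sin_pihalf dsin => ->//; last 5 first.
- by move=> x y xI yI xy; rewrite ltr_sin.
- by move=> x _; exact: continuous_cos.
- by apply/cvg_ex; exists (cos (- (pi / 2))); apply: cvg_at_right_filter; exact: continuous_cos.
- by apply/cvg_ex; exists (cos (pi / 2)); apply: cvg_at_left_filter; exact: continuous_cos.
- split.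
  + by move=> x _; exact: derivable_sin.
  + by apply: cvg_at_right_filter; exact: continuous_sin.
  + by apply: cvg_at_left_filter; exact: continuous_sin.
have e (x : R) : x \in `[- (pi / 2), pi / 2] ->
    2 * Num.sqrt (1 - sin x ^+ 2) * cos x = 1 + (cos x ^+ 2 - sin x ^+ 2).
  rewrite in_itv /= => xI.
  have c0 : 0 <= cos x by apply: cos_ge0_pihalf.
  have s2 : 1 - sin x ^+ 2 = cos x ^+ 2 by rewrite -[1](cos2Dsin2 x) addrK.
  rewrite s2 sqrtr_sqr ger0_norm//; have := cos2Dsin2 x.
  by move: (cos x) (sin x) => u v; lra.
transitivity (\int[leb]_(x in `[(- (pi / 2))%R, (pi / 2)%R])
    (1 + (cos x ^+ 2 - sin x ^+ 2))%R%:E)%E.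
  by apply: eq_integral => x; rewrite inE /= => xI; congr EFin; exact: e.
have dF (x : R) : is_derive x (1 : R) (fun x => x + sin x * cos x)
    (1 + (sin x *: - sin x + cos x *: cos x)).
  exact: is_deriveD.
rewrite (@continuous_FTC2 R _ (fun x => x + sin x * cos x))//.
- rewrite sinN cosN cos_pihalf !mulr0 !addr0 -EFinB; congr EFin; lra.
- lra.
- apply: continuous_subspaceT => x.
  have c1 := continuous_comp (@continuous_cos R x) (@exprn_continuous R 2 (cos x)).
  have c2 := continuous_comp (@continuous_sin R x) (@exprn_continuous R 2 (sin x)).
  by apply: cvgD; [exact: cvg_cst|apply: cvgB; [exact: c1|exact: c2]].
- have cF x : {for x, continuous (fun x => x + sin x * cos x : R)}.
    by apply: cvgD; [exact: cvg_id|apply: cvgM; [exact: continuous_sin|exact: continuous_cos]].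
  split.
  + by move=> x _; case: (dF x).
  + by apply: cvg_at_right_filter; exact: cF.
  + by apply: cvg_at_left_filter; exact: cF.
- move=> x _; rewrite derive1E; have [_ ->] := dF x.
  by rewrite /GRing.scale /=; ring.
Qed.

Lemma dA_disk : dA plane_disk = 1%E.
Proof.
suff E : (leb \x leb)%E plane_disk = (pi : R)%:E.
  rewrite /= /mscale /= E -EFinM mulVf// gt_eqF//; exact: pi_gt0.
have inE1 (x y : R) : xsection plane_disk x y <-> x ^+ 2 + y ^+ 2 < 1.
  rewrite /xsection /= inE /Defs.plane_disk /= /disk /=.
  by rewrite -{1}sqrtr1 ltr_sqrt.
rewrite /product_measure1 -integral_semicircle [RHS]integral_mkcond.
apply: eq_integral => x _; rewrite /patch /=.
have [xI|xI] := boolP (x \in `[(-1)%R, 1%R]%classic).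
  have x2 : 0 <= 1 - x ^+ 2.
    move: xI; rewrite inE /= in_itv /= -ler_norml => xI.
    by rewrite subr_ge0 -real_normK ?num_real// exprn_ile1.
  have -> : xsection plane_disk x =
      `](- Num.sqrt (1 - x ^+ 2)), Num.sqrt (1 - x ^+ 2)[%classic.
    have key y : (x ^+ 2 + y ^+ 2 < 1) = (`|y| < Num.sqrt (1 - x ^+ 2)).
      rewrite -[RHS](ltr_pXn2r (n := 2)) ?nnegrE ?sqrtr_ge0//.
      by rewrite sqr_sqrtr// real_normK ?num_real// ltrBrDl.
    apply/seteqP; split => y.
      by move=> /inE1; rewrite key /= in_itv /= ltr_norml.
    by rewrite /= in_itv /= -ltr_norml -key => h; apply/inE1.
  rewrite lebesgue_measure_itv /= lte_fin.
  have s0 := sqrtr_ge0 (1 - x ^+ 2); case: ifP => h.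
    by rewrite -EFinD; congr EFin; lra.
  by congr EFin; move: h => /negbT; rewrite -leNgt; lra.
have -> : xsection plane_disk x = set0; last by rewrite measure0.
apply/seteqP; split => // y /inE1 h; move: xI; rewrite notin_setE; apply.
rewrite /= in_itv /= -ler_norml -(ler_pXn2r (n := 2)) ?nnegrE// expr1n.
by rewrite real_normK ?num_real//; have := sqr_ge0 y; lra.
Qed.

End DiskMeasure.

Section DiskIntegrals.
Context {R : realType}.
Local Notation C := R[i].
Local Notation P := (measurableTypeR R * measurableTypeR R)%type.
Local Notation dA := (@dA R).
Local Notation D := (@plane_disk R).
Implicit Types (f g : C -> C).

Definition dint f : C := cint dA D (f \o of_plane).
Definition dintegrable f := cintegrable dA D (f \o of_plane).
Definition dmeasurable f := cmeasurable D (f \o @of_plane R).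

Let mD : measurable D. Proof. exact: measurable_plane_disk. Qed.

Lemma integrable_cst_disk (k : R) : dA.-integrable D (EFin \o cst k).
Proof.
apply/integrableP; split; first exact/measurable_EFinP/measurable_cst.
rewrite (_ : (fun x => _) = cst `|k|%:E); last by apply/funext.
by rewrite integral_cst// dA_disk mule1 ltry.
Qed.

Lemma Rintegral_cst_disk (k : R) : \int[dA]_(p in D) k = k.
Proof. by rewrite Rintegral_cst// dA_disk mulr1. Qed.

Lemma bounded_dintegrable f (M : R) : dmeasurable f ->
  (forall z, cnorm z < 1 -> cnorm (f z) <= M) -> dintegrable f.
Proof.
move=> mf fM; apply: (cintegrable_le _ _ mD _ (cst M)) => //.
  exact: integrable_cst_disk.
by move=> p pD; exact: fM.
Qed.

(** The condition on [Im a] comes from the factorization of a rotation into shears, which divides by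
    the sine. *)
Lemma rotation_dint f (a : C) : cnorm a = 1 -> complex.Im a != 0 -> dintegrable f ->
  dint (fun z => f (a * z)) = dint f.
Proof.
move=> a1 Ia If.
pose T (p : P) : P := (complex.Re a * p.1 - complex.Im a * p.2,
                       complex.Im a * p.1 + complex.Re a * p.2).
have hT : transports dA T 1.
  by apply/transports_dA/transports_rot => //; rewrite -cnorm_sqr a1 expr1n.
have TE p : of_plane (T p) = a * of_plane p.
  by apply: complex_ext; rewrite ?ReM ?ImM /=; ring.
have TD : T @^-1` D = D.
  apply/seteqP; split => p; change (cnorm (of_plane (T p)) < 1 -> cnorm (of_plane p) < 1) ||
    change (cnorm (of_plane p) < 1 -> cnorm (of_plane (T p)) < 1);
  by rewrite TE cnormM a1 mul1r.
have [_] := transports_cint _ T 1 D _ ler01 hT mD If.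
rewrite mul1r TD => e; rewrite /dint -e; apply: eq_cint => p _.
by rewrite /= TE.
Qed.

(** An m-th root b of -1 serves unless it is real. In that case b^2 = 1, so b^m = -1 forces m to be
    odd, and then 'i^m is not 1. *)
Lemma unit_nonroot (m : nat) : (0 < m)%N ->
  exists a : C, [/\ cnorm a = 1, complex.Im a != 0 & a ^+ m != 1].
Proof.
move=> m0; pose b : C := m.-root (-1).
have bm : b ^+ m = -1 by exact: rootCK.
have b1 : cnorm b = 1.
  have /eqP := congr1 (@cnorm R) bm; rewrite cnormX cnormN cnorm1.
  by rewrite pexpr_eq1// ?cnorm_ge0// => /eqP.
have N1 : (-1 : C) != 1.
  by rewrite -subr_eq0 -opprD oppr_eq0 -[1 + 1]/(2%:R) pnatr_eq0.
have [Ib|Ib] := eqVneq (complex.Im b) 0; last by exists b; rewrite bm.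
exists 'i; split; [exact: cnormi|by rewrite /= oner_neq0|].
apply/eqP => im1.
have b2 : b ^+ 2 = 1.
  have : cnorm b ^+ 2 = 1 by rewrite b1 expr1n.
  rewrite cnorm_sqr Ib expr0n addr0 => h.
  by apply: complex_ext; rewrite expr2 ?ReM ?ImM Ib ?mulr0 ?mul0r ?subr0 ?addr0//= -expr2.
have : (b ^+ m) ^+ 2 = 1 by rewrite bm sqrrN expr1n.
have im2 : ('i : C) ^+ 2 = -1 by exact: sqr_i.
have : (-1 : C) ^+ m = 1 by rewrite -im2 -exprM mulnC exprM im1 expr1n.
rewrite -signr_odd; case: (boolP (odd m)) => om; first by rewrite expr1 => /eqP; rewrite (negbTE N1).
move: bm; rewrite -(odd_double_half m) (negbTE om) add0n -mul2n exprM b2 expr1n => /eqP.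
by rewrite eq_sym (negbTE N1).
Qed.

Definition mono j k (z : C) : C := z ^+ j * conjc z ^+ k.

Lemma dmeasurable_mono j k : dmeasurable (mono j k).
Proof.
by apply: cmeasurableM; apply: cmeasurableX; [|apply: cmeasurableJ]; exact: cmeasurable_of_plane.
Qed.

Lemma mono_le1 j k z : cnorm z < 1 -> cnorm (mono j k z) <= 1.
Proof.
move=> z1; rewrite /mono cnormM !cnormX cnormJ -exprD exprn_ile1 ?cnorm_ge0//.
exact: ltW.
Qed.

Lemma dintegrable_mono j k : dintegrable (mono j k).
Proof.
by apply: (bounded_dintegrable _ 1); [exact: dmeasurable_mono|exact: mono_le1].
Qed.

(* Rotation by a multiplies the integral by a^(j-k). *)
Lemma dint_mono_neq j k : j != k -> dint (mono j k) = 0.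
Proof.
have key (a : C) : cnorm a = 1 -> complex.Im a != 0 -> a ^+ j != a ^+ k ->
    dint (mono j k) = 0.
  move=> a1 Ia ajk; have := rotation_dint (mono j k) a a1 Ia (dintegrable_mono j k).
  have -> : dint (fun z => mono j k (a * z)) = a ^+ j * conjc a ^+ k * dint (mono j k).
    rewrite /dint -cintZ//; last exact: dintegrable_mono.
    apply: eq_cint => p _; rewrite /= /mono conjcM !exprMn.
    by rewrite mulrACA.
  move=> /eqP; rewrite -{2}[dint _]mul1r -subr_eq0 -mulrBl mulf_eq0 => /orP[|/eqP//].
  have aa : a ^+ k * conjc a ^+ k = 1 by rewrite -exprMn mulcJ a1 expr1n expr1n.
  rewrite -aa -mulrBl mulf_eq0 subr_eq0 (negbTE ajk) /= => /eqP a0.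
  by move: aa; rewrite a0 mulr0 => /eqP; rewrite eq_sym oner_eq0.
have key' : (exists a : C, [/\ cnorm a = 1, complex.Im a != 0 & a ^+ j != a ^+ k]) ->
    dint (mono j k) = 0 by move=> [a [a1 Ia ajk]]; exact: (key a).
move=> jk; apply: key'; clear key.
have gen m n : (m < n)%N ->
    exists a : C, [/\ cnorm a = 1, complex.Im a != 0 & a ^+ m != a ^+ n].
  move=> mn; have nm : (0 < n - m)%N by rewrite subn_gt0.
  have [a [a1 Ia am]] := unit_nonroot _ nm.
  exists a; split => //; apply: contra am => /eqP ajk.
  have a0 : a ^+ m != 0 by rewrite expf_neq0// -cnorm_eq0 a1 oner_eq0.
  by apply/eqP/(mulfI a0); rewrite -exprD subnKC ?mulr1 ?ajk// ltnW.
move: jk; rewrite neq_ltn => /orP[/gen//|/gen[a [a1 Ia akj]]].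
by exists a; split => //; rewrite eq_sym.
Qed.

Lemma dilation_transport (r : R) : 0 < r ->
  transports dA (fun p : P => (r * p.1, r * p.2) : P) (r ^- 2).
Proof. by move=> r0; exact/transports_dA/transports_dilation. Qed.

Lemma dilation_preimage (r : R) : 0 < r ->
  (fun p : P => (r * p.1, r * p.2) : P) @^-1` (subdisk r) = D.
Proof.
move=> r0; have TE (p : P) : of_plane ((r * p.1, r * p.2) : P) = r%:C * of_plane p.
  by apply: complex_ext; rewrite ?ReM ?ImM /=; ring.
have E (p : P) : (cnorm (of_plane ((r * p.1, r * p.2) : P)) < r) = (cnorm (of_plane p) < 1).
  by rewrite TE cnormM cnormR gtr0_norm// gtr_pMr.
by apply/funext => p; exact: (congr1 is_true (E p)).
Qed.

Lemma dilation_integral (r : R) (g : P -> \bar R) : 0 < r ->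
  measurable_fun (subdisk r) g -> (forall p, subdisk r p -> (0 <= g p)%E) ->
  (\int[dA]_(p in D) g (r * p.1, r * p.2)%R = (r ^- 2)%:E * \int[dA]_(p in subdisk r) g p)%E.
Proof.
move=> r0 mg g0.
have := transports_ge0_integral _ _ _ _ g _ (dilation_transport r r0)
  (measurable_subdisk r) mg g0.
by rewrite dilation_preimage//; apply; rewrite invr_ge0 exprn_ge0// ltW.
Qed.

End DiskIntegrals.

(** * The integrals of |z|^(2 n) *)

Section RadialMoment.
Context {R : realType}.
Local Notation C := R[i].
Local Notation P := (measurableTypeR R * measurableTypeR R)%type.
Local Notation dA := (@dA R).
Local Notation D := (@plane_disk R).

Let mD : measurable D. Proof. exact: measurable_plane_disk. Qed.
Let G n (p : P) : \bar R := (cnorm (of_plane p) ^+ (2 * n))%:E.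
Let mG n (E : set P) : measurable_fun E (G n).
Proof.
apply/measurable_EFinP/measurable_funX/measurable_cnorm.
exact: cmeasurable_of_plane.
Qed.
Let G0 n p : (0 <= G n p)%E. Proof. by rewrite lee_fin exprn_ge0// cnorm_ge0. Qed.

Let subD q : 0 < q < 1 -> subdisk q `<=` D.
Proof.
move=> /andP[q0 q1] p pq; change (cnorm (of_plane p) < 1).
exact: lt_trans (pq : cnorm (of_plane p) < q) q1.
Qed.

(* Dilating the disk by q multiplies the integral of |z|^2n by q^(2n+2). *)
Let disk_cut n q : 0 < q < 1 ->
  (\int[dA]_(p in D) G n p = (q ^+ (2 * n + 2))%:E * \int[dA]_(p in D) G n p +
   \int[dA]_(p in D `\` subdisk q) G n p)%E.
Proof.
move=> q01; have /andP[q0 q1] := q01.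
have h := dilation_integral q (G n) q0 (mG n _) (fun p _ => G0 n p).
have -> : ((q ^+ (2 * n + 2))%:E * \int[dA]_(p in D) G n p =
    \int[dA]_(p in subdisk q) G n p)%E.
  have -> : (\int[dA]_(p in subdisk q) G n p =
      (q ^+ 2)%:E * ((q ^- 2)%:E * \int[dA]_(p in subdisk q) G n p))%E.
    by rewrite muleA -EFinM divff ?mul1e// expf_neq0// gt_eqF.
  rewrite -h addnC exprD EFinM -muleA; congr (_ * _)%E.
  rewrite -ge0_integralZl//; last by rewrite lee_fin exprn_ge0// ltW.
  apply: eq_integral => p _; rewrite /G -EFinM; congr EFin.
  have -> : of_plane ((q * p.1, q * p.2) : P) = q%:C * of_plane p.
    by apply: complex_ext; rewrite ?ReM ?ImM /=; ring.
  by rewrite cnormM cnormR gtr0_norm// exprMn.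
have mS := measurable_subdisk q.
have DU : D = subdisk q `|` (D `\` subdisk q).
  by rewrite setDUK//; exact: subD.
rewrite {1}DU ge0_integral_setU//; first exact: measurableD.
by apply/disj_setPS => p [pq [_ npq]]; exact: npq.
Qed.

Let I n := \int[dA]_(p in D) (cnorm (of_plane p) ^+ (2 * n)).

Let IE n : (\int[dA]_(p in D) G n p = (I n)%:E)%E.
Proof.
rewrite /I /Rintegral fineK// ge0_fin_numE; last by apply: integral_ge0 => p _; exact: G0.
apply: (@le_lt_trans _ _ (\int[dA]_(p in D) (cst 1%E p))%E).
  apply: ge0_le_integral => //; do ?[exact: mG|exact: measurable_cst|by move=> ? _; exact: G0].
  move=> p pD; rewrite lee_fin exprn_ile1 ?cnorm_ge0//.
  exact/ltW/pD.
by rewrite integral_cst// dA_disk mule1 ltry.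
Qed.

Let I0 : I 0%N = 1.
Proof.
rewrite /I -[RHS](Rintegral_cst_disk 1); apply: eq_Rintegral => p _.
by rewrite muln0 expr0.
Qed.

(** With x = q^2, [disk_cut] at exponent 0 gives the annulus |z| >= q the area 1 - x, and on it
    |z|^(2 n) lies between x^n and 1. At exponent n the annulus carries I_n (1 - x^(n+1)), and
    division by 1 - x brings in the geometric sum. *)
Let bracket n x : 0 < x < 1 ->
  x ^+ n <= I n * (\sum_(i < n.+1) x ^+ i) <= 1.
Proof.
move=> /andP[x0 x1]; pose q := Num.sqrt x.
have q2 : q ^+ 2 = x by rewrite sqr_sqrtr// ltW.
have q01 : 0 < q < 1.
  by rewrite sqrtr_gt0 x0 /= -sqrtr1 ltr_sqrt.
have qE m : q ^+ (2 * m + 2) = x ^+ m.+1 by rewrite exprD exprM q2 -exprSr.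
pose E := D `\` subdisk q.
have mE : measurable E by apply: measurableD => //; exact: measurable_subdisk.
have c0 := disk_cut 0 q q01; have cn := disk_cut n q q01.
rewrite !IE qE -EFinM I0 mulr1 in c0; rewrite !IE qE -EFinM in cn.
have E0 : (\int[dA]_(p in E) G 0 p = (1 - x)%:E)%E.
  move: c0; rewrite -/E; case: (\int[dA]_(p in E) G 0 p)%E => [y| |] //.
  by rewrite -EFinD => -[e]; congr EFin; rewrite e; ring.
have lo : ((x ^+ n * (1 - x))%:E <= \int[dA]_(p in E) G n p)%E.
  have xn0 : (0 <= (x ^+ n)%:E :> \bar R)%E by rewrite lee_fin exprn_ge0// ltW.
  rewrite EFinM -E0 -ge0_integralZl//; do ?[exact: mG|by move=> ? _; exact: G0].
  apply: ge0_le_integral => //.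
  - by move=> p _; rewrite mule_ge0//; exact: G0.
  - by apply: emeasurable_funM; [exact: measurable_cst|exact: mG].
  - move=> p [pD npq]; rewrite /G -EFinM muln0 expr0 mulr1 lee_fin.
    have qp : q <= cnorm (of_plane p) by rewrite leNgt; apply/negP.
    rewrite -q2 -exprM lerXn2r ?nnegrE ?cnorm_ge0//; by case/andP: q01 => /ltW.
have hi : (\int[dA]_(p in E) G n p <= (1 - x)%:E)%E.
  rewrite -E0; apply: ge0_le_integral => //; do ?[exact: mG|by move=> ? _; exact: G0].
  move=> p [pD _].
  by rewrite /G muln0 expr0 lee_fin exprn_ile1 ?cnorm_ge0//; exact/ltW/pD.
move: cn lo hi; rewrite -/E; case: (\int[dA]_(p in E) G n p)%E => [y| |] //.
rewrite -EFinD !lee_fin => -[cn] lo hi.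
have x1' : 0 < 1 - x by rewrite subr_gt0.
have key : I n * (\sum_(i < n.+1) x ^+ i) * (1 - x) = y.
  have -> : I n * (\sum_(i < n.+1) x ^+ i) * (1 - x) = - (I n * ((x - 1) * \sum_(i < n.+1) x ^+ i)).
    by ring.
  by rewrite -subrX1 {1}mulrBr; move: cn; lra.
by rewrite -(ler_pM2r x1') -[X in _ && X](ler_pM2r x1') key mul1r lo hi.
Qed.

(** Letting x tend to 1 in [bracket] gives I_n (n + 1) = 1, so the dilation law alone determines the
    integral. *)
Lemma Rintegral_radial n : I n = n.+1%:R^-1.
Proof.
have n1 : 0 < n.+1%:R :> R by [].
have i0 : 0 <= I n by apply: Rintegral_ge0 => p _; rewrite exprn_ge0// cnorm_ge0.
(* Bernoulli's inequality, weakened so as to be uniform in i <= n. *)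
have bern (x : R) i : 0 < x < 1 -> (i <= n)%N -> 1 - n%:R * (1 - x) <= x ^+ i.
  move=> /andP[x0 x1] ile; apply: (@le_trans _ _ (1 - i%:R * (1 - x))).
    by rewrite lerD2l lerN2 ler_wpM2r ?ler_nat// subr_ge0 ltW.
  elim: i {ile} => [|i IH]; first by rewrite mul0r subr0 expr0.
  rewrite exprS; apply: (@le_trans _ _ (x * (1 - i%:R * (1 - x)))); last by rewrite ler_wpM2l// ltW.
  rewrite -natr1 -subr_ge0.
  have -> : x * (1 - i%:R * (1 - x)) - (1 - (i%:R + 1) * (1 - x)) = i%:R * (1 - x) ^+ 2.
    by ring.
  by rewrite mulr_ge0// sqr_ge0.
have small e : 0 < e -> exists2 x : R, 0 < x < 1 & n%:R * (1 - x) < e.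
  move=> e0; exists (1 - Num.min 2^-1 (e / n.+1%:R)).
    have h : 0 < Num.min 2^-1 (e / n.+1%:R) by rewrite lt_min invr_gt0 ltr0n divr_gt0.
    have h' : Num.min 2^-1 (e / n.+1%:R) <= 2^-1 by rewrite ge_min lexx.
    have h2 : 2^-1 < 1 :> R by rewrite invf_lt1// ltr1n.
    by rewrite subr_gt0 gtrBl h (le_lt_trans h').
  rewrite opprB addrC subrK; have h' : Num.min 2^-1 (e / n.+1%:R) <= e / n.+1%:R by rewrite ge_min lexx orbT.
  apply: le_lt_trans (ler_wpM2l (ler0n _ _) h') _.
  by rewrite mulrA ltr_pdivrMr// mulrC ltr_pM2l// ltr_nat.
have up : I n * n.+1%:R <= 1.
  apply/ler_addgt0Pr => e e0.
  have k0 : 0 < I n * n.+1%:R + 1 by rewrite ltr_wpDl// mulr_ge0.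
  have [x x01 xe] := small _ (divr_gt0 e0 k0).
  have /andP[_ h] := bracket n x x01.
  have h2 : I n * (n.+1%:R * (1 - n%:R * (1 - x))) <= 1.
    apply: le_trans h; rewrite ler_wpM2l//.
    rewrite -[n.+1 in X in X <= _](card_ord n.+1) mulr_natl -sumr_const.
    by apply: ler_sum => i _; apply: bern => //; rewrite -ltnS.
  move: xe; rewrite ltr_pdivlMr// => xe.
  have h3 : I n * n.+1%:R * (n%:R * (1 - x)) <= (I n * n.+1%:R + 1) * (n%:R * (1 - x)).
    by rewrite ler_wpM2r ?lerDl// mulr_ge0// subr_ge0; case/andP: x01 => _ /ltW.
  move: h2 h3 xe; move: (I n) (n.+1%:R) (n%:R * (1 - x)) => a b c; lra.
have lo : 1 <= I n * n.+1%:R.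
  apply/ler_addgt0Pr => e e0; have [x x01 xe] := small _ e0.
  have /andP[h _] := bracket n x x01.
  have h2 : I n * (\sum_(i < n.+1) x ^+ i) <= I n * n.+1%:R.
    rewrite ler_wpM2l// -[n.+1 in X in _ <= X](card_ord n.+1) -sumr_const.
    by apply: ler_sum => i _; rewrite exprn_ile1//; case/andP: x01 => /ltW // _ /ltW.
  have := bern x n x01 (leqnn _); move: h h2 xe; lra.
have n0 : n.+1%:R != 0 :> R by rewrite gt_eqF.
apply: (mulIf n0).
by rewrite mulVf ?gt_eqF//; apply/eqP; rewrite eq_le up lo.
Qed.

Lemma dint_mono_eq n : dint (mono n n) = (n.+1%:R^-1 : R)%:C.
Proof.
rewrite -Rintegral_radial; apply: complex_ext; rewrite /=.
  apply: eq_Rintegral => p _ /=; rewrite /mono -exprMn mulcJ -!rmorphXn /=.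
  by rewrite -exprM.
rewrite -[RHS](Rintegral_cst_disk 0); apply: eq_Rintegral => p _ /=.
by rewrite /mono -exprMn mulcJ -rmorphXn.
Qed.

End RadialMoment.

(** * Dilated pairings *)

Section Pairing.
Context {R : realType}.
Local Notation C := R[i].
Local Notation P := (measurableTypeR R * measurableTypeR R)%type.
Local Notation dA := (@dA R).
Local Notation D := (@plane_disk R).
Implicit Types (f g h : C -> C) (c : nat -> C).

Let mD : measurable D. Proof. exact: measurable_plane_disk. Qed.

Lemma dint_dominated (f_ : nat -> C -> C) f (g : P -> R) :
  (forall n, dmeasurable (f_ n)) ->
  (forall z, cnorm z < 1 -> cnorm (f_ n z - f z) @[n --> \oo] --> (0 : R)) ->
  dA.-integrable D (EFin \o g) ->
  (forall n p, D p -> cnorm (f_ n (of_plane p)) <= g p) ->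
  dintegrable f /\ cnorm (dint (f_ n) - dint f) @[n --> \oo] --> (0 : R).
Proof.
move=> mf ff ig fg.
apply: (cint_dominated dA D mD (fun n => f_ n \o of_plane) (f \o of_plane) g) => //.
by move=> p pD; exact: ff.
Qed.

Lemma dintegrableM h f (M : R) : dintegrable h -> dmeasurable f ->
  (forall z, cnorm z < 1 -> cnorm (f z) <= M) -> dintegrable (fun z => h z * f z).
Proof.
move=> ih mf fM.
have := cintegrableM_bounded dA D mD (f \o of_plane) (h \o of_plane) M mf (fun p pD => fM _ pD) ih.
apply: eq_cintegrable => // p _; by rewrite /= mulrC.
Qed.

Definition coefsum c (a : C) n (z : C) := \sum_(j < n) c j * (a * z) ^+ j.

Lemma dmeasurable_coefsum c a n : dmeasurable (coefsum c a n).
Proof.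
apply: cmeasurable_sum => j; apply: cmeasurableM; first exact: cmeasurable_cst.
by apply: cmeasurableX; apply: cmeasurableM; [exact: cmeasurable_cst|exact: cmeasurable_of_plane].
Qed.

Lemma coefsum_bounded c (a : C) : geo_bounded c -> cnorm a < 1 ->
  exists2 K, 0 <= K & forall n z, cnorm z < 1 -> cnorm (coefsum c a n z) <= K.
Proof.
move=> hc a1; pose s := (1 + cnorm a) / 2; have a0 := cnorm_ge0 a.
have s0 : 0 < s by rewrite /s; lra.
have s1 : s < 1 by rewrite /s; lra.
have as_ : cnorm a < s by rewrite /s; lra.
have s01 : 0 < s < 1 by rewrite s0.
have [M hM] := hc s s01.
have M0 : 0 <= M by have := le_trans (cnorm_ge0 _) (hM 0%N); rewrite expr0 divr1.
have q0 : 0 <= cnorm a / s by apply: divr_ge0 => //; exact: ltW.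
have q1 : cnorm a / s < 1 by rewrite ltr_pdivrMr// mul1r.
exists (M * (1 - cnorm a / s)^-1); first by rewrite mulr_ge0// invr_ge0 subr_ge0 ltW.
move=> n z z1; apply: le_trans (cnorm_sum _ _ _ _) _.
apply: (@le_trans _ _ (\sum_(j < n) M * (cnorm a / s) ^+ j)).
  apply: ler_sum => j _; rewrite cnormM cnormX cnormM expr_div_n mulrA mulrAC.
  apply: ler_pM; rewrite ?cnorm_ge0 ?exprn_ge0 ?mulr_ge0 ?cnorm_ge0//.
  rewrite lerXn2r ?nnegrE ?mulr_ge0 ?cnorm_ge0// ler_piMr//; exact: ltW.
by rewrite -mulr_sumr; apply: ler_wpM2l => //; exact: geo_le.
Qed.

Lemma dilate_props f c (a : C) : has_taylor f c -> cnorm a < 1 ->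
  dmeasurable (fun z => f (a * z)) /\
  exists2 K, 0 <= K & (forall n z, cnorm z < 1 -> cnorm (coefsum c a n z) <= K) /\
    forall z, cnorm z < 1 -> cnorm (f (a * z)) <= K.
Proof.
move=> [hc hf] a1; have [K K0 hK] := coefsum_bounded c a hc a1.
have az z : cnorm z < 1 -> cnorm (a * z) < 1.
  move=> z1; rewrite cnormM; apply: le_lt_trans a1.
  by rewrite ler_piMr ?cnorm_ge0// ltW.
have cv z : cnorm z < 1 -> cnorm (coefsum c a n z - f (a * z)) @[n --> \oo] --> (0 : R).
  by move=> z1; exact: (hf _ (az z z1)).
split.
  apply: (cmeasurable_lim D (fun n => coefsum c a n \o of_plane)).
    by move=> n; exact: dmeasurable_coefsum.
  by move=> p pD; exact: cv.
exists K => //; split => // z z1.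
apply/ler_addgt0Pr => e e0.
have /cvgr0Pnorm_lt/(_ _ e0)[n _ /(_ _ (leqnn n))] := cv z z1.
rewrite ger0_norm ?cnorm_ge0// => ltn.
apply: le_trans (cdist_le _ (coefsum c a n z)) _.
by apply: lerD; [exact: hK|rewrite cdistC ltW].
Qed.

Lemma pairing_dilate h f c (a : C) : dintegrable h -> has_taylor f c -> cnorm a < 1 ->
  dintegrable (fun z => h z * conjc (f (a * z))) /\
  cnorm (\sum_(j < n) conjc (c j * a ^+ j) * dint (fun z => h z * conjc z ^+ j) -
    dint (fun z => h z * conjc (f (a * z)))) @[n --> \oo] --> (0 : R).
Proof.
move=> ih tf a1; have [mfa [K K0 [hK fK]]] := dilate_props f c a tf a1.
have az z : cnorm z < 1 -> cnorm (a * z) < 1.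
  move=> z1; rewrite cnormM; apply: le_lt_trans a1.
  by rewrite ler_piMr ?cnorm_ge0// ltW.
have mh := cintegrable_measurable _ _ _ ih.
have igK : dA.-integrable D (EFin \o (fun p => cnorm (h (of_plane p)) * K)).
  have := integrableZl mD K (cintegrable_norm _ _ mD _ ih).
  by apply: eq_integrable => // p _; rewrite /= mulrC EFinM.
have [||n p pD|i1 i2] := dint_dominated (fun n z => h z * conjc (coefsum c a n z))
    (fun z => h z * conjc (f (a * z))) _ _ _ igK.
- move=> n; apply: cmeasurableM => //; apply: cmeasurableJ; exact: dmeasurable_coefsum.
- move=> z z1; have hz := cvg0Z (cnorm (h z)) _ (tf.2 _ (az z z1)).
  apply: (squeeze0 _ _ _ _ hz); first by move=> n; exact: cnorm_ge0.
  by move=> n; rewrite -mulrBr cnormM -conjcB cnormJ.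
- by rewrite cnormM cnormJ ler_wpM2l ?cnorm_ge0// hK.
split => //; apply: (squeeze0 _ _ _ _ i2); first by move=> n; exact: cnorm_ge0.
move=> n; rewrite le_eqVlt; apply/orP; left; apply/eqP; congr (cnorm (_ - _)).
have imono j : dintegrable (fun z => h z * conjc z ^+ j).
  apply: (dintegrableM _ _ 1) => //.
    by apply: cmeasurableX; apply: cmeasurableJ; exact: cmeasurable_of_plane.
  by move=> z z1; rewrite cnormX cnormJ exprn_ile1 ?cnorm_ge0// ltW.
transitivity (dint (fun z => \sum_(j < n) conjc (c j * a ^+ j) * (h z * conjc z ^+ j))).
  rewrite /dint cint_sum//; last by move=> j; apply: cintegrableZ => //; exact: imono.
  by apply: eq_bigr => j _; rewrite -cintZ//; exact: imono.
apply: eq_cint => p _; rewrite /= /coefsum conjc_sum mulr_sumr; apply: eq_bigr => j _.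
rewrite exprMn !conjcM !conjcX; move: (h _) (conjc (c j)) (conjc a ^+ j) (conjc _ ^+ j) => x y u v; ring.
Qed.

Lemma geo_taylor : has_taylor (fun z => (1 - z)^-1 : C) (fun=> 1).
Proof.
split.
  move=> r /andP[r0 r1]; exists 1 => j; rewrite cnorm1 ler_pdivlMr ?exprn_gt0// mul1r.
  by rewrite exprn_ile1// ltW.
move=> z z1; have z1' : z != 1 by apply/eqP => zE; move: z1; rewrite zE cnorm1 ltxx.
have h := cvg_geo0 (cnorm (1 - z)^-1) (cnorm z) (ltac:(by rewrite cnorm_ge0)).
apply: (squeeze0 _ _ _ _ h); first by move=> n; exact: cnorm_ge0.
move=> n; rewrite cdistC (eq_bigr (fun j : 'I_n => z ^+ j)) => [|j _]; last by rewrite mul1r.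
by rewrite geo_sum// cnormM cnormX mulrC.
Qed.

(** On the diagonal two Szego kernels coincide, and their product is a dilate of this function. *)
Lemma geo2_taylor : has_taylor (fun z => (1 - z) ^- 2 : C) (fun j => j.+1%:R).
Proof.
have g1 : geo_bounded (fun=> 1 : C) by exact: geo_taylor.1.
split.
  have := geo_bounded_shift _ (geo_bounded_natM _ g1); congr geo_bounded.
  by apply/funext => j; rewrite mulr1.
move=> z z1; have z1' : z != 1 by apply/eqP => zE; move: z1; rewrite zE cnorm1 ltxx.
have h := cvg0Z (2 * cnorm ((1 - z) ^- 2)) _ (cvg_natX0 _ (cnorm_ge0 z) z1).
apply: (squeeze0 _ _ _ _ h); first by move=> n; exact: cnorm_ge0.
move=> n; rewrite cdistC geo_sum2// [leLHS]cnormM [cnorm (_ * z ^+ n)]cnormM cnormX.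
have A : cnorm (n.+1%:R - n%:R * z) <= 2 * n.+1%:R.
  apply: le_trans (cnormB _ _) _; rewrite cnormM !cnorm_nat.
  rewrite mulr_natl mulr2n lerD2l.
  apply: (@le_trans _ _ (n%:R * 1)); first by apply: ler_wpM2l => //; exact: ltW.
  by rewrite mulr1 ler_nat.
have K0 := cnorm_ge0 ((1 - z) ^- 2).
have q0 : 0 <= cnorm z ^+ n by apply: exprn_ge0; exact: cnorm_ge0.
move: A K0 q0; rewrite -[((1 - z) ^+ 2)^-1]/((1 - z) ^- 2).
move: (cnorm (n.+1%:R - _)) (cnorm ((1 - z) ^- 2)) (cnorm z ^+ n) (n.+1%:R : R) => a K q b A K0 q0.
have := ler_wpM2r (mulr_ge0 K0 q0) A; lra.
Qed.

Lemma dilate_integrable f (r : R) : 0 < r < 1 -> dintegrable f ->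
  dintegrable (fun z => f (r%:C * z)).
Proof.
move=> /andP[r0 r1] If.
have SD : subdisk r `<=` D by move=> p pr; exact: lt_trans (pr : cnorm (of_plane p) < r) r1.
have If' : cintegrable dA (subdisk r) (f \o of_plane).
  by case: If => i1 i2; split; apply: integrableS SD _ => //; exact: measurable_subdisk.
have r2 : 0 <= r ^- 2 by rewrite invr_ge0 exprn_ge0// ltW.
have [] := transports_cint dA _ _ _ _ r2 (dilation_transport r r0) (measurable_subdisk r) If'.
rewrite dilation_preimage// => i1 _; apply: eq_cintegrable i1 => // p _ /=.
by congr f; apply: complex_ext; rewrite ?ReM ?ImM /=; ring.
Qed.

Lemma dilate_norm_le f (r : R) : 0 < r < 1 -> dintegrable f ->
  \int[dA]_(p in D) cnorm (f (r%:C * of_plane p)) <=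
  r ^- 2 * \int[dA]_(p in D) cnorm (f (of_plane p)).
Proof.
move=> r01 If; have /andP[r0 r1] := r01.
have SD : subdisk r `<=` D by move=> p pr; exact: lt_trans (pr : cnorm (of_plane p) < r) r1.
have mS := measurable_subdisk r.
have mf : measurable_fun D (fun p : P => (cnorm (f (of_plane p)))%:E).
  by apply/measurable_EFinP/measurable_cnorm; exact: cintegrable_measurable If.
have mf' : measurable_fun (subdisk r) (fun p : P => (cnorm (f (of_plane p)))%:E).
  exact: measurable_funS mf.
have := dilation_integral r _ r0 mf' (fun p _ => ltac:(by rewrite lee_fin cnorm_ge0)).
move=> e.
have fin : (\int[dA]_(p in D) (cnorm (f (of_plane p)))%:E)%E \is a fin_num.
  exact: integrable_fin_num (cintegrable_norm _ _ mD _ If).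
have fin' : (\int[dA]_(p in D) (cnorm (f (r%:C * of_plane p)))%:E)%E \is a fin_num.
  exact: integrable_fin_num (cintegrable_norm _ _ mD _ (dilate_integrable f r r01 If)).
rewrite -lee_fin EFinM /Rintegral !fineK//.
have -> : (\int[dA]_(p in D) (cnorm (f (r%:C * of_plane p)))%:E)%E =
    ((r ^- 2)%:E * \int[dA]_(p in subdisk r) (cnorm (f (of_plane p)))%:E)%E.
  rewrite -e; apply: eq_integral => p _; congr (cnorm (f _))%:E.
  by apply: complex_ext; rewrite ?ReM ?ImM /=; ring.
apply: lee_wpmul2l; first by rewrite lee_fin invr_ge0 exprn_ge0// ltW.
by apply: ge0_subset_integral => // p _; rewrite lee_fin cnorm_ge0.
Qed.

(* The defect |f_n| + |f| - |f_n - f| is dominated by 2 |f|, and dilation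
   inflates the L^1 norm by at most u_n^-2. *)
Lemma dilation_L1 f (u : nat -> R) : dintegrable f -> (forall n, 0 < u n < 1) ->
  u n @[n --> \oo] --> (1 : R) ->
  (forall z, cnorm z < 1 -> cnorm (f ((u n)%:C * z) - f z) @[n --> \oo] --> (0 : R)) ->
  \int[dA]_(p in D) cnorm (f ((u n)%:C * of_plane p) - f (of_plane p))
    @[n --> \oo] --> (0 : R).
Proof.
move=> If u01 u1 fu.
have Ifu n := dilate_integrable f (u n) (u01 n) If.
have nF := cintegrable_norm _ _ mD _ If.
have nFu n := cintegrable_norm _ _ mD _ (Ifu n).
have nD n := cintegrable_norm _ _ mD _ (cintegrableB _ _ mD _ _ (Ifu n) If).
pose F p := cnorm (f (of_plane p)); pose Fu n p := cnorm (f ((u n)%:C * of_plane p)).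
pose E n p := cnorm (f ((u n)%:C * of_plane p) - f (of_plane p)).
pose k n p := Fu n p + F p - E n p.
have i2F : dA.-integrable D (EFin \o (fun p => 2 * F p)).
  by apply: eq_integrable (integrableZl mD 2 nF) => // p _; rewrite /= EFinM.
have ik n : dA.-integrable D (EFin \o k n).
  apply: eq_integrable (integrableB mD (integrableD mD (nFu n) nF) (nD n)) => // p _.
have kb n p : 0 <= k n p <= 2 * F p.
  rewrite /k /Fu /F /E; apply/andP; split.
    by rewrite subr_ge0; exact: cnormB.
  have := cdist_le (f ((u n)%:C * of_plane p)) (f (of_plane p)); lra.
have [|||||_ _ hk] := @dominated_convergence _ _ _ dA D mD
  (fun n => EFin \o k n) (EFin \o (fun p => 2 * F p)) (EFin \o (fun p => 2 * F p)).
- by move=> n; exact: measurable_int (ik n).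
- exact: measurable_int i2F.
- apply: aeW => p pD /=; apply: cvg_EFin; first by apply: nearW.
  apply/cvgrPdist_lt => e e0.
  have /cvgr0Pnorm_lt := fu _ pD; have e20 : 0 < e / 2 by rewrite divr_gt0.
  move=> /(_ _ e20); apply: filterS => n; rewrite ger0_norm ?cnorm_ge0// => h.
  rewrite /= /k /Fu /F /E; apply: (@le_lt_trans _ _ (2 * cnorm (f ((u n)%:C * of_plane p) - f (of_plane p)))); last by move: h; lra.
  have h1 := cdist_le (f ((u n)%:C * of_plane p)) (f (of_plane p)).
  have h2 := cdist_le (f (of_plane p)) (f ((u n)%:C * of_plane p)).
  rewrite cdistC in h2; rewrite ler_norml; apply/andP; split; move: h1 h2 (cnorm_ge0 (f ((u n)%:C * of_plane p) - f (of_plane p))); lra.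
- exact: i2F.
- apply: aeW => p n pD /=; rewrite lee_fin; have /andP[k0 k2] := kb n p.
  by rewrite ger0_norm.
have hk' : \int[dA]_(p in D) k n p @[n --> \oo] --> 2 * \int[dA]_(p in D) F p.
  rewrite -RintegralZl//.
  apply: (@fine_cvg R _ _ _ (fun n => (\int[dA]_(p in D) (k n p)%:E)%E)).
  rewrite /Rintegral fineK; first exact: hk.
  exact: integrable_fin_num i2F.
have EE n : \int[dA]_(p in D) E n p =
    \int[dA]_(p in D) Fu n p + \int[dA]_(p in D) F p - \int[dA]_(p in D) k n p.
  have iS : dA.-integrable D (EFin \o (fun p => Fu n p + F p)).
    by apply: eq_integrable (integrableD mD (nFu n) nF) => // p _.
  transitivity (\int[dA]_(p in D) (Fu n p + F p - k n p)).
    by apply: eq_Rintegral => p _; rewrite /k; ring.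
  rewrite (RintegralB mD iS (ik n)); congr (_ - _).
  by rewrite (RintegralD mD (nFu n) nF).
have up : (u n) ^- 2 * \int[dA]_(p in D) F p + \int[dA]_(p in D) F p -
    \int[dA]_(p in D) k n p @[n --> \oo] --> (0 : R).
  have -> : 0 = 1 ^- 2 * \int[dA]_(p in D) F p + \int[dA]_(p in D) F p - 2 * \int[dA]_(p in D) F p :> R.
    by rewrite expr1n invr1; ring.
  apply: cvgB => //; apply: cvgD; last exact: cvg_cst.
  apply: cvgM; last exact: cvg_cst.
  apply: cvgV; first by rewrite expr1n oner_neq0.
  by apply: cvgM.
apply: (squeeze0 _ _ _ _ up).
  by move=> n; apply: Rintegral_ge0 => p _; exact: cnorm_ge0.
by move=> n; rewrite [leLHS]EE !lerD2r; exact: dilate_norm_le.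
Qed.

Lemma Rintegral_bounded_cvg0 (w : nat -> C -> C) g (M : R) : dmeasurable g ->
  (forall z, cnorm z < 1 -> cnorm (g z) <= M) ->
  (forall n, dintegrable (w n)) ->
  \int[dA]_(p in D) cnorm (w n (of_plane p)) @[n --> \oo] --> (0 : R) ->
  cnorm (dint (fun z => g z * w n z)) @[n --> \oo] --> (0 : R).
Proof.
move=> mg gM iw w0; apply: (squeeze0 _ _ _ _ (cvg0Z M _ w0)).
  by move=> n; exact: cnorm_ge0.
move=> n; have igw : dintegrable (fun z => g z * w n z).
  exact: (cintegrableM_bounded dA D mD _ _ M mg (fun p pD => gM _ pD) (iw n)).
apply: le_trans (cnorm_cint_le _ _ mD _ igw) _; rewrite -RintegralZl//; last first.
  exact: (cintegrable_norm _ _ mD _ (iw n)).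
apply: le_Rintegral => //.
- exact: (cintegrable_norm _ _ mD _ igw).
- apply: eq_integrable (integrableZl mD M (cintegrable_norm _ _ mD _ (iw n))) => //.
- by move=> p pD; rewrite /= cnormM ler_wpM2r ?cnorm_ge0// gM.
Qed.

(** The Taylor sums of a merely integrable [g] need not be dominated. Its dilate by u < 1 has
    moments c_k u^k / (k + 1) by orthogonality, and [dilation_L1] lets u tend to 1. *)
Lemma taylor_moment g c : dintegrable g -> has_taylor g c ->
  (forall z, cnorm z < 1 -> ccont g z) ->
  forall k, dint (fun z => g z * conjc z ^+ k) = c k / k.+1%:R.
Proof.
move=> ig tg cg k.
(* The shift by 2 makes every factor positive, as dilation requires. *)
pose u (n : nat) : R := 1 - n.+2%:R^-1.
have u01 n : 0 < u n < 1.
  by rewrite subr_gt0 gtrBl invr_gt0 ltr0n invf_lt1 ?ltr1n.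
have u1 : u n @[n --> \oo] --> (1 : R).
  rewrite -[X in _ --> X]subr0; apply: cvgB; first exact: cvg_cst.
  have := @cvg_harmonic R; rewrite -(cvg_shiftS); exact.
have gu z : cnorm z < 1 -> cnorm (g ((u n)%:C * z) - g z) @[n --> \oo] --> (0 : R).
  move=> z1; apply/cvgr0Pnorm_lt => e e0; have [d d0 hd] := cg z z1 e e0.
  have d1 : 0 < d by [].
  have /cvgrPdist_lt/(_ _ d1) := u1; apply: filterS => n ud.
  rewrite ger0_norm ?cnorm_ge0//; apply: hd.
  rewrite -{2}[z]mul1r -mulrBl cnormM -[1]/(1%:C) -RCB cnormR distrC.
  by apply: le_lt_trans ud; rewrite ler_piMr// ltW.
have L1 := dilation_L1 g u ig u01 u1 gu.
have mk : dmeasurable (fun z : C => conjc z ^+ k).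
  by apply: cmeasurableX; apply: cmeasurableJ; exact: cmeasurable_of_plane.
have k1 (z : C) : cnorm z < 1 -> cnorm (conjc z ^+ k) <= 1.
  by move=> z1; rewrite cnormX cnormJ exprn_ile1 ?cnorm_ge0// ltW.
have igu n : dintegrable (fun z => g ((u n)%:C * z)) by exact: dilate_integrable.
have h1 := Rintegral_bounded_cvg0 (fun n z => g ((u n)%:C * z) - g z) _ 1 mk k1
   (fun n => cintegrableB _ _ mD _ _ (igu n) ig) L1.
have au n : cnorm ((u n)%:C : C) < 1.
  by have /andP[h0 h2] := u01 n; rewrite cnormR gtr0_norm.
have val n : dint (fun z => conjc z ^+ k * g ((u n)%:C * z)) = c k * (u n)%:C ^+ k / k.+1%:R.
  have ik : dintegrable (fun z : C => z ^+ k).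
    by apply: eq_cintegrable (dintegrable_mono k 0) => // p _; rewrite /= /mono expr0 mulr1.
  have [i2 s2] := pairing_dilate (fun z => z ^+ k) g c (u n)%:C ik tg (au n).
  have e1 : dint (fun z => conjc z ^+ k * g ((u n)%:C * z)) =
      conjc (dint (fun z => z ^+ k * conjc (g ((u n)%:C * z)))).
    by rewrite /dint -cintJ//; apply: eq_cint => p _; rewrite /= conjcM conjcX conjcK.
  rewrite e1; have e2 : dint (fun z => z ^+ k * conjc (g ((u n)%:C * z))) =
      conjc (c k * (u n)%:C ^+ k / k.+1%:R).
    apply/eqP; rewrite -subr_eq0 -cnorm_eq0 eq_le cnorm_ge0 andbT.
    (* From k + 1 terms on the partial sum contains its only nonzero term, the one of index k, and
       is constant. *)
    have := s2; rewrite -(cvg_shiftn k.+1) => s3.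
    apply: (cvg0_le0 _ _ s3) => N /=; rewrite cdistC le_eqVlt; apply/orP; left; apply/eqP.
    congr (cnorm (_ - _)); rewrite addnC big_split_ord /= big_ord_recr /=.
    rewrite big1 => [|i _]; last first.
      rewrite (_ : dint _ = dint (mono k i)); last by [].
      by rewrite dint_mono_neq ?mulr0// gtn_eqF.
    rewrite big1 => [|i _]; last first.
      rewrite (_ : dint _ = dint (mono k (k.+1 + i))); last by [].
      by rewrite dint_mono_neq ?mulr0// ltn_eqF// ltn_addr.
    rewrite add0r addr0 (_ : dint _ = dint (mono k k)); last by [].
    have kE : (k.+1%:R^-1 : C) = (k.+1%:R^-1)%:C by rewrite RCV rmorph_nat.
    rewrite dint_mono_eq kE; apply: etrans (conjcM _ _) _; congr (_ * _).
    by apply: complex_ext; rewrite /= ?oppr0.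
  by rewrite e2 conjcK.
apply/eqP; rewrite -subr_eq0 -cnorm_eq0 eq_le cnorm_ge0 andbT.
have h2 : cnorm (c k / k.+1%:R) * (1 - (u n) ^+ k) @[n --> \oo] --> (0 : R).
  have uk : (u n) ^+ k @[n --> \oo] --> (1 : R).
    elim: (k) => [|j IH]; first exact: cvg_cst.
    rewrite -[X in _ --> X]mulr1; under eq_fun do rewrite exprS.
    exact: cvgM u1 IH.
  have -> : 0 = cnorm (c k / k.+1%:R) * (1 - 1) :> R by rewrite subrr mulr0.
  apply: cvgM; first exact: cvg_cst.
  exact: cvgB (cvg_cst _) uk.
have h3 : cnorm (dint (fun z => conjc z ^+ k * (g ((u n)%:C * z) - g z))) +
   cnorm (c k / k.+1%:R) * (1 - (u n) ^+ k) @[n --> \oo] --> (0 : R).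
  by rewrite -[X in _ --> X]addr0; exact: cvgD.
apply: (cvg0_le0 _ _ h3) => n.
have igk : dintegrable (fun z => conjc z ^+ k * g z).
  exact: (cintegrableM_bounded dA D mD _ _ 1 mk (fun p pD => k1 _ pD) ig).
have igk' : dintegrable (fun z => conjc z ^+ k * g ((u n)%:C * z)).
  exact: (cintegrableM_bounded dA D mD _ _ 1 mk (fun p pD => k1 _ pD) (igu n)).
have -> : dint (fun z => conjc z ^+ k * (g ((u n)%:C * z) - g z)) =
   c k * (u n)%:C ^+ k / k.+1%:R - dint (fun z => g z * conjc z ^+ k).
  rewrite -val /dint -cintB//; first by apply: eq_cint => p _; rewrite /= mulrBr [g _ * _]mulrC.
  by apply: eq_cintegrable igk => // p _; rewrite /= mulrC.
have -> : cnorm (c k / k.+1%:R) * (1 - u n ^+ k) = cnorm (c k * (u n)%:C ^+ k / k.+1%:R - c k / k.+1%:R).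
  have -> : c k * (u n)%:C ^+ k / k.+1%:R - c k / k.+1%:R = - ((c k / k.+1%:R) * (1 - u n ^+ k)%:C).
    rewrite (_ : (1 - u n ^+ k)%:C = 1 - (u n)%:C ^+ k); last by rewrite RCB (rmorphXn (real_complex R)).
    by rewrite mulrBr mulr1 opprB mulrAC.
  rewrite [RHS]cnormN [RHS]cnormM cnormR ger0_norm// subr_ge0.
  by have /andP[/ltW h0 /ltW h4] := u01 n; rewrite exprn_ile1.
move: (dint _) (c k / k.+1%:R) (c k * _ / _) => I a b.
have -> : I - a = (b - a) - (b - I) by ring.
by rewrite [leRHS]addrC; exact: cnormB.
Qed.

End Pairing.

(** * The Hahn-Banach theorem and the dual of L^1 *)

Section HahnBanach.
Context {R : realType} {V : lmodType R}.
Variables (E : set V) (p : V -> R).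
Hypotheses (E_lin : forall x y s, E x -> E y -> E (x + s *: y))
  (p_add : forall x y, E x -> E y -> p (x + y) <= p x + p y)
  (p_hom : forall s x, 0 < s -> E x -> p (s *: x) = s * p x).

(** Partial functionals are graphs, so that extension is inclusion and Zorn's lemma applies to sets.
    Linearity and domination are confined to [E] because in the application [V] consists of all
    functions and [E] of the integrable ones. *)
Definition linear_graph (g : set (V * R)) := forall x a y b s,
  g (x, a) -> g (y, b) -> g (x + s *: y, a + s * b).

Definition graph_le (g : set (V * R)) := forall x a, g (x, a) -> E x /\ a <= p x.

Variable B : set (V * R).
Hypotheses (B_lin : linear_graph B) (B_le : graph_le B) (B0 : B (0, 0)).

(* The proviso [g !=set0] makes the union of the empty chain good. *)
Let good g := [/\ linear_graph g, graph_le g & g !=set0 -> B `<=` g].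

(** The graph contains (0, t (a - b)) for every t, and domination by p(0) = 0 makes t (a - b) <= 0
    for t = 1 and t = -1. *)
Let good_func g x a b : good g -> g (x, a) -> g (x, b) -> a = b.
Proof.
move=> [gl gp gB] gxa gxb.
have g0 : g (0, 0) by apply: (gB _ _ B0); exists (x, a).
have E0 : E 0 by have [] := gp _ _ g0.
have p0 : p 0 = 0.
  have := p_hom 2 0 ltac:(by []) E0; rewrite scaler0 => e; lra.
have gd : g (0, a - b).
  by have := gl _ _ _ _ (-1) gxa gxb; rewrite scaleN1r subrr mulN1r.
have key t : t * (a - b) <= 0.
  have := gl _ _ _ _ t g0 gd; rewrite scaler0 !add0r => /gp[_].
  by rewrite p0.
have := key 1; have := key (-1); lra.
Qed.

Let good_union F : F `<=` good -> total_on F subset -> good (\bigcup_(X in F) X).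
Proof.
move=> Fg tot; split.
- move=> x a y b s [X FX Xx] [Y FY Yy].
  have [XY|YX] := tot X Y FX FY.
    by exists Y => //; have [gl _ _] := Fg _ FY; apply: gl => //; exact: XY.
  by exists X => //; have [gl _ _] := Fg _ FX; apply: gl => //; exact: YX.
- by move=> x a [X FX Xx]; have [_ gp _] := Fg _ FX; exact: gp.
- move=> [z [X FX Xz]] w Bw; exists X => //.
  by have [_ _ gB] := Fg _ FX; apply: gB => //; exists z.
Qed.

Lemma hahn_banach_graph : exists psi : V -> R,
  [/\ forall x y s, E x -> E y -> psi (x + s *: y) = psi x + s * psi y,
      forall x, E x -> psi x <= p x & forall x a, B (x, a) -> psi x = a].
Proof.
have [g [gg gmax]] := Zorn_bigcup good_union.
have goodB : good B by split; [exact: B_lin|exact: B_le|move=> _].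

(* The empty graph is good by the proviso, but it is not maximal, since [B] extends it. *)
have gne : g !=set0.
  apply: contrapT => /set0P/negP; rewrite negbK => /eqP g0.
  by apply: (gmax B) => //; rewrite g0; split => // /(_ _ B0).
have [gl gp gB] := gg; have gB' := gB gne.
have g0 : g (0, 0) by exact: gB'.
have total v : E v -> exists a, g (v, a).
  move=> Ev; apply: contrapT => nv.
  have sep x a y b : g (x, a) -> g (y, b) -> a - p (x - v) <= p (y + v) - b.
    move=> gxa gyb; have [Ex _] := gp _ _ gxa; have [Ey _] := gp _ _ gyb.
    have [_] := gp _ _ (gl _ _ _ _ 1 gxa gyb); rewrite scale1r mul1r => h.
    have Exv : E (x - v) by have := E_lin x v (-1) Ex Ev; rewrite scaleN1r.
    have Eyv : E (y + v) by have := E_lin y v 1 Ey Ev; rewrite scale1r.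
    have := p_add _ _ Exv Eyv; rewrite addrACA [- v + v]addNr addr0 => h2.
    by move: h h2; lra.
  pose L := [set r | exists x a, g (x, a) /\ r = a - p (x - v)].
  (* The value given to [v]: [sep] says that every lower constraint lies below every upper one, so
     the supremum of the lower ones satisfies both. *)
  pose c := sup L.
  have cL x a : g (x, a) -> a - p (x - v) <= c.
    move=> gxa; apply: ub_le_sup; last by exists x, a.
    by exists (p (0 + v) - 0) => _ [y [b [gyb ->]]]; exact: sep.
  have cU y b : g (y, b) -> c <= p (y + v) - b.
    move=> gyb; apply: ge_sup; first by exists (0 - p (0 - v)), 0, 0.
    by move=> _ [x [a [gxa ->]]]; exact: sep.
  pose g' := [set z | exists x a t, g (x, a) /\ z = (x + t *: v, a + t * c)].
  have gg' : g `<=` g'.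
    by move=> [x a] gxa; exists x, a, 0; rewrite scale0r mul0r !addr0.
  have scl x a s : g (x, a) -> g (s *: x, s * a).
    by move=> gxa; have := gl _ _ _ _ s g0 gxa; rewrite !add0r.
  apply: (gmax g'); first last.
    split.
    - move=> _ _ _ _ s [x [a [t [gxa [-> ->]]]]] [y [b [r [gyb [-> ->]]]]].
      exists (x + s *: y), (a + s * b), (t + s * r); split; first exact: gl.
      congr pair; last by ring.
      by rewrite scalerDr scalerDl scalerA !addrA; congr (_ + _); rewrite addrAC.
    - move=> _ _ [x [a [t [gxa [-> ->]]]]]; have [Ex ax] := gp _ _ gxa.
      split; first exact: E_lin.
      (* Positive homogeneity rescales t < 0 to the lower constraint at x - v and t > 0 to the upper
         one at x + v. *)
      have [t0|t0|->] := ltrgtP t 0; last by rewrite scale0r mul0r !addr0.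
        have s0 : 0 < - t by rewrite oppr_gt0.
        have := cL _ _ (scl _ _ (- t)^-1 gxa).
        have Exv : E ((- t)^-1 *: x - v).
          have [Es _] := gp _ _ (scl _ _ (- t)^-1 gxa).
          by have := E_lin _ v (-1) Es Ev; rewrite scaleN1r.
        have -> : x + t *: v = (- t) *: ((- t)^-1 *: x - v).
          by rewrite scalerBr scalerA divff ?scale1r ?gt_eqF// scaleNr opprK.
        rewrite p_hom// -(ler_pM2l s0) mulrBr mulrA divff ?mul1r ?gt_eqF// => h.
        by move: h; lra.
      have := cU _ _ (scl _ _ t^-1 gxa).
      have Exv : E (t^-1 *: x + v).
        have [Es _] := gp _ _ (scl _ _ t^-1 gxa).
        by have := E_lin _ v 1 Es Ev; rewrite scale1r.
      have -> : x + t *: v = t *: (t^-1 *: x + v).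
        by rewrite scalerDr scalerA divff ?scale1r ?gt_eqF.
      rewrite p_hom// -(ler_pM2l t0) mulrBr mulrA divff ?mul1r ?gt_eqF// => h.
      by move: h; lra.
    - by move=> _; exact: subset_trans gg'.
  split => // sub; apply: nv; exists c; apply: sub.
  by exists 0, 0, 1; rewrite scale1r mul1r !add0r.
pose psi x := xget 0 [set a | g (x, a)].
have psiP x a : g (x, a) -> psi x = a.
  move=> gxa; have h : [set b | g (x, b)] (psi x) by apply: xgetPex; exists a.
  exact: (good_func g x _ _ gg h gxa).
exists psi; split.
- move=> x y s /total[a gxa] /total[b gyb].
  by rewrite (psiP _ _ gxa) (psiP _ _ gyb); apply: psiP; exact: gl.
- by move=> x /total[a gxa]; rewrite (psiP _ _ gxa); have [] := gp _ _ gxa.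
- by move=> x a /gB' gxa; exact: psiP.
Qed.

End HahnBanach.

(** * Functionals on L^1 of a finite measure *)

Section L1Duality.
Context {d} {T : measurableType d} {R : realType}.
Variables (mu : {measure set T -> \bar R}) (D : set T).
Hypotheses (mD : measurable D) (Doo : (mu D < +oo)%E).

Definition mbounded (u : T -> R) :=
  measurable_fun D u /\ exists M, forall x, D x -> `|u x| <= M.

Lemma mbounded_integrableM u h : mbounded u -> mu.-integrable D (EFin \o h) ->
  mu.-integrable D (EFin \o (fun x => u x * h x)).
Proof.
move=> [mu_ [M uM]] ih.
have [M0|M0] := leP 0 M; last first.
  have D0 : D = set0.
    by apply/seteqP; split=> // x /uM/(le_trans (normr_ge0 _)); rewrite leNgt M0.
  rewrite D0; exact: integrable_set0.
apply: (le_integrable mD _ _ (integrableZl mD M ih)).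
  apply/measurable_EFinP/measurable_funM => //.
  exact/measurable_EFinP/(measurable_int _ ih).
move=> x Dx; rewrite /= lee_fin !normrM [`|M|]ger0_norm//.
by rewrite ler_wpM2r// uM.
Qed.

Lemma integrable_cst_fin (k : R) : mu.-integrable D (EFin \o cst k).
Proof.
apply/integrableP; split; first exact/measurable_EFinP/measurable_cst.
rewrite (_ : (fun x => _) = cst `|k|%:E); last by apply/funext.
by rewrite integral_cst// lte_mul_pinfty// lee_fin.
Qed.

Lemma mbounded_integrable u : mbounded u -> mu.-integrable D (EFin \o u).
Proof.
move=> bu; have := mbounded_integrableM u (cst 1) bu (integrable_cst_fin 1).
by apply: eq_integrable => // x _; rewrite /= mulr1.
Qed.

Lemma mbounded_indic (A : set T) : measurable A -> mbounded \1_A.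
Proof.
move=> mA; split; first exact: measurable_indic.
by exists 1 => x _; rewrite indicE ger0_norm// lern1 leq_b1.
Qed.

Lemma Rintegral_indic (A : set T) : measurable A ->
  \int[mu]_(x in D) \1_A x = fine (mu (A `&` D)).
Proof. by move=> mA; rewrite /Rintegral integral_indic. Qed.

Variable L : (T -> R) -> R.
Hypotheses
  (L_lin : forall u v s, mu.-integrable D (EFin \o u) -> mu.-integrable D (EFin \o v) ->
     L (fun x => u x + s * v x) = L u + s * L v)
  (L_le : forall u, mu.-integrable D (EFin \o u) -> L u <= \int[mu]_(x in D) `|u x|).

Let L0 : L (fun=> 0) = 0.
Proof.
have i0 := integrable_cst_fin 0.
have := L_lin _ _ 1 i0 i0.
rewrite [X in L X = _](_ : _ = cst 0); last by apply/funext => x /=; rewrite mul1r addr0.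
by rewrite mul1r => e; change (L (cst 0) = 0); move: (L (cst 0)) e => a; lra.
Qed.

Let L_norm u : mu.-integrable D (EFin \o u) -> `|L u| <= \int[mu]_(x in D) `|u x|.
Proof.
move=> iu; have i0 := integrable_cst_fin 0.
have := L_lin _ _ (-1) i0 iu; rewrite [L (cst 0)]L0 add0r mulN1r => e.
have iNu : mu.-integrable D (EFin \o (fun x => cst 0 x + -1 * u x)).
  by apply: eq_integrable (integrableN iu) => // x _; rewrite /= add0r mulN1r.
have h := L_le _ iNu.
rewrite ler_norml L_le// andbT lerNl -e; apply: le_trans h _.
rewrite le_eqVlt; apply/orP; left; apply/eqP; apply: eq_Rintegral => x _.
by rewrite /= add0r mulN1r normrN.
Qed.

Let L_eq u v : mu.-integrable D (EFin \o u) -> mu.-integrable D (EFin \o v) ->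
  {in D, u =1 v} -> L u = L v.
Proof.
move=> iu iv uv; have := L_lin _ _ (-1) iu iv.
have iw : mu.-integrable D (EFin \o (fun x => u x + -1 * v x)).
  apply: eq_integrable (integrable_cst_fin 0) => // x xD.
  by rewrite /= uv// mulN1r subrr.
have := L_norm _ iw; rewrite (_ : \int[mu]_(x in D) _ = 0); last first.
  rewrite (_ : \int[mu]_(x in D) _ = \int[mu]_(x in D) (0 : R)).
    by rewrite Rintegral_cst// mul0r.
  by apply: eq_Rintegral => x xD; rewrite uv// mulN1r subrr normr0.
by rewrite normr_le0 => /eqP ->; rewrite mulN1r => e; lra.
Qed.

Let iI (A : set T) : measurable A -> mu.-integrable D (EFin \o (\1_A : T -> R)).
Proof. by move=> mA; apply: mbounded_integrable; exact: mbounded_indic. Qed.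

Definition indic_charge (A : set T) : \bar R := (L \1_A)%:E.

Let nuU (A B : set T) : measurable A -> measurable B -> A `&` B = set0 ->
  indic_charge (A `|` B) = (indic_charge A + indic_charge B)%E.
Proof.
move=> mA mB AB; rewrite /indic_charge -EFinD -[L \1_B]mul1r -L_lin; [|exact: iI|exact: iI].
congr (L _)%:E; apply/funext => x; rewrite !indicE mul1r in_setU.
have : ~ (A `&` B) x by rewrite AB.
case: (boolP (x \in A)) => /= [/set_mem Ax|_]; last by rewrite add0r.
case: (boolP (x \in B)) => /= [/set_mem Bx|_]; last by rewrite addr0.
by case.
Qed.

Let nu0 : indic_charge set0 = 0%E.
Proof. by rewrite /indic_charge indic0 [L _]L0. Qed.

Let nufin (A : set T) : measurable A -> indic_charge A \is a fin_num.
Proof. by []. Qed.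

Let nu_le (A : set T) : measurable A -> (`|indic_charge A| <= mfrestr mD Doo A)%E.
Proof.
move=> mA; have := L_norm _ (iI A mA).
rewrite (_ : \int[mu]_(x in D) _ = fine (mu (A `&` D))); last first.
  rewrite -Rintegral_indic//; apply: eq_Rintegral => x _.
  by rewrite ger0_norm// indicE.
rewrite /indic_charge /mfrestr /mrestr /= -lee_fin fineK// ge0_fin_numE//.
by apply: le_lt_trans Doo; apply: le_measure; rewrite ?inE//; exact: measurableI.
Qed.

(** By finite additivity the error of a partial union is the charge of the remainder, at most the
    measure of the remainder, which decreases to 0 because the measure is finite. *)
Let nu_semi_sigma_additive : semi_sigma_additive indic_charge.
Proof.
move=> F mF tF mUF.
pose U := \bigcup_n F n; pose Un n := \big[setU/set0]_(i < n) F i.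
have mUn n : measurable (Un n) by exact: bigsetU_measurable.
have UnU n : Un n `<=` U by exact: bigsetU_bigcup.
have sumE n : (\sum_(0 <= i < n) indic_charge (F i))%E = indic_charge (Un n).
  rewrite big_mkord; elim: n => [|n IH]; first by rewrite /Un !big_ord0 nu0.
  rewrite big_ord_recr /= IH /Un big_ord_recr /= nuU//; first exact: mUn.
  apply/seteqP; split => // x [Ux Fx].
  have [i /= ilt Fi] : (\bigcup_(i < n) F i) x by move: Ux; rewrite bigcup_mkord.
  by have := tF i n I I (ex_intro _ x (conj Fi Fx)) => e; move: ilt; rewrite e ltnn.
have splitU n : indic_charge U = (indic_charge (Un n) + indic_charge (U `\` Un n))%E.
  rewrite -nuU//; last 2 first.
  - exact: measurableD.
  - by apply/seteqP; split => // x [h [_]].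
  congr indic_charge; apply/seteqP; split => x.
    by move=> Ux; have [h|h] := pselect (Un n x); [left|right].
  by case => [|[]//]; exact: UnU.
have cap0 : \bigcap_n (U `\` Un n) = set0.
  apply/seteqP; split => // x h; have [[n _ Fx] _] := h 0%N I.
  have [_] := h n.+1 I; apply; rewrite /Un big_ord_recr; by right.
have cv : mfrestr mD Doo (U `\` Un n) @[n --> \oo] --> 0%E.
  rewrite -(measure0 (mfrestr mD Doo)) -cap0.
  apply: (@nonincreasing_cvg_mu _ _ _ (mfrestr mD Doo)) => //.
  - rewrite -ge0_fin_numE//; apply: fin_num_measure; exact: measurableD.
  - by move=> n; exact: measurableD.
  - by rewrite cap0.
  - move=> n m nm; apply/subsetPset => x [Ux nx]; split => // hx; apply: nx.
    by move: x hx {Ux}; exact: subset_bigsetU.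
have finm n : mfrestr mD Doo (U `\` Un n) \is a fin_num.
  by apply: fin_num_measure; exact: measurableD.
have cvR : fine (mfrestr mD Doo (U `\` Un n)) @[n --> \oo] --> (0 : R) by exact: fine_cvg cv.
rewrite (_ : (fun n => _) = (fun n => (L \1_(Un n))%:E)); last by apply/funext => n; rewrite sumE.
apply: cvg_EFin; first exact: nearW.
apply/cvgrPdist_le => e e0; move/cvgr0Pnorm_le : cvR => /(_ _ e0); apply: filterS => n.
apply: le_trans; rewrite /= -lee_fin.
have -> : L \1_U - L \1_(Un n) = L \1_(U `\` Un n).
  by have := splitU n; rewrite /indic_charge -EFinD => -[->]; rewrite addrAC subrr add0r.
rewrite [`|fine _|]ger0_norm ?fine_ge0// fineK//.
by apply: nu_le; exact: measurableD.
Qed.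

HB.instance Definition _ := isCharge.Build d T R indic_charge nu0 nufin nu_semi_sigma_additive.

Let dom : indic_charge `<< mfrestr mD Doo.
Proof.
apply/null_content_dominatesP => A mA A0; apply/eqP.
by have := nu_le A mA; rewrite [mfrestr _ _ _]A0 => h; rewrite -abse_eq0 eq_le h abse_ge0.
Qed.

Lemma indic_density : exists h : T -> R, mu.-integrable D (EFin \o h) /\
  forall A, measurable A -> L \1_A = \int[mu]_(x in D) (\1_A x * h x).
Proof.
pose RN := Radon_Nikodym indic_charge (mfrestr mD Doo).
have RNf x : RN x \is a fin_num by exact: Radon_Nikodym_fin_num.
have RNE : EFin \o (fine \o RN) = RN by apply/funext => x /=; rewrite fineK.
have mE (A : set T) : measurable A -> A `<=` D -> mfrestr mD Doo A = mu A.
  by move=> mA AD; rewrite /mfrestr /mrestr setIidl.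
have iRN : mu.-integrable D RN.
  have iT : (mfrestr mD Doo).-integrable D RN.
    by apply: integrableS (Radon_Nikodym_integrable dom).
  have [m1 f1] := integrableP _ _ _ iT.
  apply/integrableP; split => //.
  rewrite (eq_measure_integral (mfrestr mD Doo)) // => A mA AD.
  by rewrite /= mE.
exists (fine \o RN); rewrite RNE; split => // A mA.
have mAD := measurableI _ _ mA mD.
have -> : L \1_A = L \1_(A `&` D).
  apply: L_eq; [exact: iI|exact: iI|].
  by move=> x xD; rewrite !indicE in_setI xD andbT.
apply: EFin_inj; rewrite [LHS](Radon_Nikodym_integral dom mAD).
rewrite (eq_measure_integral mu); last by move=> B mB BAD; apply: mE => // x /BAD[].
rewrite setIC integral_mkcondr /Rintegral fineK; last first.
  apply: integrable_fin_num => //; apply: mbounded_integrableM; first exact: mbounded_indic.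
  by rewrite RNE.
apply: eq_integral => x _; rewrite patchE indicE EFinM /= fineK//.
by case: ifP => xA; rewrite ?mul1e ?mul0e.
Qed.

(** The sum counts the positive multiples of 1 / (n + 1) that do not exceed t, so it is the integer
    part of t (n + 1). *)
Lemma step_approx (t : R) (n : nat) : 0 <= t <= 1 ->
  0 <= t - n.+1%:R^-1 * \sum_(j < n.+1) ((j.+1%:R / n.+1%:R <= t)%R)%:R <= n.+1%:R^-1.
Proof.
move=> /andP[t0 t1]; have n0 : 0 < n.+1%:R :> R by rewrite ltr0n.
pose k := Num.truncn (t * n.+1%:R).
have tn0 : 0 <= t * n.+1%:R by rewrite mulr_ge0.
have /andP[k1 k2] := truncn_itv tn0.
have kn : (k <= n.+1)%N by rewrite -(ler_nat R); apply: (le_trans k1); rewrite ler_piMl.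
have -> : \sum_(j < n.+1) ((j.+1%:R / n.+1%:R <= t)%R)%:R = k%:R :> R.
  rewrite (eq_bigr (fun j : 'I_n.+1 => (j < k)%:R)) => [|j _]; last first.
    by rewrite ler_pdivrMr// -(truncn_ge_nat j.+1 tn0).
  clearbody k; move: kn; clear; elim: n.+1 k => [|m IH] l.
    by rewrite leqn0 => /eqP ->; rewrite big_ord0.
  rewrite leq_eqVlt => /orP[/eqP ->|].
    rewrite (eq_bigr (fun=> 1)) => [|j _]; last by rewrite ltn_ord.
    by rewrite sumr_const card_ord.
  rewrite ltnS => lm; rewrite big_ord_recr /= IH// ltnNge lm addr0//.
have e : t - n.+1%:R^-1 * k%:R = n.+1%:R^-1 * (t * n.+1%:R - k%:R).
  by rewrite mulrBr mulrCA mulVf ?mulr1// gt_eqF.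
rewrite e; apply/andP; split; first by rewrite mulr_ge0 ?invr_ge0 ?subr_ge0// ltW.
rewrite -[leRHS]mulr1; apply: ler_wpM2l; first by rewrite invr_ge0 ltW.
by rewrite lerBlDl natr1 ltW.
Qed.

(* By linearity it suffices to treat 0 <= u <= 1, which is a uniform limit of
   combinations of indicator functions. *)
Lemma L1_dual : exists h : T -> R, mu.-integrable D (EFin \o h) /\
  forall u, mbounded u -> L u = \int[mu]_(x in D) (u x * h x).
Proof.
have [h [ih hI]] := indic_density; exists h; split => //.
(* The defect of the representation: linear, and zero on indicators by the choice of [h]. *)
pose Phi u := L u - \int[mu]_(x in D) (u x * h x).
have PhiD u v s : mbounded u -> mbounded v ->
    Phi (fun x => u x + s * v x) = Phi u + s * Phi v.
  move=> bu bv; rewrite /Phi L_lin; [|exact: mbounded_integrable|exact: mbounded_integrable].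
  have iu := mbounded_integrableM _ _ bu ih; have iv := mbounded_integrableM _ _ bv ih.
  have isv : mu.-integrable D (EFin \o (fun x => s * (v x * h x))).
    by apply: eq_integrable (integrableZl mD s iv).
  rewrite (_ : \int[mu]_(x in D) ((u x + s * v x) * h x) =
      \int[mu]_(x in D) (u x * h x) + s * \int[mu]_(x in D) (v x * h x)); first by ring.
  rewrite -RintegralZl// -RintegralD//; apply: eq_Rintegral => x _; ring.
have bD u v s : mbounded u -> mbounded v -> mbounded (fun x => u x + s * v x).
  move=> [mu_ [M uM]] [mv [N vN]]; split.
    by apply: measurable_funD => //; apply: measurable_funM => //; exact: measurable_cst.
  exists (M + `|s| * N) => x Dx; apply: le_trans (ler_normD _ _) _.
  by apply: lerD; [exact: uM|rewrite normrM ler_wpM2l// vN].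
have b0 : mbounded (fun=> 0) by split; [exact: measurable_cst|exists 0 => x _; rewrite normr0].
have Phi0 : Phi (fun=> 0) = 0.
  have := PhiD _ _ 1 b0 b0; rewrite (_ : (fun x => 0 + 1 * 0) = (fun=> 0)); last first.
    by apply/funext => x; rewrite mulr0 addr0.
  by move: (Phi _) => a; lra.
have PhiI A : measurable A -> Phi \1_A = 0 by move=> mA; rewrite /Phi hI// subrr.
(* The norm of [Phi] for the uniform norm is at most [K]: the 1 accounts for [L] and |h| for the
   integral. *)
pose K := \int[mu]_(x in D) (1 + `|h x|).
have inh : mu.-integrable D (EFin \o (fun x => `|h x|)).
  by apply: eq_integrable (integrable_abse ih).
have iK : mu.-integrable D (EFin \o (fun x => 1 + `|h x|)).
  by apply: eq_integrable (integrableD mD (integrable_cst_fin 1) inh).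
have Phi_le u (e : R) : mbounded u -> (forall x, D x -> `|u x| <= e) -> `|Phi u| <= e * K.
  move=> bu ue; have iu := mbounded_integrable _ bu; have iuh := mbounded_integrableM _ _ bu ih.
  apply: le_trans (ler_normB _ _) _.
  apply: le_trans (lerD (L_norm _ iu) (le_normr_Rintegral mD iuh)) _.
  have iu' : mu.-integrable D (EFin \o (fun x => `|u x|)) by apply: eq_integrable (integrable_abse iu).
  have iuh' : mu.-integrable D (EFin \o (fun x => `|u x * h x|)) by apply: eq_integrable (integrable_abse iuh).
  rewrite -RintegralD// -RintegralZl//; apply: le_Rintegral => //.
  - by apply: eq_integrable (integrableD mD iu' iuh').
  - by apply: eq_integrable (integrableZl mD e iK).
  - by move=> x Dx; rewrite normrM mulrDr mulr1 lerD ?ler_wpM2r// ue.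
have key u : mbounded u -> (forall x, D x -> 0 <= u x <= 1) -> Phi u = 0.
  move=> bu u01.
  (* These superlevel sets make the average of their indicators the step function of [step_approx]
     applied to [u x]. *)
  pose A n j : set T := D `&` [set x | j.+1%:R / n.+1%:R <= u x].
  have mA n j : measurable (A n j).
    have m : measurable [set y : R | j.+1%:R / n.+1%:R <= y].
      by rewrite -set_itvcy; exact: measurable_itv.
    exact: bu.1 mD _ m.
  have sE n m : mbounded (fun x => \sum_(j < m) \1_(A n j) x) /\
      Phi (fun x => \sum_(j < m) \1_(A n j) x) = 0.
    elim: m => [|m [IH1 IH2]].
      by rewrite (_ : (fun x => _) = (fun=> 0)); [|apply/funext => x; rewrite big_ord0].
    rewrite (_ : (fun x => _) = (fun x => \sum_(j < m) \1_(A n j) x + 1 * \1_(A n m) x)); last first.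
      by apply/funext => x; rewrite big_ord_recr /= mul1r.
    have bA := mbounded_indic _ (mA n m).
    by split; [exact: bD|rewrite PhiD// IH2 PhiI// mulr0 addr0].
  have le n : `|Phi u| <= n.+1%:R^-1 * K.
    have [b1 e1] := sE n n.+1; have := PhiD _ _ (- n.+1%:R^-1) bu b1.
    rewrite e1 mulr0 addr0 => <-; apply: Phi_le; first exact: bD.
    move=> x Dx; have := step_approx (u x) n (u01 x Dx).
    rewrite mulNr (eq_bigr (fun j : 'I_n.+1 => \1_(A n j) x)) => [/andP[h0 h1]|j _].
      by rewrite ger0_norm.
    by rewrite indicE /A in_setI mem_set//= mem_setE.
  apply/eqP; rewrite -normr_le0; apply/ler_addgt0Pr => e e0; rewrite add0r.
  have cv : n.+1%:R^-1 * K @[n --> \oo] --> (0 : R).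
    by rewrite -[X in _ --> X](mul0r K); apply: cvgM; [exact: cvg_harmonic|exact: cvg_cst].
  move/cvgr0Pnorm_le : cv => /(_ _ e0)[n _ /(_ n (leqnn n)) hn].
  by apply: le_trans (le n) (le_trans (ler_norm _) hn).
move=> u bu; apply/eqP; rewrite -subr_eq0; apply/eqP; rewrite -/(Phi u).
have [mu_ [M uM]] := bu; pose N := `|M| + 1.
have N0 : 0 < N by rewrite /N ltr_wpDl.
(* An affine change that brings values in [-N, N] into [0, 1]; the 1 in [N] avoids division by 0. *)
pose v x := (2 * N)^-1 * N + (2 * N)^-1 * u x.
have b1 k : mbounded (fun=> k) by split; [exact: measurable_cst|exists `|k|].
have bv : mbounded v by exact: (bD (fun=> _) u _ (b1 _) bu).
have Pv : Phi v = 0.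
  apply: key => // x Dx; have := uM x Dx; rewrite ler_norml => /andP[h1 h2].
  have h3 := ler_norm M.
  have N2 : 0 < 2 * N by rewrite mulr_gt0.
  rewrite /v -mulrDr; apply/andP; split.
    by rewrite mulr_ge0 ?invr_ge0 ?(ltW N2)//; rewrite /N; lra.
  by rewrite mulrC ler_pdivrMr// mul1r /N; lra.
have P1 : Phi (fun=> 1) = 0.
  by apply: key => // x _; rewrite ler01 lexx.
have PN : Phi (fun=> - N) = 0.
  rewrite (_ : (fun=> - N) = (fun x => 0 + (- N) * 1)); last first.
    by apply/funext => x; rewrite add0r mulr1.
  by rewrite (PhiD (fun=> 0) (fun=> 1))// Phi0 P1 mulr0 addr0.
have -> : u = (fun x => - N + (2 * N) * v x).
  apply/funext => x; rewrite /v; have : N != 0 by rewrite gt_eqF.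
  by move=> Nn; field.
by rewrite (PhiD (fun=> - N) v)// Pv PN mulr0 addr0.
Qed.

End L1Duality.

Section AeEq.
Context {d} {T : measurableType d} {R : realType}.
Variables (mu : {measure set T -> \bar R}) (D : set T).
Hypothesis mD : measurable D.
Implicit Types f g : T -> R[i].

Lemma ae_eq_cint f g : cmeasurable D f -> cmeasurable D g ->
  (\forall x \ae mu, D x -> f x = g x) -> cint mu D f = cint mu D g.
Proof.
move=> [f1 f2] [g1 g2] fg; apply: complex_ext => /=; rewrite /Rintegral; congr fine;
  (apply: ae_eq_integral => //; [exact/measurable_EFinP|exact/measurable_EFinP|
   by apply: filterS fg => x h Dx /=; rewrite h]).
Qed.

End AeEq.

(** * Bounded solutions of the moment problem *)

Section MomentProblem.
Context {R : realType}.
Local Notation C := R[i].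
Local Notation P := (measurableTypeR R * measurableTypeR R)%type.
Local Notation dA := (@dA R).
Local Notation D := (@plane_disk R).

Let mD : measurable D. Proof. exact: measurable_plane_disk. Qed.
Let Doo : (dA D < +oo)%E. Proof. by rewrite dA_disk ltry. Qed.

Lemma sum_trunc (F : nat -> C) n N : (n <= N)%N ->
  \sum_(k < N) (if (k < n)%N then F k else 0) = \sum_(k < n) F k.
Proof. by move=> nN; rewrite [RHS](big_ord_widen N F nN) [RHS]big_mkcond. Qed.

(** A complex function is held as the pair of its parts: the extension theorem is real, and each
    component will give a functional on real L^1. *)
Let V : lmodType R := ((P -> R^o) * (P -> R^o))%type.
Let cplx (u : V) (p : P) : C := (u.1 p : R) +i* (u.2 p : R).
Let E : set V := [set u | cintegrable dA D (cplx u)].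
Let nrm (u : V) : R := \int[dA]_(p in D) cnorm (cplx u p).

Let cplx_lin u v s p : cplx (u + s *: v) p = cplx u p + s%:C * cplx v p.
Proof. by apply: complex_ext; rewrite ?ReD ?ImD ?ReM ?ImM /= mul0r ?subr0 ?addr0. Qed.

Let E_lin u v s : E u -> E v -> E (u + s *: v).
Proof.
move=> Eu Ev; have h := cintegrableD _ _ mD _ _ Eu (cintegrableZ _ _ mD s%:C _ Ev).
by apply: eq_cintegrable h => // p _; rewrite cplx_lin.
Qed.

Let nrm_add u v : E u -> E v -> nrm (u + v) <= nrm u + nrm v.
Proof.
move=> Eu Ev; have iu := cintegrable_norm _ _ mD _ Eu; have iv := cintegrable_norm _ _ mD _ Ev.
rewrite /nrm -(RintegralD mD iu iv); apply: le_Rintegral => //.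
- have := E_lin u v 1 Eu Ev; rewrite scale1r => h; exact: (cintegrable_norm _ _ mD _ h).
- by apply: eq_integrable (integrableD mD iu iv).
- move=> p _; have := cplx_lin u v 1 p; rewrite scale1r mul1r => ->; exact: cnormD.
Qed.

Let nrm_hom s u : 0 < s -> E u -> nrm (s *: u) = s * nrm u.
Proof.
move=> s0 Eu; have iu := cintegrable_norm _ _ mD _ Eu.
rewrite /nrm -RintegralZl//; apply: eq_Rintegral => p _.
have := cplx_lin 0 u s p; rewrite add0r => ->.
by rewrite (_ : cplx 0 p = 0)// add0r cnormM cnormR gtr0_norm.
Qed.

Variable m : nat -> C.
Hypothesis m_le : forall n (c : nat -> C),
  cnorm (\sum_(k < n) m k * conjc (c k)) <=
  \int[dA]_(p in D) cnorm (\sum_(k < n) c k * of_plane p ^+ k).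

Let poly n (c : nat -> C) (p : P) : C := \sum_(k < n) c k * of_plane p ^+ k.
Let pr (f : P -> C) : V := (fun p => complex.Re (f p), fun p => complex.Im (f p)).
Let cplx_pr f p : cplx (pr f) p = f p. Proof. by rewrite /cplx /=; case: (f p). Qed.

(** The graph of the real part of the functional on polynomials. As a relation it needs no proof
    that a polynomial function determines its coefficients; single-valuedness follows from
    [B_le]. *)
Let B : set (V * R) := [set z | exists n c,
  z = (pr (poly n c), complex.Re (\sum_(k < n) m k * conjc (c k)))].

Let poly_integrable n c : cintegrable dA D (poly n c).
Proof.
apply: cintegrable_sum => // k; apply: cintegrableZ => //.
by apply: eq_cintegrable (dintegrable_mono k 0) => // p _; rewrite /= /mono expr0 mulr1.
Qed.

Let B_lin : linear_graph B.
Proof.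
move=> _ _ _ _ s [n [c [-> ->]]] [n' [c' [-> ->]]].
pose t n (c : nat -> C) k := if (k < n)%N then c k else 0.
exists (maxn n n'), (fun k => t n c k + s%:C * t n' c' k).
have tS (F : nat -> C -> C) n1 c1 : (forall k, F k 0 = 0) -> (n1 <= maxn n n')%N ->
    \sum_(k < maxn n n') F k (t n1 c1 k) = \sum_(k < n1) F k (c1 k).
  move=> F0 h; rewrite -(sum_trunc (fun k => F k (c1 k)) _ _ h); apply: eq_bigr => k _.
  by rewrite /t; case: ifP.
have pE p : poly (maxn n n') (fun k => t n c k + s%:C * t n' c' k) p =
    poly n c p + s%:C * poly n' c' p.
  rewrite /poly -(tS (fun k x => x * of_plane p ^+ k) n c) ?leq_maxl//; last by move=> k; rewrite mul0r.
  rewrite -(tS (fun k x => x * of_plane p ^+ k) n' c') ?leq_maxr//; last by move=> k; rewrite mul0r.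
  by rewrite mulr_sumr -big_split; apply: eq_bigr => k _; rewrite mulrDl mulrA.
congr pair.
  by congr pair; apply/funext => p /=; rewrite pE ?ReD ?ImD ?ReM ?ImM /= mul0r ?subr0 ?addr0.
rewrite -(tS (fun k x => m k * conjc x) n c) ?leq_maxl//; last by move=> k; rewrite rmorph0 mulr0.
rewrite -(tS (fun k x => m k * conjc x) n' c') ?leq_maxr//; last by move=> k; rewrite rmorph0 mulr0.
have -> (x : C) : s * complex.Re x = complex.Re (s%:C * x) by rewrite ReM /= mul0r subr0.
rewrite -ReD mulr_sumr -big_split; congr complex.Re; apply: eq_bigr => k _.
rewrite conjcD conjcM mulrDr; congr (_ + _).
have -> : conjc s%:C = s%:C by apply: complex_ext; rewrite ?ReJ ?ImJ /= ?oppr0.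
exact: mulrCA.
Qed.

Let B_le u a : B (u, a) -> E u /\ a <= nrm u.
Proof.
move=> [n [c [-> ->]]]; split.
  by apply: eq_cintegrable (poly_integrable n c) => // p _; rewrite cplx_pr.
apply: le_trans (ler_norm _) _; apply: le_trans (Re_le_cnorm _) _.
apply: le_trans (m_le n c) _; rewrite le_eqVlt; apply/orP; left; apply/eqP.
by apply: eq_Rintegral => p _; rewrite cplx_pr.
Qed.

Let B0 : B (0, 0).
Proof.
exists 0%N, (fun=> 0); rewrite big_ord0; congr (_, _); congr (_, _).
  by apply/funext => p; rewrite /poly big_ord0.
by apply/funext => p; rewrite /poly big_ord0.
Qed.

(** The restrictions of the extension to purely real and purely imaginary functions have densities
    h1 and h2. As Re (u conj H) = Re u h1 + Im u h2 for H = h1 + 'i h2, this [H] represents the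
    whole functional on bounded functions. *)
Let density : exists H : P -> C, cintegrable dA D H /\
  (forall u, cmeasurable D u -> (exists M, forall p, D p -> cnorm (u p) <= M) ->
    complex.Re (cint dA D (fun p => u p * conjc (H p))) <=
      \int[dA]_(p in D) cnorm (u p)) /\
  forall n c, complex.Re (cint dA D (fun p => poly n c p * conjc (H p))) =
    complex.Re (\sum_(k < n) m k * conjc (c k)).
Proof.
have [psi [psi_lin psi_le psiB]] := hahn_banach_graph E nrm E_lin nrm_add nrm_hom B B_lin B_le B0.
pose inl (u : P -> R) : V := (u : P -> R^o, 0); pose inr (u : P -> R) : V := (0, u : P -> R^o).
have i0 : dA.-integrable D (EFin \o (fun=> 0 : R)) by exact: integrable_cst_disk.
have Einl u : dA.-integrable D (EFin \o u) -> E (inl u) by move=> iu; split.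
have Einr u : dA.-integrable D (EFin \o u) -> E (inr u) by move=> iu; split.
have inl_lin u v s : inl (fun p => u p + s * v p) = inl u + s *: inl v.
  by apply: injective_projections => //=; rewrite scaler0 addr0.
have inr_lin u v s : inr (fun p => u p + s * v p) = inr u + s *: inr v.
  by apply: injective_projections => //=; rewrite scaler0 addr0.
have linl u v s : dA.-integrable D (EFin \o u) -> dA.-integrable D (EFin \o v) ->
    (psi \o inl) (fun p => u p + s * v p) = (psi \o inl) u + s * (psi \o inl) v.
  by move=> iu iv; rewrite /= inl_lin psi_lin//.
have linr u v s : dA.-integrable D (EFin \o u) -> dA.-integrable D (EFin \o v) ->
    (psi \o inr) (fun p => u p + s * v p) = (psi \o inr) u + s * (psi \o inr) v.
  by move=> iu iv; rewrite /= inr_lin psi_lin//.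
have lel u : dA.-integrable D (EFin \o u) -> (psi \o inl) u <= \int[dA]_(p in D) `|u p|.
  move=> iu; apply: le_trans (psi_le _ (Einl _ iu)) _; rewrite le_eqVlt; apply/orP; left; apply/eqP.
  by apply: eq_Rintegral => p _; rewrite cnormE /= expr0n addr0 sqrtr_sqr.
have ler u : dA.-integrable D (EFin \o u) -> (psi \o inr) u <= \int[dA]_(p in D) `|u p|.
  move=> iu; apply: le_trans (psi_le _ (Einr _ iu)) _; rewrite le_eqVlt; apply/orP; left; apply/eqP.
  by apply: eq_Rintegral => p _; rewrite cnormE /= expr0n add0r sqrtr_sqr.
have [h1 [ih1 h1E]] := L1_dual dA D mD Doo (psi \o inl) linl lel.
have [h2 [ih2 h2E]] := L1_dual dA D mD Doo (psi \o inr) linr ler.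
pose H p : C := h1 p +i* h2 p.
have iH : cintegrable dA D H by split.
have psiE u : cmeasurable D u -> (exists M, forall p, D p -> cnorm (u p) <= M) ->
    psi (pr u) = complex.Re (cint dA D (fun p => u p * conjc (H p))).
  move=> mu_ [M uM].
  have b1 : mbounded D (fun p => complex.Re (u p)).
    by split; [exact: mu_.1|exists M => p /uM; apply: le_trans; exact: Re_le_cnorm].
  have b2 : mbounded D (fun p => complex.Im (u p)).
    by split; [exact: mu_.2|exists M => p /uM; apply: le_trans; exact: Im_le_cnorm].
  have ib1 := mbounded_integrable _ _ mD Doo _ b1; have ib2 := mbounded_integrable _ _ mD Doo _ b2.
  have -> : psi (pr u) = psi (inl (fun p => complex.Re (u p))) + 1 * psi (inr (fun p => complex.Im (u p))).
    rewrite -psi_lin; [|exact: Einl|exact: Einr].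
    by rewrite scale1r; congr psi; congr (_, _); rewrite ?addr0 ?add0r.
  rewrite mul1r [psi _](h1E _ b1) [psi (inr _)](h2E _ b2) -RintegralD//; last 2 first.
  - exact: mbounded_integrableM.
  - exact: mbounded_integrableM.
  by apply: eq_Rintegral => p _; rewrite ReM /= mulrN opprK.
exists H; split=> //; split.
  move=> u mu_ bu; rewrite -psiE//; have [M uM] := bu.
  have Eu : E (pr u).
    apply: (cintegrable_le _ _ mD _ (cst M)) => //.
      exact: integrable_cst_disk.
    by move=> p pD; rewrite cplx_pr uM.
  apply: le_trans (psi_le _ Eu) _; rewrite le_eqVlt; apply/orP; left; apply/eqP.
  by apply: eq_Rintegral => p _; rewrite cplx_pr.
move=> n c; rewrite -psiE.
- by apply: psiB; exists n, c.
- exact: cintegrable_measurable (poly_integrable n c).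
- exists (\sum_(k < n) cnorm (c k)) => p pD; apply: le_trans (cnorm_sum _ _ _ _) _.
  apply: ler_sum => k _; rewrite cnormM cnormX ler_piMr ?cnorm_ge0//.
  by rewrite exprn_ile1 ?cnorm_ge0// ltW.
Qed.

Lemma moment_problem : exists mu : C -> C,
  [/\ dmeasurable mu, forall z, cnorm (mu z) <= 1 &
      forall k, dint (fun z => mu z * conjc z ^+ k) = m k].
Proof.
have [H [iH [Htest Hpoly]]] := density.
have mH := cintegrable_measurable _ _ _ iH.
have mN := measurable_cnorm _ _ mH.
pose G : set P := D `&` [set p | cnorm (H p) <= 1].
pose bad : set P := D `&` [set p | 1 < cnorm (H p)].
have mG : measurable G.
  have h : measurable [set y : R | y <= 1] by rewrite -set_itvNyc; exact: measurable_itv.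
  exact: mN mD _ h.
have mbad : measurable bad.
  have h : measurable [set y : R | 1 < y] by rewrite -set_itvoy; exact: measurable_itv.
  exact: mN mD _ h.
have cR (r : P -> R) : measurable_fun D r -> cmeasurable D (fun p => (r p)%:C : C).
  by move=> mr; split => //; exact: measurable_cst.
have mI (A : set P) : measurable A -> measurable_fun D (\1_A : P -> R).
  by move=> mA; exact: measurable_indic.
(* The test function [u] = r H is the phase of [H] on the set where |H| > 1 and 0 elsewhere. The
   power -1 stands for the inverse, so that measurability is that of [powR]. *)
pose r p : R := \1_bad p * cnorm (H p) `^ (-1).
have mr : measurable_fun D r.
  by apply: measurable_funM; [exact: mI|exact: (measurableT_comp (@measurable_powR R (-1)) mN)].
pose u p : C := (r p)%:C * H p.
have mu_ : cmeasurable D u by apply: cmeasurableM => //; exact: cR.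
have uN p : cnorm (u p) = \1_bad p.
  rewrite /u cnormM cnormR /r powR_inv1 ?cnorm_ge0// indicE.
  have [/set_mem[_ /= H1]|_] := boolP (p \in bad); last by rewrite mul0r normr0 mul0r.
  have H0 : 0 < cnorm (H p) by exact: lt_trans H1.
  by rewrite mul1r ger0_norm ?invr_ge0 ?cnorm_ge0// mulVf// gt_eqF.
have uH p : complex.Re (u p * conjc (H p)) = \1_bad p * cnorm (H p).
  rewrite /u -mulrA mulcJ ReM /= mul0r subr0 /r powR_inv1 ?cnorm_ge0// indicE.
  have [/set_mem[_ /= H1]|_] := boolP (p \in bad); last by rewrite !mul0r.
  have H0 : 0 < cnorm (H p) by exact: lt_trans H1.
  by rewrite !mul1r expr2 mulKf// gt_eqF.
have bu : exists M, forall p, D p -> cnorm (u p) <= M.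
  by exists 1 => p _; rewrite uN indicE lern1 leq_b1.
have test := Htest u mu_ bu.
have iN := cintegrable_norm _ _ mD _ iH.
have b1 : mbounded D (\1_bad : P -> R) by exact: mbounded_indic.
have i1 := mbounded_integrable dA D mD Doo _ b1.
have i2 := mbounded_integrableM dA D mD _ _ b1 iN.
(* Testing shows that |H| integrates over [bad] to at most the measure of [bad]. So [k], which is
   positive exactly on [bad], has integral 0 and [bad] is null. *)
pose k p : R := \1_bad p * cnorm (H p) - \1_bad p.
have ik : dA.-integrable D (EFin \o k) by apply: eq_integrable (integrableB mD i2 i1).
have k0 p : 0 <= k p.
  rewrite /k indicE; have [/set_mem[_ /= H1]|_] := boolP (p \in bad); last by rewrite mul0r subr0.
  by rewrite mul1r subr_ge0 ltW.
have kI : \int[dA]_(p in D) k p = 0.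
  apply/eqP; rewrite eq_le; apply/andP; split; last by apply: Rintegral_ge0 => p _; exact: k0.
  rewrite (RintegralB mD i2 i1) subr_le0.
  move: test; rewrite [complex.Re _](_ : _ = \int[dA]_(p in D) (\1_bad p * cnorm (H p))); last first.
    by apply: eq_Rintegral => p _; exact: uH.
  have -> : \int[dA]_(p in D) cnorm (u p) = \int[dA]_(p in D) \1_bad p.
    by apply: eq_Rintegral => p _; exact: uN.
  exact.
have kae : ae_eq dA D (EFin \o k) (cst 0%E).
  apply/(ae_eq_integral_abs dA mD (measurable_int _ ik)).
  have e : (\int[dA]_(p in D) `|(EFin \o k) p| = \int[dA]_(p in D) (k p)%:E)%E.
    by apply: eq_integral => p _; rewrite /= ger0_norm.
  by rewrite e -[LHS]fineK ?integrable_fin_num// [fine _]kI.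
pose to_plane (z : C) : P := (complex.Re z, complex.Im z).
have toK p : to_plane (of_plane p) = p by case: p.
(* Cutting [H] off outside [G] gives the bound 1 everywhere and changes [H] on the disk only on the
   null set [bad]. *)
pose mu z := (\1_G (to_plane z))%:C * H (to_plane z).
have muE p : mu (of_plane p) = (\1_G p)%:C * H p by rewrite /mu toK.
have mmu : dmeasurable mu.
  rewrite /dmeasurable (_ : mu \o _ = fun p => (\1_G p)%:C * H p); last by apply/funext.
  by apply: cmeasurableM => //; apply: cR; exact: mI.
have mu1 z : cnorm (mu z) <= 1.
  rewrite /mu; move: (to_plane z) => p; rewrite cnormM cnormR indicE.
  by have [/set_mem[_ /= H1]|_] := boolP (p \in G); rewrite ?normr1 ?mul1r// normr0 mul0r.
exists mu; split => // j.
pose X := dint (fun z => mu z * conjc z ^+ j).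
have mz : cmeasurable D (fun p : P => conjc (of_plane p) ^+ j : C).
  by apply: cmeasurableX; apply: cmeasurableJ; exact: cmeasurable_of_plane.
have XE : X = cint dA D (fun p => H p * conjc (of_plane p) ^+ j).
  apply: ae_eq_cint => //; first exact: cmeasurableM.
    exact: cmeasurableM.
  apply: filterS kae => p kp pD; have := kp pD; rewrite /= muE => -[].
  rewrite /k !indicE; have [/set_mem[_ /= H1]|nb] := boolP (p \in bad).
    by rewrite mul1r => /eqP; rewrite subr_eq0 gt_eqF.
  move=> _; rewrite (_ : p \in G) ?mul1r//.
  apply/mem_set; split => //=; rewrite leNgt; apply: contra nb => h; exact/mem_set.
have iX : cintegrable dA D (fun p => H p * conjc (of_plane p) ^+ j).
  apply: eq_cintegrable (cintegrableM_bounded dA D mD (fun p => conjc (of_plane p) ^+ j) H 1 mz _ iH) => //.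
    by move=> p _; rewrite mulrC.
  by move=> p pD; rewrite cnormX cnormJ exprn_ile1 ?cnorm_ge0// ltW.
(* Only real parts are controlled by [density]; the monomials c0 z^j with c0 = 1 and c0 = 'i recover
   both parts of the moment. *)
have key (c0 : C) : complex.Re (conjc c0 * X) = complex.Re (conjc c0 * m j).
  have h := Hpoly j.+1 (fun k => if k == j then c0 else 0).
  have e : \sum_(k < j.+1) m k * conjc (if (k : nat) == j then c0 else 0) = conjc c0 * m j.
    rewrite big_ord_recr /= eqxx big1 ?add0r 1?mulrC// => i _.
    by rewrite ltn_eqF// rmorph0 mulr0.
  rewrite e in h; rewrite -h.
  have -> : conjc c0 * X = conjc (cint dA D (fun p => c0 * of_plane p ^+ j * conjc (H p))).
    rewrite XE -cintZ// -cintJ//; last first.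
      apply: eq_cintegrable (cintegrableJ _ _ mD _ (cintegrableZ _ _ mD (conjc c0) _ iX)) => // p _.
      by rewrite !conjcM conjcX !conjcK mulrCA mulrC.
    apply: eq_cint => p _; rewrite !conjcM conjcX conjcK; ring.
  rewrite ReJ; congr (complex.Re _); apply: eq_cint => p _; congr (_ * _).
  by rewrite /poly big_ord_recr /= eqxx big1 ?add0r// => i _; rewrite ltn_eqF// mul0r.
have := key 'i; have := key 1; rewrite !ReM !ReJ !ImJ /= !(mul0r, mul1r, subr0, sub0r, oppr0) => e1 e2.
by apply: complex_ext; [exact: e1|move: e2; rewrite !mulN1r !opprK].
Qed.

End MomentProblem.

(** * Multiplication operators and their moments *)

Section ScrQ.
Context {R : realType}.
Local Notation C := R[i].
Local Notation P := (measurableTypeR R * measurableTypeR R)%type.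
Local Notation dA := (@dA R).
Local Notation D := (@plane_disk R).
Implicit Types (f g h : C -> C) (z w u : C).

Let mD : measurable D. Proof. exact: measurable_plane_disk. Qed.

Lemma cmeasurable_clip (H : P -> C) : cmeasurable D H ->
  cmeasurable D (fun p => if cnorm (H p) <= 1 then H p else 0).
Proof.
move=> mH; have mN := measurable_cnorm _ _ mH.
pose G : set P := D `&` [set p | cnorm (H p) <= 1].
have mG : measurable G.
  have h : measurable [set y : R | y <= 1] by rewrite -set_itvNyc; exact: measurable_itv.
  exact: mN mD _ h.
have e : {in D, (fun p => (\1_G p)%:C * H p) =1 (fun p => if cnorm (H p) <= 1 then H p else 0)}.
  move=> p /set_mem Dp; rewrite indicE; have [h|h] := boolP (cnorm (H p) <= 1).
    by rewrite (_ : p \in G) ?mul1r//; apply/mem_set.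
  rewrite (_ : p \in G = false) ?mul0r//; apply/negbTE/negP => /set_mem[_].
  exact/negP.
have [h1 h2] : cmeasurable D (fun p => (\1_G p)%:C * H p).
  apply: cmeasurableM => //; split; last exact: measurable_cst.
  exact: measurable_indic.
split; [apply: eq_measurable_fun h1|apply: eq_measurable_fun h2];
  by move=> p Dp /=; rewrite e.
Qed.

(** The essential bound means |mu| <= 1 almost everywhere on the disk; setting [mu] to 0 elsewhere
    gives a pointwise bound and leaves integrals unchanged. *)
Lemma Linfty_ball_representative (mu : C -> C) : Linfty_closed_unit_ball mu ->
  exists nu : C -> C, [/\ dmeasurable nu, forall z, cnorm (nu z) <= 1 &
    forall h, dmeasurable h -> dint (fun z => mu z * h z) = dint (fun z => nu z * h z)].
Proof.
move=> [mmu mule]; exists (fun z => if cnorm (mu z) <= 1 then mu z else 0).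
have m2 : dmeasurable (fun z => if cnorm (mu z) <= 1 then mu z else 0).
  exact: (cmeasurable_clip (mu \o of_plane)).
split=> // [z|h mh]; first by case: ifP => // _; rewrite cnorm0.
apply: ae_eq_cint => //; [exact: cmeasurableM|exact: cmeasurableM|].
move: mule; rewrite /Linfty_norm Lnorm.unlock; case: ifP => [_|/negbT].
  move/ess_supP; apply: filterS => p /= hp Dp; congr (_ * _).
  by move: hp; rewrite patchE mem_set//= lee_fin ger0_norm ?cnorm_ge0// => ->.
(* The remaining case of the L^oo norm concerns a space of measure 0, but the disk alone has mass
   1. *)
move=> h0; exfalso; move: h0; rewrite -leNgt => h0.
have : (dA D <= dA [set: P])%E by apply: le_measure; rewrite ?inE.
by rewrite dA_disk leNgt (le_lt_trans h0)// lte01.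
Qed.

Lemma Linfty_ball_of_bound (mu : C -> C) : dmeasurable mu -> (forall z, cnorm (mu z) <= 1) ->
  Linfty_closed_unit_ball mu.
Proof.
move=> mmu mu1; split => //; rewrite /Linfty_norm Lnorm.unlock; case: ifP => // _.
apply/ess_supP; apply: aeW => p /=; rewrite patchE; case: ifP => _.
  by rewrite /= lee_fin ger0_norm ?cnorm_ge0.
by rewrite /= normr0 lee_fin ler01.
Qed.

(** Serves to identify [diag Q], which is 0 at the origin, with the sum of its power series, which
    is m_0 there. *)
Lemma ae_neq0 : \forall p \ae dA, of_plane p != 0.
Proof.
exists ([set 0] `*` [set 0]); split.
- by apply: measurableX; exact: measurable_set1.
- have -> : dA ([set 0] `*` [set 0]) = ((pi^-1)%:E * (@lebesgue_measure R \x @lebesgue_measure R) ([set 0%R] `*` [set 0%R]))%E.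
    by [].
  have l0 : (@lebesgue_measure R) [set 0%R] = 0%E by exact: lebesgue_measure_set1.
  have -> : (@lebesgue_measure R \x @lebesgue_measure R)%E ([set 0%R] `*` [set 0%R]) = 0%E.
    apply: etrans (product_measure1E _ _ _ _) _; [exact: measurable_set1|exact: measurable_set1|].
    by apply: etrans (congr2 mule l0 l0) _; rewrite mule0.
  by rewrite mule0.
- move=> p /= /negP; rewrite negbK => /eqP h; split => /=.
    by have := congr1 (@complex.Re R) h.
  by have := congr1 (@complex.Im R) h.
Qed.

Definition szego_int h (z : C) : C := dint (fun u => h u * conjc (szego z u)).

Lemma conjc_szego (z u : C) : conjc (szego z u) = (1 - z * conjc u)^-1.
Proof.
have e (x : C) : conjc x^-1 = (conjc x)^-1 by exact: fmorphV.
by rewrite /szego conj_conjc e conjcB conjcM conjcK (rmorph1 (@conjc R)).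
Qed.

Lemma conjc_disk (z : C) : cnorm z < 1 -> cnorm (conjc z) < 1.
Proof. by rewrite cnormJ. Qed.

Lemma szego_int_series h z : dintegrable h -> cnorm z < 1 ->
  dintegrable (fun u => h u * conjc (szego z u)) /\
  cnorm (\sum_(j < n) z ^+ j * dint (fun u => h u * conjc u ^+ j) - szego_int h z)
    @[n --> \oo] --> (0 : R).
Proof.
move=> ih z1; have [i s] := pairing_dilate h _ _ (conjc z) ih geo_taylor (conjc_disk z z1).
split; first exact: i.
apply: (squeeze0 _ _ _ _ s) => n; first exact: cnorm_ge0.
rewrite le_eqVlt; apply/orP; left; apply/eqP; congr (cnorm (_ - _)).
by apply: eq_bigr => j _; rewrite mul1r -conjcX conjcK.
Qed.

Lemma one_subM_neq0 (z u : C) : cnorm z < 1 -> cnorm u < 1 -> 1 - z * conjc u != 0.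
Proof.
move=> z1 u1; rewrite subr_eq0; apply/eqP => e.
have : cnorm (z * conjc u) < 1.
  rewrite cnormM cnormJ; apply: le_lt_trans z1.
  by rewrite ler_piMr ?cnorm_ge0// ltW.
by rewrite -e cnorm1 ltxx.
Qed.

(* Partial fractions: z/(1-zt) - w/(1-wt) = (z-w)/((1-zt)(1-wt)). *)
Lemma scrQ_offdiag h z w : dintegrable h -> cnorm z < 1 -> cnorm w < 1 ->
  (z - w) * scrQ (mul_op h) z w = z * w * (z * szego_int h z - w * szego_int h w).
Proof.
move=> ih z1 w1.
have [iz _] := szego_int_series h z ih z1; have [iw _] := szego_int_series h w ih w1.
have -> : scrQ (mul_op h) z w =
    z * w * dint (fun u => h u * conjc (szego w u) * conjc (szego z u)) by [].
rewrite mulrCA; congr (_ * _).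
have e : z * szego_int h z - w * szego_int h w =
    dint (fun u => z * (h u * conjc (szego z u)) - w * (h u * conjc (szego w u))).
  rewrite /szego_int /dint -!cintZ// -cintB//; exact: cintegrableZ.
rewrite e.
have [zw|zw] := eqVneq z w.
  rewrite zw subrr mul0r; apply/esym; transitivity (cint dA D (fun=> 0 : C)); last exact: cint0.
  apply: eq_cint => p _.
  by rewrite /= subrr.
have zw' : z - w != 0 by rewrite subr_eq0.
have pt (u : C) : cnorm u < 1 -> h u * conjc (szego w u) * conjc (szego z u) =
    (z - w)^-1 * (z * (h u * conjc (szego z u)) - w * (h u * conjc (szego w u))).
  move=> u1; have := one_subM_neq0 z u z1 u1; have := one_subM_neq0 w u w1 u1.
  rewrite !conjc_szego; move: zw'; move: (h u) (conjc u) => a t h0 h1 h2.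
  field; by rewrite h0 h1 h2.
have ii : dintegrable (fun u => z * (h u * conjc (szego z u)) - w * (h u * conjc (szego w u))).
  by apply: (cintegrableB _ _ mD); exact: cintegrableZ.
rewrite (_ : dint _ = (z - w)^-1 * dint (fun u => z * (h u * conjc (szego z u)) - w * (h u * conjc (szego w u)))).
  by rewrite mulrA divff ?mul1r.
rewrite /dint -cintZ//; apply: eq_cint => p /set_mem pD; exact: pt.
Qed.

Lemma scrQ_offdiag_series h z w : dintegrable h -> cnorm z < 1 -> cnorm w < 1 ->
  cnorm (\sum_(n < N) z * w * dint (fun u => h u * conjc u ^+ n) * (z ^+ n.+1 - w ^+ n.+1) -
    (z - w) * scrQ (mul_op h) z w) @[N --> \oo] --> (0 : R).
Proof.
move=> ih z1 w1; rewrite scrQ_offdiag//.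
have [_ sz] := szego_int_series h z ih z1; have [_ sw] := szego_int_series h w ih w1.
pose mo n := dint (fun u => h u * conjc u ^+ n).
apply: (squeeze0D _ _ _ _ _ (cvg0Z (cnorm (z * w * z)) _ sz) (cvg0Z (cnorm (z * w * w)) _ sw)).
  by move=> n; exact: cnorm_ge0.
move=> n; have -> : \sum_(j < n) z * w * mo j * (z ^+ j.+1 - w ^+ j.+1) =
    z * w * (z * \sum_(j < n) z ^+ j * mo j - w * \sum_(j < n) w ^+ j * mo j).
  rewrite !mulr_sumr -sumrB mulr_sumr; apply: eq_bigr => j _; rewrite !exprS.
  move: (mo j) (z ^+ j) (w ^+ j) => a b c; ring.
rewrite -!cnormM; apply: le_trans (cnormB _ _); rewrite le_eqVlt; apply/orP; left; apply/eqP.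
congr cnorm; move: (szego_int h z) (szego_int h w) (\sum_(j < n) _) (\sum_(j < n) _) => a b c e; ring.
Qed.

(** Partial fractions degenerate for w = z. The two kernels multiply to (1 - z conj u)^-2 instead,
    whose expansion has the coefficients j + 1. *)
Lemma scrQ_diag_series h z : dintegrable h -> cnorm z < 1 ->
  cnorm (\sum_(n < N) z ^+ 2 * (n.+1%:R * dint (fun u => h u * conjc u ^+ n) * z ^+ n) -
    scrQ (mul_op h) z z) @[N --> \oo] --> (0 : R).
Proof.
move=> ih z1; have [i s] := pairing_dilate h _ _ (conjc z) ih geo2_taylor (conjc_disk z z1).
apply: (squeeze0 _ _ _ _ (cvg0Z (cnorm (z ^+ 2)) _ s)) => n; first exact: cnorm_ge0.
rewrite -cnormM mulrBr le_eqVlt; apply/orP; left; apply/eqP; congr (cnorm (_ - _)).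
  rewrite mulr_sumr; apply: eq_bigr => j _; rewrite conjcM -conjcX conjcK.
  rewrite (_ : conjc j.+1%:R = j.+1%:R); last exact: rmorph_nat.
  move: (dint _) (z ^+ j) => a b; congr (_ * _); ring.
rewrite /scrQ expr2; congr (_ * _); apply: eq_cint => p /set_mem pD; rewrite /= /mul_op.
rewrite -mulrA; congr (_ * _); rewrite conj_conjc -conjcM; congr conjc.
by rewrite /szego conj_conjc -invfM -expr2.
Qed.

End ScrQ.

(** * Integrability of the Bergman projection *)

Section Bessel.
Context {R : realType}.
Local Notation C := R[i].
Local Notation P := (measurableTypeR R * measurableTypeR R)%type.
Local Notation dA := (@dA R).
Local Notation D := (@plane_disk R).
Implicit Types (f g h : C -> C) (z w u : C) (c : nat -> C).

Let mD : measurable D. Proof. exact: measurable_plane_disk. Qed.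

Lemma climit_unique (s : nat -> C) (x y : C) :
  cnorm (s n - x) @[n --> \oo] --> (0 : R) ->
  cnorm (s n - y) @[n --> \oo] --> (0 : R) -> x = y.
Proof.
move=> sx sy; apply/eqP; rewrite -subr_eq0 -cnorm_eq0 eq_le cnorm_ge0 andbT.
have h : cnorm (s n - x) + cnorm (s n - y) @[n --> \oo] --> (0 : R).
  by rewrite -[X in _ --> X]addr0; exact: cvgD.
apply: (cvg0_le0 _ _ h) => n; rewrite [cnorm (s n - x)]cdistC.
apply: le_trans (cnormD _ _); rewrite le_eqVlt; apply/orP; left; apply/eqP.
by congr cnorm; move: (s n) => t; ring.
Qed.

Lemma cnorm_subX z w (r : R) j : cnorm z <= r -> cnorm w <= r ->
  cnorm (z ^+ j.+1 - w ^+ j.+1) <= j.+1%:R * r ^+ j * cnorm (z - w).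
Proof.
move=> zr wr; have r0 : 0 <= r by apply: le_trans zr; exact: cnorm_ge0.
elim: j => [|j IH]; first by rewrite !expr1 expr0 !mul1r.
have -> : z ^+ j.+2 - w ^+ j.+2 = z * (z ^+ j.+1 - w ^+ j.+1) + (z - w) * w ^+ j.+1.
  by rewrite !exprS; ring.
apply: le_trans (cnormD _ _) _; rewrite !cnormM cnormX.
have h1 : cnorm z * cnorm (z ^+ j.+1 - w ^+ j.+1) <= r * (j.+1%:R * r ^+ j * cnorm (z - w)).
  by apply: ler_pM => //; exact: cnorm_ge0.
have h2 : cnorm (z - w) * cnorm w ^+ j.+1 <= cnorm (z - w) * r ^+ j.+1.
  by apply: ler_wpM2l; [exact: cnorm_ge0|apply: lerXn2r => //; rewrite nnegrE ?cnorm_ge0].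
apply: le_trans (lerD h1 h2) _; rewrite le_eqVlt; apply/orP; left; apply/eqP.
rewrite -[j.+2%:R]natr1 exprS; move: (cnorm (z - w)) (r ^+ j) (j.+1%:R : R) => a b e; ring.
Qed.

(** The partial sums are Lipschitz on a smaller disk with one common constant, which passes to the
    limit. *)
Lemma has_taylor_ccont f c z : has_taylor f c -> cnorm z < 1 -> ccont f z.
Proof.
move=> [hc hf] z1 e e0; pose r := (1 + cnorm z) / 2; pose s := (1 + r) / 2.
have z0 := cnorm_ge0 z.
have r0 : 0 < r by rewrite /r; lra.
have zr : cnorm z < r by rewrite /r; lra.
have rs : r < s by rewrite /s /r; lra.
have s0 : 0 < s by exact: lt_trans rs.
have s1 : s < 1 by rewrite /s /r; lra.
have s01 : (0 : R) < s < 1 by rewrite s0.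
have [M hM] := hc s s01.
have M0 : 0 <= M by have := le_trans (cnorm_ge0 _) (hM 0%N); rewrite expr0 divr1.
have q0 : 0 <= r / s by apply: divr_ge0; exact: ltW.
have q1 : r / s < 1 by rewrite ltr_pdivrMr// mul1r.
have [K K0 [p /andP[p0 p1] hp]] := natX_lt _ q0 q1.
(* The j-th term is at most (M / s^j) j r^(j-1) |w - z| = (M / r) j (r / s)^j |w - z|; the sum over
   j gives [L]. *)
pose L := M / r * (K * (1 - p)^-1).
have L0 : 0 <= L.
  by rewrite /L !mulr_ge0 ?invr_ge0 ?subr_ge0//; exact: ltW.
have lip w : cnorm w < r -> cnorm (f w - f z) <= L * cnorm (w - z).
  move=> wr; have w1 : cnorm w < 1 by apply: lt_trans wr (lt_trans rs s1).
  rewrite -subr_le0.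
  have h : cnorm (\sum_(j < n) c j * w ^+ j - f w) + cnorm (\sum_(j < n) c j * z ^+ j - f z)
      @[n --> \oo] --> (0 : R).
    by rewrite -[X in _ --> X]addr0; apply: cvgD; exact: hf.
  apply: (cvg0_le0 _ _ h) => n; rewrite lerBlDr.
  have hs : cnorm (\sum_(j < n) c j * w ^+ j - \sum_(j < n) c j * z ^+ j) <= L * cnorm (w - z).
    rewrite -sumrB; apply: le_trans (cnorm_sum _ _ _ _) _.
    apply: (@le_trans _ _ (\sum_(j < n) M / r * K * cnorm (w - z) * p ^+ j)); last first.
      have -> : L * cnorm (w - z) = M / r * K * cnorm (w - z) * (1 - p)^-1.
        by rewrite /L !mulrA mulrAC.
      rewrite -mulr_sumr; apply: ler_wpM2l; last exact: geo_le.
      by rewrite !mulr_ge0 ?invr_ge0 ?cnorm_ge0//; exact: ltW.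
    apply: ler_sum => -[j /= _] _; rewrite -mulrBr cnormM.
    case: j => [|j].
      by rewrite !expr0 subrr cnorm0 mulr0 mulr1 !mulr_ge0 ?invr_ge0 ?cnorm_ge0//; exact: ltW.
    have h1 := cnorm_subX w z r j (ltW wr) (ltW zr).
    apply: le_trans (ler_pM (cnorm_ge0 _) (cnorm_ge0 _) (hM j.+1) h1) _.
    have h2 := hp j.+1.
    have h3 : j.+1%:R * (r / s) ^+ j.+1 <= K * p ^+ j.+1.
      apply: le_trans h2; apply: ler_wpM2r; first exact: exprn_ge0.
      by rewrite ler_nat.
    have h4 : 0 <= M / r * cnorm (w - z) by rewrite !mulr_ge0 ?invr_ge0 ?cnorm_ge0//; exact: ltW.
    have := ler_wpM2l h4 h3; rewrite expr_div_n.
    have -> : M / r * cnorm (w - z) * (j.+1%:R * (r ^+ j.+1 / s ^+ j.+1)) =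
        M / s ^+ j.+1 * (j.+1%:R * r ^+ j * cnorm (w - z)).
      have rn : r != 0 by rewrite gt_eqF.
      have sn : s ^+ j.+1 != 0 by rewrite expf_neq0// gt_eqF.
      rewrite exprS; move: (cnorm (w - z)) (r ^+ j) (s ^+ j.+1) sn => a b d dn.
      by field; rewrite rn dn.
    by move=> h5; apply: le_trans h5 _; rewrite le_eqVlt; apply/orP; left; apply/eqP; ring.
  set x := \sum_(j < n) _ in hs *; set y := \sum_(j < n) _ in hs *.
  have -> : f w - f z = (f w - x) + (x - y) + (y - f z) by ring.
  apply: le_trans (cnormD _ _) _; apply: le_trans (lerD (cnormD _ _) (lexx _)) _.
  by rewrite [cnorm (f w - x)]cdistC; move: hs; lra.
have eL : 0 < e / (L + 1) by rewrite divr_gt0// ltr_wpDl.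
exists (Num.min (r - cnorm z) (e / (L + 1))); first by rewrite lt_min eL subr_gt0 zr.
move=> w; rewrite lt_min => /andP[h1 h2].
have wr : cnorm w < r.
  by apply: le_lt_trans (cdist_le w z) _; rewrite addrC -ltrBrDr.
apply: le_lt_trans (lip w wr) _.
move: h2; rewrite ltr_pdivlMr ?ltr_wpDl// => h2; apply: le_lt_trans h2.
by rewrite mulrC ler_wpM2l ?cnorm_ge0// lerDl.
Qed.

Definition psum c n z := \sum_(k < n) c k * z ^+ k.

Lemma dmeasurable_psum c n : dmeasurable (psum c n).
Proof.
apply: cmeasurable_sum => j; apply: cmeasurableM; first exact: cmeasurable_cst.
by apply: cmeasurableX; exact: cmeasurable_of_plane.
Qed.

Lemma cnorm_psum_le c n z : cnorm z < 1 -> cnorm (psum c n z) <= \sum_(k < n) cnorm (c k).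
Proof.
move=> z1; apply: le_trans (cnorm_sum _ _ _ _) _; apply: ler_sum => k _.
by rewrite cnormM cnormX ler_piMr ?cnorm_ge0// exprn_ile1 ?cnorm_ge0// ltW.
Qed.

Lemma dintegrable_psum c n : dintegrable (psum c n).
Proof. exact: (bounded_dintegrable _ _ (dmeasurable_psum c n) (cnorm_psum_le c n)). Qed.

Lemma dintegrable_moment h k : dintegrable h -> dintegrable (fun z => h z * conjc z ^+ k).
Proof.
move=> ih; apply: (dintegrableM _ _ 1) => //.
  by apply: cmeasurableX; apply: cmeasurableJ; exact: cmeasurable_of_plane.
by move=> z z1; rewrite cnormX cnormJ exprn_ile1 ?cnorm_ge0// ltW.
Qed.

Lemma dint_conj_psum h c n : dintegrable h ->
  dint (fun z => h z * conjc (psum c n z)) =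
  \sum_(k < n) conjc (c k) * dint (fun z => h z * conjc z ^+ k).
Proof.
move=> ih; have im k := dintegrable_moment h k ih.
transitivity (dint (fun z => \sum_(k < n) conjc (c k) * (h z * conjc z ^+ k))).
  apply: eq_cint => p _; rewrite /= /psum conjc_sum mulr_sumr; apply: eq_bigr => k _.
  by rewrite conjcM conjcX mulrCA.
rewrite /dint cint_sum//; last by move=> k; apply: cintegrableZ => //; exact: im.
by apply: eq_bigr => k _; rewrite -cintZ//; exact: im.
Qed.

Lemma psum_moment c n k : (k < n)%N ->
  dint (fun z => psum c n z * conjc z ^+ k) = c k * (k.+1%:R^-1)%:C.
Proof.
move=> kn; transitivity (dint (fun z => \sum_(j < n) c j * mono j k z)).
  by apply: eq_cint => p _; rewrite /= /psum mulr_suml; apply: eq_bigr => j _; rewrite mulrA.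
rewrite /dint cint_sum//; last by move=> j; apply: cintegrableZ => //; exact: dintegrable_mono.
rewrite (eq_bigr (fun j : 'I_n => c j * dint (mono j k))) => [|j _]; last first.
  by rewrite -cintZ//; exact: dintegrable_mono.
rewrite (bigD1 (Ordinal kn))//= dint_mono_eq big1 ?addr0// => j jk.
by rewrite dint_mono_neq ?mulr0//.
Qed.

(* With s := sum (k+1)|m_k|^2 one has s = int mu (conj S) <= int |S|
   <= int (1 + |S|^2)/2 = (1 + s)/2, whence s <= 1. *)
Lemma bessel_L1 (mu : C -> C) n : dmeasurable mu -> (forall z, cnorm z < 1 -> cnorm (mu z) <= 1) ->
  \int[dA]_(p in D) cnorm (psum (fun k => k.+1%:R * dint (fun z => mu z * conjc z ^+ k)) n (of_plane p)) <= 1.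
Proof.
move=> mmu mu1; have imu := bounded_dintegrable _ _ mmu mu1.
pose m k := dint (fun z => mu z * conjc z ^+ k); pose c k : C := k.+1%:R * m k.
change (\int[dA]_(p in D) cnorm (psum c n (of_plane p)) <= 1).
pose s : R := \sum_(k < n) k.+1%:R * cnorm (m k) ^+ 2.
have sE : \sum_(k < n) conjc (c k) * m k = s%:C.
  rewrite /s (rmorph_sum (real_complex R)); apply: eq_bigr => k _.
  rewrite /c conjcM -mulrA [conjc (m k) * _]mulrC mulcJ [RHS]RCM.
  congr (_ * _); rewrite (rmorph_nat (real_complex R)); exact: rmorph_nat.
have e1 : dint (fun z => mu z * conjc (psum c n z)) = s%:C by rewrite dint_conj_psum// sE.
have iS := dintegrable_psum c n.
have e2 : dint (fun z => psum c n z * conjc (psum c n z)) = s%:C.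
  rewrite dint_conj_psum// -sE; apply: eq_bigr => k _; congr (_ * _).
  rewrite psum_moment// /c mulrAC RCV (rmorph_nat (real_complex R)) divff ?mul1r//.
have mS := dmeasurable_psum c n.
have iSS : dintegrable (fun z => psum c n z * conjc (psum c n z)).
  apply: (dintegrableM _ _ (\sum_(k < n) cnorm (c k))) => //; first exact: cmeasurableJ.
  by move=> z z1; rewrite cnormJ; exact: cnorm_psum_le.
have nS := cintegrable_norm _ _ mD _ iS.
have i2 : dA.-integrable D (EFin \o (fun p => cnorm (psum c n (of_plane p)) ^+ 2)).
  apply: eq_integrable iSS.1 => // p _; rewrite /= mulcJ //.
have s2 : \int[dA]_(p in D) cnorm (psum c n (of_plane p)) ^+ 2 = s.
  transitivity (complex.Re (dint (fun z => psum c n z * conjc (psum c n z)))); last by rewrite e2.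
  by apply: eq_Rintegral => p _; rewrite /= mulcJ.
have le1 : s <= \int[dA]_(p in D) cnorm (psum c n (of_plane p)).
  have imS : dintegrable (fun z => mu z * conjc (psum c n z)).
    apply: (dintegrableM _ _ (\sum_(k < n) cnorm (c k))) => //; first exact: cmeasurableJ.
    by move=> z z1; rewrite cnormJ; exact: cnorm_psum_le.
  have := cnorm_cint_le _ _ mD _ imS; rewrite [cint _ _ _]e1 cnormR => h.
  apply: le_trans (ler_norm _) (le_trans h _); apply: le_Rintegral => //.
    exact: (cintegrable_norm _ _ mD _ imS).
  by move=> p pD; rewrite /= cnormM cnormJ ler_piMl ?cnorm_ge0// mu1.
have le2 : \int[dA]_(p in D) cnorm (psum c n (of_plane p)) <= 2^-1 * (1 + s).
  have i1 := integrable_cst_disk (1 : R).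
  have i12 : dA.-integrable D (EFin \o (fun p => 1 + cnorm (psum c n (of_plane p)) ^+ 2)).
    by apply: eq_integrable (integrableD mD i1 i2).
  have e3 : \int[dA]_(p in D) (2^-1 * (1 + cnorm (psum c n (of_plane p)) ^+ 2)) = 2^-1 * (1 + s).
    rewrite RintegralZl//; congr (_ * _); rewrite (RintegralD mD i1 i2) s2; congr (_ + _).
    exact: Rintegral_cst_disk.
  rewrite -e3; apply: le_Rintegral => //.
    by apply: eq_integrable (integrableZl mD 2^-1 i12).
  move=> p _; move: (cnorm _) => x; have := sqr_ge0 (x - 1); rewrite sqrrB mulr1 expr1n; lra.
by move: le1 le2; lra.
Qed.

(** [g] is the Bergman projection of [mu] and may be unbounded. Its Taylor sums have L^1 norm at
    most 1 uniformly in n, which Fatou's lemma turns into integrability. *)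
Lemma bessel_integrable (mu g : C -> C) : dmeasurable mu ->
  (forall z, cnorm z < 1 -> cnorm (mu z) <= 1) ->
  has_taylor g (fun k => k.+1%:R * dint (fun z => mu z * conjc z ^+ k)) -> dintegrable g.
Proof.
move=> mmu mu1 [_ tg]; pose c k : C := k.+1%:R * dint (fun z => mu z * conjc z ^+ k).
have mg : dmeasurable g.
  apply: (cmeasurable_lim D (fun n => psum c n \o of_plane)) => //.
    by move=> n; exact: dmeasurable_psum.
  by move=> p pD; exact: tg.
have mgn := measurable_cnorm _ _ mg.
suff h : (\int[dA]_(p in D) (cnorm (g (of_plane p)))%:E < +oo)%E.
  apply: (cintegrable_le _ _ mD _ (fun p => cnorm (g (of_plane p)))) => //.
  apply/integrableP; split; first exact/measurable_EFinP.
  by under eq_integral do rewrite /= ger0_norm ?cnorm_ge0//.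
have F := @fatou _ _ _ dA D mD (fun n p => (cnorm (psum c n (of_plane p)))%:E).
have mS n := measurable_cnorm _ _ (dmeasurable_psum c n).
have := F (fun n => (measurable_EFinP _ _).2 (mS n)) (fun n p _ => ltac:(by rewrite lee_fin cnorm_ge0)).
have -> : (\int[dA]_(p in D) limn_einf (fun n => (cnorm (psum c n (of_plane p)))%:E) =
    \int[dA]_(p in D) (cnorm (g (of_plane p)))%:E)%E.
  apply: eq_integral => p /set_mem pD; apply: (cvg_limn_einf_sup _).1.
  apply: cvg_EFin; first exact: nearW.
  apply/cvgrPdist_lt => e e0; have /cvgr0Pnorm_lt/(_ _ e0) := tg _ pD; apply: filterS => n.
  rewrite ger0_norm ?cnorm_ge0//; apply: le_lt_trans; rewrite /= ler_norml.
  have h1 := cdist_le (psum c n (of_plane p)) (g (of_plane p)).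
  have h2 := cdist_le (g (of_plane p)) (psum c n (of_plane p)).
  rewrite cdistC in h2; apply/andP; split; [move: h1|move: h2]; rewrite -/(psum c n _); lra.
move=> h; apply: (le_lt_trans h).
apply: (@le_lt_trans _ _ 1%E); last exact: ltry.
rewrite limn_einf_lim; apply: lime_le; first exact: is_cvg_einfs.
apply: nearW => n; apply: (@le_trans _ _ (\int[dA]_(p in D) (cnorm (psum c n (of_plane p)))%:E)%E).
  by apply: ereal_inf_lbound; exists n => //=.
have iS := integrable_fin_num mD (cintegrable_norm _ _ mD _ (dintegrable_psum c n)).
by rewrite -[leLHS]fineK// lee_fin; exact: bessel_L1.
Qed.

End Bessel.

(** * Limits of dilated pairings *)

Section DilatedPairing.
Context {R : realType}.
Local Notation C := R[i].
Local Notation P := (measurableTypeR R * measurableTypeR R)%type.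
Local Notation dA := (@dA R).
Local Notation D := (@plane_disk R).
Implicit Types (f g h : C -> C) (z w u : C) (c : nat -> C).

Let mD : measurable D. Proof. exact: measurable_plane_disk. Qed.

Lemma cnorm_dint_le1 f g : dmeasurable f -> (forall z, cnorm z < 1 -> cnorm (f z) <= 1) ->
  dintegrable g -> cnorm (dint (fun z => f z * g z)) <= \int[dA]_(p in D) cnorm (g (of_plane p)).
Proof.
move=> mf f1 ig; have ifg : dintegrable (fun z => f z * g z).
  exact: (cintegrableM_bounded dA D mD _ _ 1 mf (fun p pD => f1 _ pD) ig).
apply: le_trans (cnorm_cint_le _ _ mD _ ifg) _; apply: le_Rintegral => //.
- exact: (cintegrable_norm _ _ mD _ ifg).
- exact: (cintegrable_norm _ _ mD _ ig).
- by move=> p pD; rewrite /= cnormM ler_piMl ?cnorm_ge0// f1.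
Qed.

Lemma A1normE f : dintegrable f -> A1norm f = (\int[dA]_(p in D) cnorm (f (of_plane p)))%:E.
Proof.
by move=> If; rewrite /Rintegral fineK//; exact: integrable_fin_num (cintegrable_norm _ _ mD _ If).
Qed.

Lemma A1_taylor f : A1 f -> dintegrable f /\ exists c, has_taylor f c.
Proof.
move=> [df If]; have [c [tf _]] := taylor_disk f df; split; last by exists c.
have mf : dmeasurable f.
  apply: (cmeasurable_lim D (fun n => psum c n \o of_plane)) => //.
    by move=> n; exact: dmeasurable_psum.
  by move=> p pD; exact: tf.2.
have mn := measurable_cnorm _ _ mf.
apply: (cintegrable_le _ _ mD _ (fun p => cnorm (f (of_plane p)))) => //.
apply/integrableP; split; first exact/measurable_EFinP.
by under eq_integral do rewrite /= ger0_norm ?cnorm_ge0//.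
Qed.

Lemma dilate_pairing_limit mu f : dmeasurable mu ->
  (forall z, cnorm z < 1 -> cnorm (mu z) <= 1) -> dintegrable f ->
  (forall z, cnorm z < 1 -> ccont f z) ->
  (fun r : R => dint (fun z => mu z * conjc (f (r%:C * z)))) r @[r --> (1 : R)^'-] -->
    dint (fun z => mu z * conjc (f z)).
Proof.
move=> mmu mu1 If cf.
pose phi r := cnorm (dint (fun z => mu z * conjc (f z)) - dint (fun z => mu z * conjc (f (r%:C * z)))).
have conjI g : dintegrable g -> dintegrable (fun z => mu z * conjc (g z)).
  move=> ig; apply: (cintegrableM_bounded dA D mD _ _ 1 mmu (fun p pD => mu1 _ pD)).
  exact: (cintegrableJ _ _ mD _ ig).
have key : phi r @[r --> (1 : R)^'-] --> (0 : R).
  apply/cvg_at_leftP => u [ult u1].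
  (* A sequence tending to 1 from below may start with nonpositive terms; the maximum with 1/2 makes
     dilation legitimate and agrees with [u] eventually. *)
  pose v n : R := Num.max (u n) 2^-1.
  have h2 : (2^-1 : R) < 1 by rewrite invf_lt1 ?ltr1n.
  have v01 n : 0 < v n < 1.
    by rewrite /v lt_max invr_gt0 ltr0n orbT gt_max ult h2.
  have v1 : v n @[n --> \oo] --> (1 : R).
    apply/cvgrPdist_lt => e e0; move/cvgrPdist_lt : u1 => /(_ _ e0); apply: filterS => n.
    have un := ult n; have /andP[_ vn] := v01 n.
    rewrite !gtr0_norm ?subr_gt0//; apply: le_lt_trans; rewrite lerD2l lerN2.
    by rewrite /v le_max lexx.
  have fv z : cnorm z < 1 -> cnorm (f ((v n)%:C * z) - f z) @[n --> \oo] --> (0 : R).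
    move=> z1; apply/cvgr0Pnorm_lt => e e0; have [d d0 hd] := cf z z1 e e0.
    have /cvgrPdist_lt/(_ _ d0) := v1; apply: filterS => n ud.
    rewrite ger0_norm ?cnorm_ge0//; apply: hd.
    rewrite -{2}[z]mul1r -mulrBl cnormM -[1]/(1%:C) -RCB cnormR distrC.
    by apply: le_lt_trans ud; rewrite ler_piMr// ltW.
  have L1 := dilation_L1 f v If v01 v1 fv.
  have Ifv n : dintegrable (fun z => f ((v n)%:C * z)) by exact: dilate_integrable.
  have phi_le n : phi (v n) <= \int[dA]_(p in D) cnorm (f ((v n)%:C * of_plane p) - f (of_plane p)).
    have e : dint (fun z => mu z * conjc (f z)) - dint (fun z => mu z * conjc (f ((v n)%:C * z))) =
        dint (fun z => mu z * conjc (f z - f ((v n)%:C * z))).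
      rewrite /dint -cintB//; [|exact: conjI|exact: (conjI (fun z => f ((v n)%:C * z)))].
      by apply: eq_cint => p _; rewrite /= conjcB mulrBr.
    rewrite /phi e; apply: le_trans (cnorm_dint_le1 mu (fun z => conjc (f z - f ((v n)%:C * z))) mmu mu1 _) _.
      by apply: (cintegrableJ _ _ mD); apply: (cintegrableB _ _ mD) => //; exact: Ifv.
    rewrite le_eqVlt; apply/orP; left; apply/eqP; apply: eq_Rintegral => p _.
    by rewrite cnormJ cdistC.
  have h : phi (v n) @[n --> \oo] --> (0 : R).
    by apply: (squeeze0 _ _ _ phi_le L1) => n; exact: cnorm_ge0.
  apply: cvg_trans h; apply: near_eq_cvg.
  have half_gt0 : (0 : R) < 1 - 2^-1 by rewrite subr_gt0.
  move/cvgrPdist_lt : u1 => /(_ _ half_gt0); apply: filterS => n.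
  rewrite gtr0_norm ?subr_gt0// ltrD2l ltrN2 => un.
  by rewrite /v max_l// ltW.
apply/cvg_cnormP => e e0; move/cvgr0Pnorm_lt : key => /(_ _ e0).
by apply: filterS => r; rewrite ger0_norm ?cnorm_ge0.
Qed.

Lemma A1_psum c n : A1 (psum c n).
Proof.
split.
  move=> z _; suff [l h] : exists l, cderiv (psum c n) z l by have [] := (cderivP _ _ _).1 h.
  have dX k : exists l, cderiv (fun u => u ^+ k) z l.
    elim: k => [|k [l h]]; first by exists 0; exact: cderiv_cst.
    exists (z * l + z ^+ k * 1); rewrite (_ : (fun u => u ^+ k.+1) = (fun u => u * u ^+ k)).
      exact: (cderivM (fun u => u) (fun u => u ^+ k)) (cderiv_id z) h.
    by apply/funext => u; rewrite exprS.
  elim: n => [|n [l h]].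
    exists 0; rewrite (_ : psum c 0 = fun=> 0); first exact: cderiv_cst.
    by apply/funext => u; rewrite /psum big_ord0.
  have [l' h'] := dX n; exists (l - (- c n) * l').
  rewrite (_ : psum c n.+1 = fun u => psum c n u - (- c n) * u ^+ n).
    exact: cderivB h (cderivZ _ _ _ _ h').
  by apply/funext => u; rewrite /psum big_ord_recr /= mulNr opprK.
by rewrite A1normE ?ltry//; exact: dintegrable_psum.
Qed.

(** [diag Q] with its removable singularity filled in: for a = m_0 it has a Taylor series on the
    whole disk, which [diag Q] lacks unless m_0 = 0. *)
Definition full_diag (Q : C -> C -> C) (a : C) z : C := if z == 0 then a else diag Q z.

Lemma dmeasurable_neq0 : dmeasurable (fun z => if z == 0 then 0 else 1 : C).
Proof.
pose A : set P := [set 0] `*` [set 0].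
have mA' : measurable A by apply: measurableX; exact: measurable_set1.
have mA : measurable (~` A) by exact: measurableC.
have mI : measurable_fun D (\1_(~` A) : P -> R) by exact: measurable_indic.
rewrite /dmeasurable (_ : _ \o _ = fun p => (\1_(~` A) p)%:C).
  by split; [exact: mI|exact: measurable_cst].
apply/funext => p; rewrite /= indicE; case: eqP => [e|ne].
  rewrite memNset//= => h; apply: h; split.
    by have := congr1 (@complex.Re R) e.
  by have := congr1 (@complex.Im R) e.
rewrite mem_set//= => -[h1 h2]; apply: ne; apply: complex_ext => //=.
Qed.

Lemma diagE (Q : C -> C -> C) a z : diag Q z = full_diag Q a z * (if z == 0 then 0 else 1).
Proof.
rewrite /full_diag; case: eqP => [->|_]; last by rewrite mulr1.
by rewrite mulr0 /diag expr0n invr0 mul0r.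
Qed.

Lemma cnorm_neq0_le1 z : cnorm (if z == 0 then 0 else 1 : C) <= 1.
Proof. by case: ifP => _; rewrite ?cnorm0 ?cnorm1. Qed.

Lemma dint_diag (Q : C -> C -> C) a h :
  dintegrable (fun z => full_diag Q a z * h z) ->
  dintegrable (fun z => diag Q z * h z) /\
  dint (fun z => diag Q z * h z) = dint (fun z => full_diag Q a z * h z).
Proof.
move=> ih; have id : dintegrable (fun z => diag Q z * h z).
  have := dintegrableM _ _ 1 ih dmeasurable_neq0 (fun z _ => cnorm_neq0_le1 z).
  by apply: eq_cintegrable => // p _; rewrite /= (diagE Q a) mulrAC.
split => //; apply: ae_eq_cint => //.
- exact: cintegrable_measurable id.
- exact: cintegrable_measurable ih.
by apply: filterS (@ae_neq0 R) => p p0 _; rewrite /= (diagE Q a) (negbTE p0) mulr1.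
Qed.

End DilatedPairing.

(** * The two implications *)

Section Main.
Context {R : realType}.
Local Notation C := R[i].
Local Notation P := (measurableTypeR R * measurableTypeR R)%type.
Local Notation dA := (@dA R).
Local Notation D := (@plane_disk R).
Variable Q : C -> C -> C.
Hypotheses (holQ : holomorphic_bidisk Q)
  (Qz0 : forall z, disk z -> Q z 0 = 0) (Q0w : forall w, disk w -> Q 0 w = 0)
  (waveQ : damped_wave Q).

Let mD : measurable D. Proof. exact: measurable_plane_disk. Qed.
Let moment (h : C -> C) n := dint (fun z => h z * conjc z ^+ n).

Lemma full_diag_taylor (m : nat -> C) : geo_bounded m ->
  (forall z, disk z -> z != 0 ->
     cnorm (\sum_(n < N) n.+1%:R * m n * z ^+ n - diag Q z) @[N --> \oo] --> (0 : R)) ->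
  has_taylor (full_diag Q (m 0%N)) (fun k => k.+1%:R * m k).
Proof.
move=> gm hm; split.
  have := geo_boundedB _ _ (geo_bounded_natM _ gm) (geo_boundedZ (-1) _ gm).
  rewrite (_ : (fun j => _) = (fun j => j.+1%:R * m j))//.
  by apply/funext => j; rewrite mulN1r opprK -natr1 mulrDl mul1r.
move=> z z1; rewrite /full_diag; case: eqP => [->|/eqP z0]; last exact: hm.
rewrite -cvg_shiftS; apply: (squeeze0 _ (fun=> 0) _ _ (cvg_cst _)) => n; first exact: cnorm_ge0.
rewrite /= big_ord_recl /= expr0 mulr1 mul1r big1 => [|i _]; last first.
  by rewrite /= exprS mul0r mulr0.
by rewrite addr0 subrr cnorm0.
Qed.

Lemma scrQ_moments (mu : C -> C) (b m : nat -> C) : dmeasurable mu ->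
  (forall z, cnorm z < 1 -> cnorm (mu z) <= 1) ->
  (forall z w, disk z -> disk w -> Q z w = scrQ (mul_op mu) z w) ->
  has_taylor (trace_fun Q) b -> (forall n, b n.+2 = - half * m n) ->
  forall n, m n = moment mu n.
Proof.
move=> mmu mu1 QE tb bm n.
have imu := bounded_dintegrable _ _ mmu mu1.
have h2 : cnorm (half : C) < 1 by rewrite /half cnormR ger0_norm ?invr_ge0// invf_lt1 ?ltr1n.
have moment_le k : cnorm (moment mu k) <= 1.
  have ik : dintegrable (fun z : C => conjc z ^+ k).
    by apply: eq_cintegrable (dintegrable_moment (fun=> 1) k (bounded_dintegrable (fun=> 1) 1 (cmeasurable_cst _ _) (fun z _ => ltac:(by rewrite cnorm1)))) => // p _; rewrite /= mul1r.
  apply: le_trans (cnorm_dint_le1 _ _ mmu mu1 ik) _.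
  rewrite -[leRHS](Rintegral_cst_disk (1 : R)); apply: le_Rintegral => //.
  - exact: (cintegrable_norm _ _ mD _ ik).
  - exact: integrable_cst_disk.
  - by move=> p pD; rewrite cnormX cnormJ exprn_ile1 ?cnorm_ge0// ltW.
pose I := szego_int mu.
(* The Taylor coefficients of (half - w) scrQ(half, w), which by [scrQ_offdiag] is half w (half
   I(half) - w I(w)), where I(w) is the sum of the moments times w^k. The linear coefficient
   involves I(half), but the comparison uses only indices from 2 on. *)
pose d j := match j with 0 => 0 | 1 => half * (half * I half) | k.+2 => - half * moment mu k end.
have td : has_taylor (trace_fun Q) d.
  split.
    move=> r /andP[r0 r1]; exists (cnorm (half * (half * I half)) + 1) => j.
    have K0 : 0 <= cnorm (half * (half * I half)) by exact: cnorm_ge0.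
    have dj : cnorm (d j) <= cnorm (half * (half * I half)) + 1.
      case: j => [|[|k]]; first by rewrite cnorm0 addr_ge0.
        by rewrite lerDl.
      change (cnorm (- half * moment mu k) <= cnorm (half * (half * I half)) + 1); rewrite [leLHS]cnormM cnormN; apply: (@le_trans _ _ (1 * 1)).
        by apply: ler_pM; rewrite ?cnorm_ge0// ltW.
      by rewrite mulr1 lerDr.
    apply: le_trans dj _; rewrite ler_pdivlMr ?exprn_gt0//.
    by rewrite ler_piMr ?addr_ge0// exprn_ile1// ltW.
  move=> w w1; have [_ sw] := szego_int_series mu w imu w1.
  rewrite -(cvg_shiftn 2).
  apply: (squeeze0 _ _ _ _ (cvg0Z (cnorm (half * w ^+ 2)) _ sw)) => N; first exact: cnorm_ge0.
  have -> : trace_fun Q w = half * w * (half * I half - w * I w).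
    by rewrite /trace_fun QE// scrQ_offdiag.
  rewrite -cnormM -[leRHS]cnormN le_eqVlt; apply/orP; left; apply/eqP; congr cnorm.
  rewrite /= addn2 !big_ord_recl /= mul0r add0r expr1.
  rewrite (eq_bigr (fun j : 'I_N => - half * w ^+ 2 * (w ^+ j * moment mu j))) => [|j _]; last first.
    rewrite /bump /= !add1n !exprS; move: (w ^+ j) (moment mu j) => s t; ring.
  rewrite -mulr_sumr -[szego_int mu w]/(I w); move: (\sum_(j < N) _) (I half) (I w) half => s t v u; ring.
have := has_taylor_unique _ _ _ tb td n.+2; rewrite bm /d; apply: mulfI.
by rewrite oppr_eq0 -cnorm_eq0 cnormR normr_eq0 invr_eq0 pnatr_eq0.
Qed.

(** Off the diagonal the two series agree and z - w is cancelled. On the diagonal, where this is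
    impossible, the series of [diag Q] takes over, and the origin is settled by the boundary
    condition. *)
Lemma moments_scrQ (mu : C -> C) (m : nat -> C) : dintegrable mu ->
  (forall n, moment mu n = m n) ->
  (forall z w, disk z -> disk w ->
     cnorm (\sum_(n < N) z * w * m n * (z ^+ n.+1 - w ^+ n.+1) - (z - w) * Q z w)
       @[N --> \oo] --> (0 : R)) ->
  (forall z, disk z -> z != 0 ->
     cnorm (\sum_(n < N) n.+1%:R * m n * z ^+ n - diag Q z) @[N --> \oo] --> (0 : R)) ->
  forall z w, disk z -> disk w -> Q z w = scrQ (mul_op mu) z w.
Proof.
move=> imu mE hzw hzz z w z1 w1.
have [<-|zw] := eqVneq z w; last first.
  have h := scrQ_offdiag_series mu z w imu z1 w1.
  have h' : cnorm (\sum_(n < N) z * w * m n * (z ^+ n.+1 - w ^+ n.+1) -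
      (z - w) * scrQ (mul_op mu) z w) @[N --> \oo] --> (0 : R).
    apply: (squeeze0 _ _ _ _ h) => n; first exact: cnorm_ge0.
    rewrite le_eqVlt; apply/orP; left; apply/eqP; congr (cnorm (_ - _)).
    by apply: eq_bigr => j _; rewrite -mE.
  have zw0 : z - w != 0 by rewrite subr_eq0.
  exact: (mulfI zw0 (climit_unique _ _ _ (hzw z w z1 w1) h')).
have [->|z0] := eqVneq z 0.
  have D0 : disk (0 : C) by change (cnorm (0 : C) < 1); rewrite cnorm0.
  by rewrite Qz0// /scrQ !mul0r.
have h := scrQ_diag_series mu z imu z1.
have h' : cnorm (\sum_(n < N) z ^+ 2 * (n.+1%:R * moment mu n * z ^+ n) - Q z z)
    @[N --> \oo] --> (0 : R).
  apply: (squeeze0 _ _ _ _ (cvg0Z (cnorm (z ^+ 2)) _ (hzz z z1 z0))) => n; first exact: cnorm_ge0.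
  rewrite -cnormM mulrBr le_eqVlt; apply/orP; left; apply/eqP; congr (cnorm (_ - _)).
    by rewrite mulr_sumr; apply: eq_bigr => j _; rewrite mE.
  by rewrite /diag mulrA divff ?mul1r// expf_neq0.
exact: (climit_unique _ _ _ h' h).
Qed.

Lemma pairing_of_scrQ : (exists mu : C -> C, Linfty_closed_unit_ball mu /\
     forall z w, disk z -> disk w -> Q z w = scrQ (mul_op mu) z w) ->
  forall f : C -> C, A1 f -> exists L : C, is_dilated_pairing (diag Q) f L /\
       ((cnorm L)%:E <= A1norm f)%E.
Proof.
move=> [mu0 [ball QE0]] f Af.
have [mu [mmu mu1 muE]] := Linfty_ball_representative mu0 ball.
have mu1' z : cnorm z < 1 -> cnorm (mu z) <= 1 by [].
have imu := bounded_dintegrable _ _ mmu mu1'.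
have mS z : cnorm z < 1 -> dmeasurable (fun u : C => conjc (szego z u)).
  move=> z1; have [h _] := dilate_props _ _ (conjc z) geo_taylor (conjc_disk z z1).
  by apply: cmeasurableJ; exact: h.
(* [scrQ] involves the symbol only through integrals against products of Szego kernels, which do not
   see the change from [mu0] to [mu]. *)
have QE z w : disk z -> disk w -> Q z w = scrQ (mul_op mu) z w.
  move=> z1 w1; rewrite QE0//; congr (_ * _).
  have e := muE (fun u => conjc (szego w u) * conjc (szego z u)) (cmeasurableM _ _ _ (mS w w1) (mS z z1)).
  transitivity (dint (fun u => mu0 u * (conjc (szego w u) * conjc (szego z u)))).
    by apply: eq_cint => p _; rewrite /= mulrA.
  by rewrite e; apply: eq_cint => p _; rewrite /= mulrA.
have [b [m [tb bm gm _ hzz]]] := wave_series Q holQ Qz0 Q0w waveQ.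
have mE := scrQ_moments mu b m mmu mu1' QE tb bm.
have tg := full_diag_taylor m gm hzz; set g := full_diag Q (m 0%N) in tg.
have ig : dintegrable g.
  apply: (bessel_integrable mu g mmu mu1').
  by rewrite (_ : (fun k => _) = (fun k => k.+1%:R * m k))//; apply/funext => k; rewrite mE.
have gE k : moment g k = m k.
  rewrite /moment (taylor_moment g _ ig tg (fun z z1 => has_taylor_ccont _ _ z tg z1)).
  by rewrite mulrAC divff ?mul1r// pnatr_eq0.
have [If [c tf]] := A1_taylor f Af.
(* [pairing_dilate] expresses both pairings as limits of sums over moments, which [g] and [mu]
   share. *)
have pE (r : R) : 0 < r < 1 ->
    dintegrable (fun z => diag Q z * conjc (f (r%:C * z))) /\
    dint (fun z => diag Q z * conjc (f (r%:C * z))) = dint (fun z => mu z * conjc (f (r%:C * z))).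
  move=> /andP[r0 r1]; have rC : cnorm (r%:C : C) < 1 by rewrite cnormR gtr0_norm.
  have [i1 s1] := pairing_dilate g f c r%:C ig tf rC.
  have [i2 s2] := pairing_dilate mu f c r%:C imu tf rC.
  have [i3 e3] := dint_diag Q (m 0%N) (fun z => conjc (f (r%:C * z))) i1.
  split => //; rewrite e3; apply: (climit_unique _ _ _ s1).
  apply: (squeeze0 _ _ _ _ s2) => n; first exact: cnorm_ge0.
  rewrite le_eqVlt; apply/orP; left; apply/eqP; congr (cnorm (_ - _)).
  by apply: eq_bigr => j _; congr (_ * _); rewrite -[LHS]/(moment g j) gE mE.
exists (dint (fun z => mu z * conjc (f z))); split; [split|].
- by move=> r r01; exact: (pE r r01).1.
- have h := dilate_pairing_limit mu f mmu mu1' If (fun z z1 => has_taylor_ccont _ _ z tf z1).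
  apply: cvg_trans h; apply: near_eq_cvg.
  have n1 := nbhs_left_gt (ltr01 : (0 : R) < 1); have n2 := nbhs_left_lt (1 : R).
  apply: filterS2 n1 n2 => r r0 r1.
  by have [_ <-] := pE r (ltac:(by rewrite r0 r1)).
- rewrite A1normE// lee_fin.
  apply: le_trans (cnorm_dint_le1 _ _ mmu mu1' (cintegrableJ _ _ mD _ If)) _.
  by rewrite le_eqVlt; apply/orP; left; apply/eqP; apply: eq_Rintegral => p _; rewrite /= cnormJ.
Qed.

Lemma scrQ_of_pairing :
  (forall f : C -> C, A1 f -> exists L : C, is_dilated_pairing (diag Q) f L /\
       ((cnorm L)%:E <= A1norm f)%E) ->
  exists mu : C -> C, Linfty_closed_unit_ball mu /\
     forall z w, disk z -> disk w -> Q z w = scrQ (mul_op mu) z w.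
Proof.
move=> H.
have [b [m [_ _ gm hzw hzz]]] := wave_series Q holQ Qz0 Q0w waveQ.
have tg := full_diag_taylor m gm hzz; set g := full_diag Q (m 0%N) in tg.
(* The constant function f = 1 equals its dilates, so the existence of its pairing already says that
   [diag Q] is integrable. *)
have idiag : dintegrable (diag Q).
  have [L [[hr _] _]] := H _ (A1_psum (fun=> 1) 1).
  have r01 : 0 < (2^-1 : R) < 1 by rewrite invr_gt0 ltr0n invf_lt1 ?ltr1n.
  apply: eq_cintegrable (hr _ r01) => // p _.
  by rewrite /= /psum big_ord1 expr0 mulr1 conj_conjc (rmorph1 (@conjc R)) mulr1.
have ig : dintegrable g.
  (* [g] differs from [diag Q] by m_0 at the origin, written here as a bounded measurable
     function. *)
  have ipt : dintegrable (fun z : C => m 0%N * (1 - (if z == 0 then 0 else 1))).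
    apply: (bounded_dintegrable _ (cnorm (m 0%N) * 2)).
      apply: cmeasurableM; first exact: cmeasurable_cst.
      by apply: cmeasurableB; [exact: cmeasurable_cst|exact: dmeasurable_neq0].
    move=> z _; rewrite cnormM ler_wpM2l ?cnorm_ge0//; apply: le_trans (cnormB _ _) _.
    by rewrite cnorm1 -[leRHS]/(1 + 1) lerD2l cnorm_neq0_le1.
  apply: eq_cintegrable (cintegrableD _ _ mD _ _ idiag ipt) => // p _.
  rewrite /= /g /full_diag; case: eqP => [->|_]; last by rewrite subrr mulr0 addr0.
  by rewrite subr0 mulr1 /diag expr0n invr0 mul0r add0r.
have gE k : moment g k = m k.
  rewrite /moment (taylor_moment g _ ig tg (fun z z1 => has_taylor_ccont _ _ z tg z1)).
  by rewrite mulrAC divff ?mul1r// pnatr_eq0.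
have m_le n (c : nat -> C) : cnorm (\sum_(k < n) m k * conjc (c k)) <=
    \int[dA]_(p in D) cnorm (\sum_(k < n) c k * of_plane p ^+ k).
  have [L [[_ hL] Lle]] := H _ (A1_psum c n).
  move: Lle; rewrite A1normE; last exact: dintegrable_psum.
  rewrite lee_fin => Lle.
  suff -> : \sum_(k < n) m k * conjc (c k) = L by exact: Lle.
  (* The pairing with a dilated polynomial is a finite sum with factors r^k, so its limit as r tends
     to 1 is explicit and must be [L]. *)
  have pE (r : R) : dint (fun z => diag Q z * conjc (psum c n (r%:C * z))) =
      \sum_(k < n) (r ^+ k)%:C * (m k * conjc (c k)).
    have pr z : psum c n (r%:C * z) = psum (fun k => c k * (r ^+ k)%:C) n z.
      apply: eq_bigr => k _; rewrite exprMn mulrA; congr (_ * _ * _).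
      exact/esym/(rmorphXn (real_complex R)).
    have e : (fun z => g z * conjc (psum c n (r%:C * z))) =
        (fun z => g z * conjc (psum (fun k => c k * (r ^+ k)%:C) n z)).
      by apply/funext => z; rewrite pr.
    have i1 : dintegrable (fun z => g z * conjc (psum c n (r%:C * z))).
      rewrite e; apply: (dintegrableM _ _ (\sum_(k < n) cnorm (c k * (r ^+ k)%:C))) => //.
        by apply: cmeasurableJ; exact: dmeasurable_psum.
      by move=> z z1; rewrite cnormJ; exact: cnorm_psum_le.
    have [_ ->] := dint_diag Q (m 0%N) _ i1.
    rewrite -/g e dint_conj_psum//; apply: eq_bigr => k _.
    rewrite -/(moment g k) gE conjcM; have -> : conjc (r ^+ k)%:C = (r ^+ k)%:C :> C.
      by apply: complex_ext; rewrite ?ReJ ?ImJ /= ?oppr0.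
    by rewrite mulrAC mulrC [conjc _ * _]mulrC.
  pose u (j : nat) : R := 1 - j.+2%:R^-1.
  have ult j : u j < 1 by rewrite gtrBl invr_gt0.
  have u1 : u j @[j --> \oo] --> (1 : R).
    rewrite -[X in _ --> X]subr0; apply: cvgB; first exact: cvg_cst.
    have := @cvg_harmonic R; rewrite -(cvg_shiftS); exact.
  (* The left limit at 1 is read along the sequence [u], on which both candidate limits of [F] are
     compared. *)
  pose F r := \sum_(k < n) (r ^+ k)%:C * (m k * conjc (c k)).
  have h1 : cnorm (F (u j) - L) @[j --> \oo] --> (0 : R).
    have h : cnorm (F r - L) @[r --> (1 : R)^'-] --> (0 : R).
      apply/cvgr0Pnorm_lt => e e0; move/cvg_cnormP : hL => /(_ _ e0); apply: filterS => r.
      by rewrite ger0_norm ?cnorm_ge0// cdistC /F -pE.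
    exact: (cvg_at_leftP _ _ _).1 h u (conj ult u1).
  have uk k : (u j) ^+ k @[j --> \oo] --> (1 : R).
    elim: k => [|k IH]; first exact: cvg_cst.
    rewrite -[X in _ --> X]mulr1; under eq_fun do rewrite exprS.
    exact: cvgM u1 IH.
  have h2 : cnorm (F (u j) - \sum_(k < n) m k * conjc (c k)) @[j --> \oo] --> (0 : R).
    have s0 (a : nat -> R) l : \sum_(k < l) a k * `|u j ^+ k - 1| @[j --> \oo] --> (0 : R).
      elim: l => [|k IH].
        by under eq_fun do rewrite big_ord0; exact: cvg_cst.
      rewrite -[X in _ --> X]addr0; under eq_fun do rewrite big_ord_recr /=.
      apply: cvgD; first exact: IH.
      rewrite -[X in _ --> X](mulr0 (a k)); apply: cvgM; first exact: cvg_cst.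
      have h : u j ^+ k - 1 @[j --> \oo] --> (1 - 1 : R) by exact: cvgB (uk k) (cvg_cst _).
      by rewrite subrr in h; have hn := cvg_norm h; rewrite normr0 in hn; exact: hn.
    apply: (squeeze0 _ _ _ _ (s0 (fun k => cnorm (m k * conjc (c k))) n)) => j; first exact: cnorm_ge0.
    rewrite -sumrB; apply: le_trans (cnorm_sum _ _ _ _) _; apply: ler_sum => k _.
    rewrite -[X in _ - X]mul1r -mulrBl [leLHS]cnormM [leLHS]mulrC le_eqVlt; apply/orP; left; apply/eqP.
    by congr (_ * _); rewrite -[1]/(1%:C) -RCB cnormR.
  exact: climit_unique h2 h1.
have [mu [mmu mu1 muE]] := moment_problem m m_le.
exists mu; split; first exact: Linfty_ball_of_bound.
apply: (moments_scrQ mu m) => //.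
exact: (bounded_dintegrable mu 1 mmu (fun z _ => mu1 z)).
Qed.

End Main.

Theorem theorem2p8 (R : realType) (Q : R[i] -> R[i] -> R[i])
    (holQ : holomorphic_bidisk Q)
    (Qz0 : forall z : R[i], disk z -> Q z 0 = 0)
    (Q0w : forall w : R[i], disk w -> Q 0 w = 0)
    (waveQ : damped_wave Q) :
  (exists mu : R[i] -> R[i], Linfty_closed_unit_ball mu /\
     forall z w : R[i], disk z -> disk w -> Q z w = scrQ (mul_op mu) z w)
  <->
  (forall f : R[i] -> R[i], A1 f ->
     exists L : R[i], is_dilated_pairing (diag Q) f L /\
       ((cnorm L)%:E <= A1norm f)%E).
Proof.
by split; [exact: pairing_of_scrQ|exact: scrQ_of_pairing].
Qed.
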